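(* Let $r\ge 3$ and $n>r$ be integers. The affine $v$-Schur algebra $\widehat{\mathbf{S}}_v(n,r)$ (the image of $\mathbf{U}(\widehat{\mathfrak{gl}}_n)$ in $\operatorname{End}_{\mathbb{Q}(v)}(V^{\otimes r})$) is presented, as a $\mathbb{Q}(v)$-algebra, by the generators $E_i,F_i,K_i,K_i^{-1}$ ($1\le i\le n$) (mapping to their actions on $V^{\otimes r}$) subject to relations (Q1)–(Q9) (indices read modulo $n$) together with the relations $$K_1K_2\cdots K_n=v^r \quad\text{(Q15)},\qquad (K_i-1)(K_i-v)(K_i-v^2)\cdots(K_i-v^r)=0\ \ (1\le i\le n)\quad\text{(Q16)}.$$ Equivalently, the kernel of the action map $\mathbf{U}(\widehat{\mathfrak{gl}}_n)\to\operatorname{End}_{\mathbb{Q}(v)}(V^{\otimes r})$ is the two-sided ideal generated by $K_1\cdots K_n-v^r$ and the elements $\prod_{j=0}^r(K_i-v^j)$, $1\le i\le n$.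
   Context: $v$ is an indeterminate. $\mathbf{U}(\widehat{\mathfrak{gl}}_n)$ is the associative unital $\mathbb{Q}(v)$-algebra with generators $E_i,F_i,K_i,K_i^{-1}$ ($1\le i\le n$), indices read modulo $n$, and relations: (Q1) $K_iK_j=K_jK_i$; (Q2) $K_iK_i^{-1}=K_i^{-1}K_i=1$; (Q3) $K_iE_j=v^{\epsilon^+(i,j)}E_jK_i$; (Q4) $K_iF_j=v^{\epsilon^-(i,j)}F_jK_i$; (Q5) $E_iF_j-F_jE_i=\delta_{ij}\frac{K_iK_{i+1}^{-1}-K_i^{-1}K_{i+1}}{v-v^{-1}}$; (Q6) $E_iE_j=E_jE_i$ and (Q7) $F_iF_j=F_jF_i$ whenever $i-j\not\equiv\pm1 \pmod n$; (Q8) $E_i^2E_j-(v+v^{-1})E_iE_jE_i+E_jE_i^2=0$ and (Q9) $F_i^2F_j-(v+v^{-1})F_iF_jF_i+F_jF_i^2=0$ whenever $i-j\equiv\pm1\pmod n$. Here $\epsilon^+(i,j)=1$ if $j=i$, $-1$ if $j\equiv i-1\pmod n$, $0$ otherwise, and $\epsilon^-(i,j)=-\epsilon^+(i,j)$. Let $V$ be the $\mathbb{Q}(v)$-vector space with basis $\{e_t:t\in\mathbb{Z}\}$, with $\mathbf{U}(\widehat{\mathfrak{gl}}_n)$-action: $E_ie_{t+1}=e_t$ if $i\equiv t\pmod n$ and $0$ otherwise; $F_ie_t=e_{t+1}$ if $i\equiv t \pmod n$ and $0$ otherwise; $K_ie_t=ve_t$ if $i\equiv t\pmod n$ and $e_t$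 otherwise. The tensor space $V^{\otimes r}$ is a module via the iterated comultiplication $\Delta(E_i)=E_i\otimes K_iK_{i+1}^{-1}+1\otimes E_i$, $\Delta(F_i)=K_i^{-1}K_{i+1}\otimes F_i+F_i\otimes 1$, $\Delta(K_i^{\pm1})=K_i^{\pm1}\otimes K_i^{\pm1}$. $\widehat{\mathbf{S}}_v(n,r)$ denotes the image of $\mathbf{U}(\widehat{\mathfrak{gl}}_n)$ in $\operatorname{End}_{\mathbb{Q}(v)}(V^{\otimes r})$; for $n>r$ this is the (scalar-extended) affine $q$-Schur algebra with $q=v^2$. *)

(* Defs.v *)
From HB Require Import structures.
From mathcomp Require Import all_boot all_order all_algebra.
Set Implicit Arguments.
Unset Strict Implicit.
Unset Printing Implicit Defensive.
Import Order.TTheory GRing.Theory Num.Theory.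
Local Open Scope ring_scope.

Definition Qv : fieldType := {fraction {poly rat}}.
Definition vv : Qv := @FracField.tofrac _ ('X : {poly rat}).

(* Generators E_i, F_i, K_i, K_i^{-1} of U(gl_n^), indices i : 'I_n     *)
(* (read modulo n; index i of 'I_n stands for the residue class of i). *)
Inductive gen (n : nat) :=
  | GE of 'I_n | GF of 'I_n | GK of 'I_n | GKi of 'I_n.

Section GenEq.
Variable n : nat.
Definition gen_code (g : gen n) : nat * 'I_n :=
  match g with GE i => (0%N, i) | GF i => (1%N, i)
             | GK i => (2%N, i) | GKi i => (3%N, i) end.
Definition gen_decode (x : nat * 'I_n) : option (gen n) :=
  match x with
  | (0, i) => Some (GE i) | (1, i) => Some (GF i)
  | (2, i) => Some (GK i) | (3, i) => Some (GKi i) | _ => None end%N.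
Lemma gen_codeK : pcancel gen_code gen_decode.
Proof. by case. Qed.
HB.instance Definition _ := Equality.copy (gen n) (pcan_type gen_codeK).
End GenEq.

(* Words in the generators; the free Q(v)-algebra on the generators is *)
(* represented by finite formal linear combinations of words.          *)
Definition word (n : nat) := seq (gen n).
Definition fa (n : nat) := seq (Qv * word n).

Definition fa_coef n (p : fa n) (w : word n) : Qv :=
  \sum_(x <- p | x.2 == w) x.1.
Definition fa_one n : fa n := [:: (1, [::])].
Definition fa_mul n (p q : fa n) : fa n :=
  [seq (x.1 * y.1, x.2 ++ y.2) | x <- p, y <- q].
Definition fa_prod n (ps : seq (fa n)) : fa n := foldr (@fa_mul n) (fa_one n) ps.

Definition eps_plus n (i j : 'I_n) : int :=
  if j == i then 1 else if j == ord_pred i then -1 else 0.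
Definition eps_minus n (i j : 'I_n) : int := - eps_plus i j.

Definition adjacent n (i j : 'I_n) : bool := (j == ordS i) || (j == ord_pred i).

Inductive relator (n r : nat) : fa n -> Prop :=
  | Q1 (i j : 'I_n) : @relator n r [:: (1, [:: GK i; GK j]); (-1, [:: GK j; GK i])]
  | Q2a (i : 'I_n) : @relator n r [:: (1, [:: GK i; GKi i]); (-1, [::])]
  | Q2b (i : 'I_n) : @relator n r [:: (1, [:: GKi i; GK i]); (-1, [::])]
  | Q3 (i j : 'I_n) :
      @relator n r [:: (1, [:: GK i; GE j]); (- vv ^ eps_plus i j, [:: GE j; GK i])]
  | Q4 (i j : 'I_n) :
      @relator n r [:: (1, [:: GK i; GF j]); (- vv ^ eps_minus i j, [:: GF j; GK i])]
  | Q5 (i j : 'I_n) :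
      @relator n r ([:: (1, [:: GE i; GF j]); (-1, [:: GF j; GE i])] ++
                   if i == j then
                     [:: (- (vv - vv^-1)^-1, [:: GK i; GKi (ordS i)]);
                         ((vv - vv^-1)^-1, [:: GKi i; GK (ordS i)])]
                   else [::])
  | Q6 (i j : 'I_n) : ~~ adjacent i j ->
      @relator n r [:: (1, [:: GE i; GE j]); (-1, [:: GE j; GE i])]
  | Q7 (i j : 'I_n) : ~~ adjacent i j ->
      @relator n r [:: (1, [:: GF i; GF j]); (-1, [:: GF j; GF i])]
  | Q8 (i j : 'I_n) : adjacent i j ->
      @relator n r [:: (1, [:: GE i; GE i; GE j]); (- (vv + vv^-1), [:: GE i; GE j; GE i]);
                      (1, [:: GE j; GE i; GE i])]
  | Q9 (i j : 'I_n) : adjacent i j ->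
      @relator n r [:: (1, [:: GF i; GF i; GF j]); (- (vv + vv^-1), [:: GF i; GF j; GF i]);
                      (1, [:: GF j; GF i; GF i])]
  | Q15 : @relator n r [:: (1, [seq GK i | i <- enum 'I_n]); (- vv ^+ r, [::])]
  | Q16 (i : 'I_n) :
      @relator n r (fa_prod [seq [:: (1, [:: GK i]); (- vv ^+ j, [::])] | j <- iota 0 r.+1]).

(* The two-sided ideal of the free algebra generated by the relators:  *)
(* p is (as a formal linear combination of words) equal to a finite   *)
(* sum  sum_k c_k u_k rho_k w_k  with u_k, w_k words, rho_k relators.  *)
Definition ideal_expand n (q : seq (Qv * word n * fa n * word n)) : fa n :=
  flatten [seq [seq (x.1.1.1 * y.1, x.1.1.2 ++ y.2 ++ x.2) | y <- x.1.2] | x <- q].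

Definition in_rel_ideal (n r : nat) (p : fa n) : Prop :=
  exists q : seq (Qv * word n * fa n * word n),
    (forall x, x \in q -> @relator n r x.1.2) /\
    (forall w, fa_coef p w = fa_coef (ideal_expand q) w).

(* The natural module V (basis e_t, t in Z) and the tensor space       *)
(* V^{(x) r}, whose basis vectors e_{t_1} (x) ... (x) e_{t_r} are       *)
(* indexed by sequences of integers of size r.  A vector is given as a *)
(* finite formal linear combination of basis indices.                  *)
Definition vec := seq (Qv * seq int).
Definition vec_coef (x : vec) (s : seq int) : Qv := \sum_(y <- x | y.2 == s) y.1.
Definition vec_scale (c : Qv) (x : vec) : vec := [seq (c * y.1, y.2) | y <- x].

Section Action.
Variable n : nat.

Definition congn (t : int) (i : 'I_n) : bool := ((t %% n)%Z == (i : nat)%:Z).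

Definition vE (i : 'I_n) (a : int) : seq (Qv * int) :=
  if congn (a - 1) i then [:: (1, a - 1)] else [::].
Definition vF (i : 'I_n) (a : int) : seq (Qv * int) :=
  if congn a i then [:: (1, a + 1)] else [::].
Definition vK (i : 'I_n) (a : int) : Qv := if congn a i then vv else 1.
Definition vKi (i : 'I_n) (a : int) : Qv := if congn a i then vv^-1 else 1.
(* eigenvalue of K_i K_{i+1}^{-1} and of its inverse on e_a *)
Definition vKt (i : 'I_n) (a : int) : Qv := vK i a * vKi (ordS i) a.
Definition vKti (i : 'I_n) (a : int) : Qv := vKi i a * vK (ordS i) a.

(* group-like elements act factorwise (Delta(K) = K (x) K) *)
Definition diag (f : int -> Qv) (s : seq int) : Qv := foldr (fun a c => f a * c) 1 s.

(* Delta(E_i) = E_i (x) K_i K_{i+1}^{-1} + 1 (x) E_i, iterated on V (x) V^{(x) m} *)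
Fixpoint tE (i : 'I_n) (s : seq int) : vec :=
  match s with
  | [::] => [::]
  | a :: s' => [seq (y.1 * diag (vKt i) s', y.2 :: s') | y <- vE i a]
               ++ [seq (y.1, a :: y.2) | y <- tE i s']
  end.
(* Delta(F_i) = K_i^{-1} K_{i+1} (x) F_i + F_i (x) 1 *)
Fixpoint tF (i : 'I_n) (s : seq int) : vec :=
  match s with
  | [::] => [::]
  | a :: s' => [seq (vKti i a * y.1, a :: y.2) | y <- tF i s']
               ++ [seq (y.1, y.2 :: s') | y <- vF i a]
  end.

Definition tgen (g : gen n) (s : seq int) : vec :=
  match g with
  | GE i => tE i s
  | GF i => tF i s
  | GK i => [:: (diag (vK i) s, s)]
  | GKi i => [:: (diag (vKi i) s, s)]
  end.

Fixpoint tword (w : word n) (s : seq int) : vec :=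
  match w with
  | [::] => [:: (1, s)]
  | g :: w' => flatten [seq vec_scale y.1 (tgen g y.2) | y <- tword w' s]
  end.

Definition tact (p : fa n) (s : seq int) : vec :=
  flatten [seq vec_scale x.1 (tword x.2 s) | x <- p].

Definition acts_zero (r : nat) (p : fa n) : Prop :=
  forall s : seq int, size s = r -> forall s' : seq int, vec_coef (tact p s) s' = 0.
End Action.

(* Main.v *)
From HB Require Import structures.
Require Import Defs.
From mathcomp Require Import all_boot all_order all_algebra all_fingroup.
From mathcomp Require Import generic_quotient boolp ring zify.
Set Implicit Arguments.
Unset Strict Implicit.
Unset Printing Implicit Defensive.
Import Order.TTheory GRing.Theory Num.Theory.
Local Open Scope ring_scope.

(* Fix a module M over the algebra presented by (Q1)-(Q16), let w be the weight
   of e_1 (x) ... (x) e_r, and let m be a vector of M of weight w.  The point is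
   that V^{(x) r} (+) M contains the graph of a map commuting with the generators
   and sending e_1 (x) ... (x) e_r to m; hence an element killing V^{(x) r} kills m,
   and, all weights being reachable from w, it kills M.  Apply this to M = the
   presented algebra itself.

   A basis vector whose entries are distinct modulo n is a configuration of r
   labelled particles on the n sites of a circle, at most one per site.  Exchanging
   the contents of the sites i and i+1 is given by E_i, F_i or a Hecke-like operator
   F_i E_i - v^{-1} (or its inverse); in every module these operators satisfy the
   braid relations of the exchanges, in each of the cases of occupied and empty
   sites.  Since r < n there is always an empty site, so that every configuration is
   joined to the initial one by exchanges lowering an energy, and a confluence
   argument attaches to it a well defined vector of M.  This gives the graph in
   weight w; the remaining weights are reached by moving particles into empty sites,
   which is invertible by the sl_2 relation and again confluent, and the resulting
   spaces are stable under all generators. *)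

(** Why the subspace is a graph: two particles are exchanged by T or by its inverse according to the
    order of their labels, and with this choice basis vectors of the tensor space go to basis
    vectors. Vectors attached to distinct configurations thus have distinct basis vectors as first
    coordinates, and a combination of them with zero first coordinate is zero. Other weights inherit
    this, because a move into an empty site is undone up to a nonzero quantum integer. The harder
    half is stability under [E_i] and [F_i] on crowded sites, since the construction only controls
    moves of a particle alone on its site. The sl_2 relation reduces to such moves and to [F_i E_i]
    on two singly occupied sites; moves far from [i] commute with [F_i E_i] and spread the other
    particles until all occupations are 0 or 1, where [F_i E_i] is an exchange plus a scalar. A
    module is not given with weight spaces: (Q16) diagonalizes each [K_i], and with (Q15) it forces
    weights to be compositions of r. The bound r >= 3 mainly serves as n >= 4, so that nodes i and
    i+2 are not adjacent. *)

Section FreeAction.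
Variables (n : nat) (P : lmodType Qv) (g : gen n -> {linear P -> P}).

Definition wact (w : word n) (x : P) : P := foldr (fun a y => g a y) x w.
Definition faact (p : fa n) (x : P) : P := \sum_(y <- p) y.1 *: wact y.2 x.

Lemma wact_linear w : linear (wact w).
Proof. by elim: w => [|a w IH] c x y //=; rewrite IH linearP. Qed.

HB.instance Definition _ w := GRing.isLinear.Build _ _ _ _ (wact w) (wact_linear w).

Lemma faact_linear p : linear (faact p).
Proof.
move=> c x y; rewrite /faact scaler_sumr -big_split; apply: eq_bigr => u _ /=.
by rewrite linearP scalerDr !scalerA mulrC.
Qed.

HB.instance Definition _ p := GRing.isLinear.Build _ _ _ _ (faact p) (faact_linear p).

Lemma wact_cat u w x : wact (u ++ w) x = wact u (wact w x).
Proof. by rewrite /wact foldr_cat. Qed.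

Lemma faact_cat p q x : faact (p ++ q) x = faact p x + faact q x.
Proof. by rewrite /faact big_cat. Qed.

Lemma faact_mul p q x : faact (fa_mul p q) x = faact p (faact q x).
Proof.
rewrite /faact big_allpairs_dep /=; apply: eq_bigr => u _.
rewrite linear_sum scaler_sumr; apply: eq_bigr => w _ /=.
by rewrite wact_cat linearZ /= scalerA.
Qed.

Lemma faact_word w x : faact [:: (1, w)] x = wact w x.
Proof. by rewrite /faact big_seq1 scale1r. Qed.

End FreeAction.

(** Lists are unnormalised combinations in which a key may recur, so only total coefficients are
    meaningful. The induction removes at once all entries with the first key, whose total is
    zero. *)
Lemma sum_coef_eq0 (T : eqType) (P : lmodType Qv) (phi : T -> P) (l : seq (Qv * T)) :
  (forall t, \sum_(x <- l | x.2 == t) x.1 = 0) -> \sum_(x <- l) x.1 *: phi x.2 = 0.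
Proof.
have [m] := ubnP (size l); elim: m l => // m IH [|[a t] l] /=; first by rewrite big_nil.
rewrite ltnS => sl h.
have -> : \sum_(x <- (a, t) :: l) x.1 *: phi x.2 =
          \sum_(x <- [seq x <- l | x.2 != t]) x.1 *: phi x.2.
  rewrite big_cons big_filter (bigID (fun x => x.2 == t)) /= addrA.
  rewrite (eq_bigr (fun x => x.1 *: phi t)); last by move=> x /eqP->.
  rewrite -scaler_suml -scalerDl.
  by have := h t; rewrite big_cons /= eqxx => ->; rewrite scale0r add0r.
apply: IH; first exact: leq_ltn_trans (size_subseq (filter_subseq _ _)) sl.
move=> u; rewrite big_filter_cond; have [->|ut] := eqVneq u t.
  by rewrite big1 // => x /andP[/negPf->].
have := h u; rewrite big_cons /= eq_sym (negPf ut) => {2}<-.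
apply: eq_bigl => x; case: (eqVneq x.2 u) => [->|]; by rewrite ?ut ?andbF.
Qed.

(** * The indeterminate is not a root of unity; quantum integers *)

Lemma vv_neq0 : vv != 0.
Proof. by rewrite /vv tofrac_eq0 polyX_eq0. Qed.

Lemma vv_exp_neq1 (m : nat) : (0 < m)%N -> vv ^+ m != 1.
Proof.
move=> m0; rewrite /vv -tofracXn -tofrac1 tofrac_eq.
apply/eqP => /(congr1 (fun q : {poly rat} => q`_0)).
by rewrite coefXn coef1 eqxx; case: m m0.
Qed.

Section QuantumIntegers.
Variables (F : fieldType) (v : F).
Hypotheses (v0 : v != 0) (v1 : forall m, (0 < m)%N -> v ^+ m != 1).

Lemma exprz_eq1_generic (m : int) : (v ^ m == 1) = (m == 0).
Proof.
case: m => [[|m]|m]; first by rewrite !eqxx.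
  by rewrite (negPf (v1 _)).
by rewrite NegzE -exprnN invr_eq1 (negPf (v1 _)).
Qed.

Lemma exprz_inj_generic : injective (fun m : int => v ^ m).
Proof.
move=> a b /= h; apply/eqP; rewrite -subr_eq0 -exprz_eq1_generic.
by rewrite expfzDr // h -expfzDr // subrr.
Qed.

Definition qnum (m : int) : F := (v ^ m - v ^ (- m)) / (v - v^-1).

Lemma sub_inv_neq0 : v - v^-1 != 0.
Proof.
rewrite subr_eq0; apply/eqP => h; have := v1 (isT : (0 < 2)%N).
by rewrite expr2 {2}h divff ?eqxx.
Qed.

Lemma qnum_eq0 m : (qnum m == 0) = (m == 0).
Proof.
rewrite mulf_eq0 invr_eq0 (negPf sub_inv_neq0) orbF subr_eq0.
by apply/eqP/eqP => [/exprz_inj_generic|-> //]; lia.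
Qed.

Lemma qnumN m : qnum (- m) = - qnum m.
Proof. by rewrite /qnum opprK -mulNr opprB. Qed.

Lemma qnum1 : qnum 1 = 1.
Proof. by rewrite /qnum expr1z exprN1 divff // sub_inv_neq0. Qed.

Lemma qnum2 : qnum 2 = v + v^-1.
Proof.
rewrite /qnum -exprnN -[v ^ 2]/(v ^+ 2).
by field; rewrite v0 subr_eq0; move: (v1 (isT : (0 < 2)%N)); rewrite expr2.
Qed.

(** This scalar arises in the three-particle braid relation, where it cancels two factors [2]^-1
    coming from the Serre relations. *)
Lemma qnum3 : qnum 3 + 1 = (v + v^-1) ^+ 2.
Proof.
rewrite /qnum -exprnN -[v ^ 3]/(v ^+ 3).
by field; rewrite v0 subr_eq0; move: (v1 (isT : (0 < 2)%N)); rewrite expr2.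
Qed.

End QuantumIntegers.

Definition qint (m : int) : Qv := qnum vv m.

Lemma vv_expz_inj : injective (fun m : int => vv ^ m).
Proof. exact: exprz_inj_generic vv_neq0 vv_exp_neq1. Qed.

Lemma vv_sub_inv_neq0 : vv - vv^-1 != 0.
Proof. exact: sub_inv_neq0 vv_neq0 vv_exp_neq1. Qed.

Lemma qint_eq0 m : (qint m == 0) = (m == 0).
Proof. exact: qnum_eq0 vv_neq0 vv_exp_neq1 m. Qed.

Lemma qint0 : qint 0 = 0. Proof. by apply/eqP; rewrite qint_eq0. Qed.
Lemma qint1 : qint 1 = 1. Proof. exact: qnum1 vv_neq0 vv_exp_neq1. Qed.
Lemma qint2 : qint 2 = vv + vv^-1. Proof. exact: qnum2 vv_neq0 vv_exp_neq1. Qed.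
Lemma qint3 : qint 3 + 1 = (vv + vv^-1) ^+ 2. Proof. exact: qnum3 vv_neq0 vv_exp_neq1. Qed.
Lemma qintN m : qint (- m) = - qint m. Proof. exact: qnumN. Qed.

(** * The cyclic index set *)

Section Cyclic.
Variable n : nat.
Implicit Types i j : 'I_n.

Lemma val_ordS i : ordS i = (if i.+1 == n then 0 else i.+1)%N :> nat.
Proof.
rewrite /=; case: eqP => [->|h]; first by rewrite modnn.
by rewrite modn_small // ltn_neqAle ltn_ord andbT; apply/eqP.
Qed.

Lemma eq_ord_pred i j : (j == ord_pred i) = (ordS j == i).
Proof. by rewrite -(inj_eq (@ordS_inj n)) ord_predK. Qed.

Lemma ordS_neq i : (1 < n)%N -> (ordS i == i) = false.
Proof.
by move=> n1; apply/eqP => /(congr1 (@nat_of_ord n)); rewrite val_ordS; case: eqP => h h'; lia.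
Qed.

Lemma ordSS_neq i : (2 < n)%N -> (ordS (ordS i) == i) = false.
Proof.
move=> n1; apply/eqP => /(congr1 (@nat_of_ord n)).
by move: (val_ordS i) (val_ordS (ordS i)); do 2!case: eqP => ?; lia.
Qed.

Lemma ordSSS_neq i : (3 < n)%N -> (ordS (ordS (ordS i)) == i) = false.
Proof.
move=> n1; apply/eqP => /(congr1 (@nat_of_ord n)).
by move: (val_ordS i) (val_ordS (ordS i)) (val_ordS (ordS (ordS i))); do 3!case: eqP => ?; lia.
Qed.

Lemma adjacentE i j : adjacent i j = (j == ordS i) || (ordS j == i).
Proof. by rewrite /adjacent eq_ord_pred. Qed.

Lemma iter_ordS (i : 'I_n) k : iter k (@ordS n) i = ((i + k) %% n)%N :> nat.
Proof.
elim: k => [|k IH] /=; first by rewrite addn0 modn_small.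
by move: IH => /= ->; rewrite addnS -addn1 modnDml addn1.
Qed.

Lemma iter_ordS_surj (i j : 'I_n) : exists2 k, (k < n)%N & iter k (@ordS n) i = j.
Proof.
have n0 : (0 < n)%N by apply: leq_ltn_trans (ltn_ord i).
exists ((j + (n - i)) %% n)%N; first by rewrite ltn_mod.
apply: val_inj => /=; rewrite iter_ordS modnDmr addnCA subnKC; last exact: ltnW.
by rewrite modnDr modn_small.
Qed.

Lemma iter_ord_pred_surj (i j : 'I_n) : exists2 k, (k < n)%N & iter k (@ord_pred n) i = j.
Proof.
have [k kn <-] := iter_ordS_surj j i; exists k => //.
by elim: k {kn} => [|k IH] //; rewrite iterSr [iter k.+1 (@ordS n) j]iterS ordSK.
Qed.

End Cyclic.

(* [src b i] loses and [tgt b i] gains a particle under [E_i] (b = true)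
   or [F_i] (b = false). *)
Definition src n (b : bool) (i : 'I_n) : 'I_n := if b then ordS i else i.
Definition tgt n (b : bool) (i : 'I_n) : 'I_n := if b then i else ordS i.
Arguments src {n} !b i /.
Arguments tgt {n} !b i /.

(** A representation of the presented algebra, described without constructing the algebra. *)
Record schur_module (n r : nat) := SchurModule {
  smod :> lmodType Qv;
  gact : gen n -> {linear smod -> smod};
  gactP : forall rho, relator r rho -> forall x, faact gact rho x = 0
}.

(** * Weight vectors and the defining relations on them *)

Section ModuleTheory.
Variables (n r : nat) (P : schur_module n r).
Hypothesis (n4 : (3 < n)%N).
Implicit Types (i j : 'I_n) (b : bool) (x : P).

Definition X b i : {linear P -> P} := gact P (if b then GE i else GF i).
Definition wt (lam : 'I_n -> int) (x : P) := forall i, gact P (GK i) x = vv ^ lam i *: x.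
Definition shift (lam : 'I_n -> int) b i : 'I_n -> int :=
  fun j => lam j + (j == tgt b i)%:Z - (j == src b i)%:Z.

Lemma tgt_neq_src b i : (tgt b i == src b i) = false.
Proof. by case: b; [rewrite eq_sym|]; apply: ordS_neq; lia. Qed.

Lemma wt_ext lam lam' x : lam =1 lam' -> wt lam x -> wt lam' x.
Proof. by move=> e h i; rewrite h e. Qed.

Lemma wt0 lam : wt lam 0.
Proof. by move=> i; rewrite linear0 scaler0. Qed.

Lemma wtD lam x y : wt lam x -> wt lam y -> wt lam (x + y).
Proof. by move=> hx hy i; rewrite linearD hx hy scalerDr. Qed.

Lemma wtZ lam c x : wt lam x -> wt lam (c *: x).
Proof. by move=> hx i; rewrite linearZ /= hx !scalerA mulrC. Qed.

Lemma wt_sum (I : Type) (s : seq I) (p : pred I) (F : I -> P) lam :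
  (forall k, p k -> wt lam (F k)) -> wt lam (\sum_(k <- s | p k) F k).
Proof.
by move=> h; elim/big_ind: _ => //; [exact: wt0|move=> *; exact: wtD].
Qed.

Lemma actKE i j x : gact P (GK i) (X true j x) = vv ^ eps_plus i j *: X true j (gact P (GK i) x).
Proof.
have := gactP (Q3 r i j) x; rewrite /faact !big_cons big_nil /= scale1r addr0 scaleNr.
by move/eqP; rewrite subr_eq0 => /eqP.
Qed.

Lemma actKF i j x : gact P (GK i) (X false j x) = vv ^ eps_minus i j *: X false j (gact P (GK i) x).
Proof.
have := gactP (Q4 r i j) x; rewrite /faact !big_cons big_nil /= scale1r addr0 scaleNr.
by move/eqP; rewrite subr_eq0 => /eqP.
Qed.

Lemma actKiK i x : gact P (GKi i) (gact P (GK i) x) = x.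
Proof.
have := gactP (Q2b r i) x; rewrite /faact !big_cons big_nil /= scale1r addr0 scaleN1r.
by move/eqP; rewrite subr_eq0 => /eqP.
Qed.

Lemma actKi_wt lam i x : wt lam x -> gact P (GKi i) x = vv ^ (- lam i) *: x.
Proof.
move=> h; have := actKiK i x; rewrite h linearZ /= => {2}<-.
by rewrite scalerA -expfzDr ?vv_neq0 // addNr expr0z scale1r.
Qed.

Lemma wt_shift lam b i x : wt lam x -> wt (shift lam b i) (X b i x).
Proof.
move=> h j; rewrite /shift; case: b => /=.
  rewrite actKE h linearZ /= scalerA -expfzDr ?vv_neq0 //; congr (_ ^ _ *: _).
  rewrite /eps_plus eq_ord_pred !(eq_sym j); case: eqP => [<-|_].
    by rewrite ordS_neq /=; lia.
  by case: eqP; lia.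
rewrite actKF h linearZ /= scalerA -expfzDr ?vv_neq0 //; congr (_ ^ _ *: _).
rewrite /eps_minus /eps_plus eq_ord_pred !(eq_sym j); case: eqP => [<-|_].
  by rewrite ordS_neq /=; lia.
by case: eqP; lia.
Qed.

Lemma faact_prod ps x : faact (gact P) (fa_prod ps) x = foldr (faact (gact P)) x ps.
Proof.
elim: ps => [|p ps IH] /=; first by rewrite /fa_one faact_word.
by rewrite -IH -faact_mul.
Qed.

(** On a weight vector (Q16) becomes multiplication by the product of the [v^(lam i) - v^m]; some
    factor vanishes because x is nonzero, and distinct powers of v differ. *)
Lemma wt_bounds lam x i : wt lam x -> x != 0 -> 0 <= lam i <= r%:Z.
Proof.
move=> h x0; have := gactP (Q16 r i) x; rewrite faact_prod.
set s := iota 0 r.+1.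
have -> : foldr (faact (gact P)) x [seq [:: (1, [:: GK i]); (- vv ^+ m, [::])] | m <- s] =
  (\prod_(m <- s) (vv ^ lam i - vv ^+ m)) *: x.
  elim: s => [|m s IH]; first by rewrite big_nil scale1r.
  rewrite /= IH big_cons /faact !big_cons big_nil /= linearZ /= h !scale1r addr0 !scalerA.
  by rewrite -scalerDl; congr (_ *: _); rewrite mulrBl mulNr mulrC.
move/eqP; rewrite scaler_eq0 (negPf x0) orbF prodf_seq_eq0 => /hasP[j].
rewrite mem_iota /= add0n subr_eq0 => jr /eqP e.
have -> : lam i = j%:Z by apply: vv_expz_inj.
lia.
Qed.

Lemma wt_total lam x : wt lam x -> x != 0 -> \sum_i lam i = r%:Z.
Proof.
move=> h x0; have := gactP (Q15 n r) x; rewrite /faact !big_cons big_nil /= scale1r addr0.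
have -> : wact (gact P) [seq GK i | i <- enum 'I_n] x = vv ^ (\sum_i lam i) *: x.
  rewrite -big_enum /=; elim: (enum _) => [|i s IH] /=; first by rewrite big_nil expr0z scale1r.
  rewrite IH big_cons linearZ /= h scalerA -expfzDr ?vv_neq0 //.
  by rewrite addrC.
rewrite -scalerDl; move/eqP; rewrite scaler_eq0 (negPf x0) orbF subr_eq0 => /eqP e.
by apply: vv_expz_inj.
Qed.

(** Otherwise the image would be a nonzero vector with a negative weight at [src b i]. *)
Lemma X_eq0 lam b i x : wt lam x -> lam (src b i) <= 0 -> X b i x = 0.
Proof.
move=> h l0; apply/eqP; apply/negP => /negP /(wt_bounds (src b i) (wt_shift b i h)).
rewrite /shift eqxx eq_sym tgt_neq_src /=; lia.
Qed.

(** (Q5) made symmetric in E and F: the case of F E is that of E F rearranged, as [-m] = -[m]. *)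
Lemma XX_sl2 lam b i x : wt lam x ->
  X b i (X (~~ b) i x) = X (~~ b) i (X b i x) + qint (lam (tgt b i) - lam (src b i)) *: x.
Proof.
move=> h.
have e : X true i (X false i x) = X false i (X true i x) + qint (lam i - lam (ordS i)) *: x.
  have := gactP (Q5 r i i) x; rewrite eqxx /faact !big_cons big_nil /= !scale1r addr0.
  rewrite !(actKi_wt _ h) !h !linearZ /= !(actKi_wt _ h) !h !scalerA scaleN1r.
  rewrite addrA -scalerDl => /eqP.
  rewrite addr_eq0 subr_eq => /eqP->; rewrite addrC; congr (_ + _).
  rewrite -scaleNr; congr (_ *: _).
  rewrite /qint /qnum opprB !expfzDr ?vv_neq0 //; ring.
case: b => //=; rewrite e -addrA -scalerDl.
by rewrite -[lam i - _]opprB qintN addNr scale0r addr0.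
Qed.

Lemma XX_opp b i j x : i != j -> X b i (X (~~ b) j x) = X (~~ b) j (X b i x).
Proof.
have e k l : k != l -> X true k (X false l x) = X false l (X true k x).
  move=> kl; have := gactP (Q5 r k l) x; rewrite (negPf kl) /faact !big_cons big_nil /=.
  by rewrite scale1r addr0 scaleN1r => /eqP; rewrite subr_eq0 => /eqP.
by case: b => ij /=; rewrite e // eq_sym.
Qed.

Lemma XX_far b i j x : ~~ adjacent i j -> X b i (X b j x) = X b j (X b i x).
Proof.
case: b => ij.
  have := gactP (Q6 r ij) x; rewrite /faact !big_cons big_nil /=.
  by rewrite scale1r addr0 scaleN1r => /eqP; rewrite subr_eq0 => /eqP.
have := gactP (Q7 r ij) x; rewrite /faact !big_cons big_nil /=.
by rewrite scale1r addr0 scaleN1r => /eqP; rewrite subr_eq0 => /eqP.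
Qed.

Lemma XX_serre b i j x : adjacent i j ->
  X b i (X b i (X b j x)) + X b j (X b i (X b i x)) = (vv + vv^-1) *: X b i (X b j (X b i x)).
Proof.
case: b => ij.
  have := gactP (Q8 r ij) x; rewrite /faact !big_cons big_nil /=.
  by rewrite !scale1r addr0 scaleNr addrCA => /eqP; rewrite addrC subr_eq0 => /eqP.
have := gactP (Q9 r ij) x; rewrite /faact !big_cons big_nil /=.
by rewrite !scale1r addr0 scaleNr addrCA => /eqP; rewrite addrC subr_eq0 => /eqP.
Qed.

(** The opposite product vanishes because the target is empty, so only the sl_2 scalar is left. It
    is nonzero when the source is occupied: this is how moves are undone throughout. *)
Lemma XX_inv lam b i x : wt lam x -> lam (tgt b i) = 0 ->
  X (~~ b) i (X b i x) = qint (lam (src b i)) *: x.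
Proof.
move=> h l0; have := XX_sl2 b i h; rewrite l0 sub0r qintN scaleNr.
have -> : X (~~ b) i x = 0 by apply: X_eq0 h _; case: b l0 => /= ->.
by rewrite linear0 => /esym/eqP; rewrite subr_eq0 => /eqP.
Qed.

Lemma XX_inv1 lam b i x : wt lam x -> lam (tgt b i) = 0 -> lam (src b i) = 1 ->
  X (~~ b) i (X b i x) = x.
Proof. by move=> h l0 l1; rewrite (XX_inv h) // l1 qint1 scale1r. Qed.

End ModuleTheory.

(** * Deciding linear identities in a module by comparing coefficients *)

Section LinearExpressions.
Variable R : comNzRingType.

Inductive lexp :=
  | LVar of nat | LZero | LAdd of lexp & lexp | LOpp of lexp | LScale of R & lexp.

Fixpoint leval (V : lmodType R) (env : seq V) e : V :=
  match e with
  | LVar k => nth 0 env k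
  | LZero => 0
  | LAdd e1 e2 => leval env e1 + leval env e2
  | LOpp e1 => - leval env e1
  | LScale c e1 => c *: leval env e1
  end.

(** The index test is [Nat.eqb], which [cbn] evaluates on numerals, so that only identities between
    scalars remain. *)
Fixpoint lcoef e (i : nat) : R :=
  match e with
  | LVar k => if PeanoNat.Nat.eqb i k then 1 else 0
  | LZero => 0
  | LAdd e1 e2 => lcoef e1 i + lcoef e2 i
  | LOpp e1 => - lcoef e1 i
  | LScale c e1 => c * lcoef e1 i
  end.

Fixpoint same_coefs e1 e2 k : Prop :=
  match k with
  | 0 => True
  | k'.+1 => same_coefs e1 e2 k' /\ lcoef e1 k' = lcoef e2 k'
  end.

Lemma levalE (V : lmodType R) (env : seq V) e :
  leval env e = \sum_(i < size env) lcoef e i *: env`_i.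
Proof.
elim: e => [k||e1 IH1 e2 IH2|e1 IH1|c e1 IH1] /=.
- have [sk|ks] := leqP (size env) k.
    rewrite nth_default // big1 // => i _; case: PeanoNat.Nat.eqb_spec => [e|_].
      by move: (ltn_ord i); rewrite e ltnNge sk.
    by rewrite scale0r.
  rewrite (bigD1 (Ordinal ks)) //= PeanoNat.Nat.eqb_refl scale1r big1 ?addr0 // => i ik.
  case: PeanoNat.Nat.eqb_spec => [e|_]; last by rewrite scale0r.
  by case/eqP: ik; apply: val_inj.
- by rewrite big1 // => i _; rewrite scale0r.
- by rewrite IH1 IH2 -big_split; apply: eq_bigr => i _; rewrite scalerDl.
- by rewrite IH1 -sumrN; apply: eq_bigr => i _; rewrite scaleNr.
- by rewrite IH1 scaler_sumr; apply: eq_bigr => i _; rewrite scalerA.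
Qed.

Lemma leval_eq (V : lmodType R) (env : seq V) e1 e2 :
  same_coefs e1 e2 (size env) -> leval env e1 = leval env e2.
Proof.
move=> h; rewrite !levalE; apply: eq_bigr => i _; congr (_ *: _).
case: i; elim: (size env) h => // k IH /= [h1 h2] i; rewrite ltnS leq_eqVlt => /orP[/eqP->//|].
exact: IH.
Qed.

End LinearExpressions.

Ltac lmod_index x env :=
  lazymatch env with
  | x :: _ => constr:(0%N)
  | _ :: ?env' => let k := lmod_index x env' in constr:(k.+1)
  end.
Ltac lmod_atoms t env :=
  lazymatch t with
  | @GRing.zero _ => env
  | @GRing.add _ ?a ?b => let env1 := lmod_atoms a env in lmod_atoms b env1
  | @GRing.opp _ ?a => lmod_atoms a env
  | @GRing.scale _ _ _ ?a => lmod_atoms a env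
  | _ => match env with
         | context [t :: _] => env
         | _ => constr:(t :: env)
         end
  end.
Ltac lmod_reify R t env :=
  lazymatch t with
  | @GRing.zero _ => constr:(@LZero R)
  | @GRing.add _ ?a ?b =>
      let a' := lmod_reify R a env in let b' := lmod_reify R b env in constr:(@LAdd R a' b')
  | @GRing.opp _ ?a => let a' := lmod_reify R a env in constr:(@LOpp R a')
  | @GRing.scale _ _ ?c ?a => let a' := lmod_reify R a env in constr:(@LScale R c a')
  | _ => let k := lmod_index t env in constr:(@LVar R k)
  end.
(* Reduces an identity between linear combinations in a module over [R] to
   the scalar identities between the coefficients. *)
Ltac lmod_coefs R :=
  lazymatch goal with
  | |- @eq ?V ?a ?b =>
    let env0 := lmod_atoms a (@nil V) in
    let env := lmod_atoms b env0 in
    let ea := lmod_reify R a env in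
    let eb := lmod_reify R b env in
    refine (@leval_eq R _ env ea eb _);
    cbn [same_coefs lcoef size PeanoNat.Nat.eqb];
    repeat (lazymatch goal with |- True => exact I | |- _ /\ _ => split end)
  end.

(* [field] does not terminate in practice on the concrete field [Qv], which is
   therefore replaced by an arbitrary one. *)
Ltac scalar_field :=
  move: (vv) vv_neq0;
  repeat match goal with c : GRing.Field.sort Qv |- _ => revert c end;
  generalize Qv; intros; field; try assumption.
Ltac lmod_field := lmod_coefs Qv; scalar_field.

(** * Exchanging the contents of adjacent sites *)

(** Four consecutive sites are distinct, which is what n > 3 provides; gathered as rewrite rules for
    weight computations. *)
Lemma ordS_neqs n (n4 : (3 < n)%N) :
  (((forall i : 'I_n, (ordS i == i) = false) * (forall i : 'I_n, (i == ordS i) = false)) *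
  ((forall i : 'I_n, (ordS (ordS i) == i) = false) * (forall i : 'I_n, (i == ordS (ordS i)) = false)) *
  ((forall i : 'I_n, (ordS (ordS (ordS i)) == i) = false) *
   (forall i : 'I_n, (i == ordS (ordS (ordS i))) = false)) *
  (forall i j : 'I_n, (ordS i == ordS j) = (i == j)))%type.
Proof.
do !split=> *; rewrite ?(inj_eq (@ordS_inj n)) //; last first.
all: try by rewrite eq_sym; first [apply: ordS_neq; lia|apply: ordSS_neq; lia|exact: ordSSS_neq].
all: by first [apply: ordS_neq; lia|apply: ordSS_neq; lia|exact: ordSSS_neq].
Qed.

Ltac weight n4 := rewrite /shift /= ?eqxx ?(ordS_neqs n4) /=; lia.

Section RankTwo.
Variables (n r : nat) (P : schur_module n r).
Hypothesis (n4 : (3 < n)%N).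
Implicit Types (lam : 'I_n -> int) (i j : 'I_n) (x : P).

Lemma XD b i x y : X P b i (x + y) = X P b i x + X P b i y.
Proof. exact: linearD. Qed.
Lemma XB b i x y : X P b i (x - y) = X P b i x - X P b i y.
Proof. exact: linearB. Qed.
Lemma XZ b i (c : Qv) x : X P b i (c *: x) = c *: X P b i x.
Proof. exact: linearZ. Qed.

(* On a pair of adjacent singly occupied sites [swap] acts as a Hecke
   generator [T] with [T^2 = 1 + (v - v^-1) T], and [swap'] is its inverse. *)
Definition swap i x : P := X P false i (X P true i x) - vv^-1 *: x.
Definition swap' i x : P := swap i x - (vv - vv^-1) *: x.

Lemma swapD i x y : swap i (x + y) = swap i x + swap i y.
Proof. by rewrite /swap !XD scalerDr opprD addrACA. Qed.
Lemma swapZ i (c : Qv) x : swap i (c *: x) = c *: swap i x.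
Proof. by rewrite /swap !XZ scalerBr !scalerA mulrC. Qed.
Lemma swap'D i x y : swap' i (x + y) = swap' i x + swap' i y.
Proof. by rewrite /swap' swapD scalerDr opprD addrACA. Qed.
Lemma swap'Z i (c : Qv) x : swap' i (c *: x) = c *: swap' i x.
Proof. by rewrite /swap' swapZ [in RHS]scalerBr !scalerA (mulrC c). Qed.

Lemma shiftK lam b i : shift (shift lam b i) (~~ b) i =1 lam.
Proof. by move=> j; rewrite /shift; case: b => /=; lia. Qed.

Lemma wt_XX lam b i x : wt lam x -> wt lam (X P (~~ b) i (X P b i x)).
Proof. by move=> w; apply: wt_ext (shiftK lam b i) _; do 2!apply: wt_shift => //. Qed.

Lemma wt_swap lam i x : wt lam x -> wt lam (swap i x).
Proof. by move=> w; apply: wtD; [exact: (wt_XX true)|rewrite -scaleNr; exact: wtZ]. Qed.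

Lemma wt_swap' lam i x : wt lam x -> wt lam (swap' i x).
Proof. by move=> w; apply: wtD; [exact: wt_swap|rewrite -scaleNr; exact: wtZ]. Qed.

(** [E_i x] has two particles on site i and none on i+1, so E_i F_i multiplies it by [2]. *)
Lemma FE_square lam i x : wt lam x -> lam i = 1 -> lam (ordS i) = 1 ->
  X P false i (X P true i (X P false i (X P true i x))) = qint 2 *: X P false i (X P true i x).
Proof.
move=> w li lj; have wE := wt_shift n4 true i w.
rewrite (XX_inv n4 (b := false) (i := i) wE) ?XZ //=; last by weight n4.
by congr (qint _ *: _); weight n4.
Qed.

Lemma swapK lam i x : wt lam x -> lam i = 1 -> lam (ordS i) = 1 -> swap' i (swap i x) = x.
Proof.
move=> w li lj; rewrite /swap' /swap !XB !XZ (FE_square w) // qint2.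
lmod_field.
Qed.

Lemma swap'K lam i x : wt lam x -> lam i = 1 -> lam (ordS i) = 1 -> swap i (swap' i x) = x.
Proof.
move=> w li lj; rewrite -[RHS](swapK w li lj) /swap' -!scaleNr.
by rewrite swapD swapZ.
Qed.

Section ThreeSites.
Variables (lam : 'I_n -> int) (i : 'I_n) (x : P).
Hypothesis w : wt lam x.
Local Notation j := (ordS i).
Local Notation k := (ordS (ordS i)).
Local Notation E := (X P true i).
Local Notation F := (X P false i).
Local Notation E' := (X P true j).
Local Notation F' := (X P false j).

Lemma EF'C y : E (F' y) = F' (E y).
Proof. by apply: (XX_opp true); rewrite (ordS_neqs n4). Qed.

Lemma E'FC y : E' (F y) = F (E' y).
Proof. by apply: (XX_opp true); rewrite (ordS_neqs n4). Qed.

Lemma adj_ij : adjacent i j.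
Proof. by rewrite adjacentE eqxx. Qed.

(** One outer term of the quantum Serre relation vanishes, so the other two are proportional with
    ratio [2]. *)
Lemma serre_top b l m y : adjacent l m -> X P b l (X P b m y) = 0 ->
  X P b l (X P b m (X P b l y)) = (qint 2)^-1 *: X P b m (X P b l (X P b l y)).
Proof.
move=> a e; have := XX_serre b y a; rewrite e linear0 add0r => ->.
by rewrite scalerA -qint2 mulVf ?scale1r // qint_eq0.
Qed.

(** E x leaves site i+1 empty, hence F' kills it, and the Serre relation turns F F' F E x into
    [2]^-1 F' F F E x = F' F x. On the other side E' F' undoes itself on x. The terms in v^-1
    already agree. *)
Lemma swap_braid_110 : lam i = 1 -> lam j = 1 -> lam k = 0 ->
  F (F' (swap i x)) = swap j (F (F' x)).
Proof.
move=> li lj lk; rewrite /swap !XB !XZ; congr (_ - _).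
have wE := wt_shift n4 true i w; have wF' := wt_shift n4 false j w.
have wF := wt_shift n4 false i w.
have e1 : F' (E x) = 0.
  by apply: (X_eq0 n4 (b := false) (i := j) wE); weight n4.
have e2 : F (F (E x)) = qint 2 *: F x.
  have := XX_sl2 true i w; rewrite /= li lj subrr qint0 scale0r addr0 => <-.
  by rewrite (XX_inv n4 (b := true) (i := i) wF) /=; [congr (qint _ *: _)|]; weight n4.
have e3 : E' (F' x) = x.
  by apply: (XX_inv1 n4 (b := false) (i := j) w).
rewrite E'FC e3.
have -> : F (F' (F (E x))) = (qint 2)^-1 *: F' (F (F (E x))).
  by apply: serre_top adj_ij _; rewrite e1 linear0.
by rewrite e2 XZ scalerA mulVf ?qint_eq0 // scale1r.
Qed.

End ThreeSites.

Section ThreeSites2.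
Variables (lam : 'I_n -> int) (i : 'I_n) (x : P).
Hypothesis w : wt lam x.
Local Notation j := (ordS i).
Local Notation k := (ordS (ordS i)).
Local Notation E := (X P true i).
Local Notation F := (X P false i).
Local Notation E' := (X P true j).
Local Notation F' := (X P false j).

(** Transported from the arrangement 110 by an invertible move of a particle into the hole; the
    arrangement 011 below is treated in the same way. *)
Lemma swap_braid_101 : lam i = 1 -> lam j = 0 -> lam k = 1 ->
  E (swap j (F x)) = F' (swap i (E' x)).
Proof.
move=> li lj lk; have wE' := wt_shift n4 true j w.
have e1 : F' (E' x) = x by apply: (XX_inv1 n4 (b := true) (i := j) w).
rewrite -[in LHS]e1 -(swap_braid_110 wE'); try by weight n4.
have wS := wt_shift n4 false j (wt_swap i wE').
by apply: (XX_inv1 n4 (b := false) (i := i) wS); weight n4.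
Qed.

Lemma swap_braid_011 : lam i = 0 -> lam j = 1 -> lam k = 1 ->
  swap i (E' (E x)) = E' (E (swap j x)).
Proof.
move=> li lj lk; have wE := wt_shift n4 true i w.
have wy := wt_shift n4 true j wE.
have e2 : F' (E' (E x)) = E x by apply: (XX_inv1 n4 (b := true) (i := j) wE); weight n4.
have e1 : F (F' (E' (E x))) = x by rewrite e2; apply: (XX_inv1 n4 (b := true) (i := i) w).
rewrite -[in RHS]e1 -(swap_braid_110 wy); try by weight n4.
have wS := wt_swap i wy; have wS' := wt_shift n4 false j wS.
have -> : E (F (F' (swap i (E' (E x))))) = F' (swap i (E' (E x))).
  by apply: (XX_inv1 n4 (b := false) (i := i) wS'); weight n4.
by apply/esym/(XX_inv1 n4 (b := false) (i := j) wS); weight n4.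
Qed.

(** The braid relation in Kazhdan-Lusztig form, C C' C - C = C' C C' - C' with C = F E and C' = F'
    E'. Both sides are equal to F' E F E' x: the left one by two Serre relations, for E E' E and for
    F F' F, the right one by commuting E with F' and E' with F. *)
Lemma FE_braid : lam i = 1 -> lam j = 1 -> lam k = 1 ->
  F (E (F' (E' (F (E x))))) - F (E x) = F' (E' (F (E (F' (E' x))))) - F' (E' x).
Proof.
move=> li lj lk.
have wE := wt_shift n4 true i w; have wE' := wt_shift n4 true j w.
have wE'E := wt_shift n4 true j wE.
have wEE' := wt_shift n4 true i wE'.
have wEEE' := wt_shift n4 true i wEE'.
have wFE' := wt_shift n4 false i wE'.
have -> : F (E (F' (E' (F (E x))))) - F (E x) = F (F' (F (E (E' (E x))))).
  rewrite E'FC EF'C (XX_sl2 true i wE'E) /=.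
  have -> : qint (shift (shift lam true i) true j i - shift (shift lam true i) true j (ordS i)) = 1.
    by rewrite -qint1; congr qint; weight n4.
  rewrite scale1r !XD (XX_inv1 n4 (b := true) (i := j) wE) /= ?addrK //; weight n4.
have -> : E (E' (E x)) = (qint 2)^-1 *: E (E (E' x)).
  have := XX_serre true x (adj_ij i).
  have -> : E (E x) = 0 by apply: (X_eq0 n4 (b := true) (i := i) wE); weight n4.
  by rewrite linear0 addr0 -qint2 => ->; rewrite scalerA mulVf ?scale1r // qint_eq0.
have e0 : F' (E (E (E' x))) = 0.
  by apply: (X_eq0 n4 (b := false) (i := j) wEEE'); weight n4.
have -> : F (F' (F ((qint 2)^-1 *: E (E (E' x))))) =
   ((qint 2)^-1 * (qint 2)^-1) *: F' (F (F (E (E (E' x))))).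
  by rewrite !XZ (serre_top (b := false) (adj_ij i)) ?e0 ?linear0 // scalerA.
(* The sites i, i+1, i+2 now carry 1, 2, 0 particles; evaluating F F E E u is a computation in the
   sl_2 of node i, with result [2]^2 E F u. *)
set u := E' x.
have uF : F (E u) = E (F u) + u.
  have := XX_sl2 false i wE'; rewrite /= => ->; congr (_ + _).
  by rewrite -[RHS]scale1r -qint1; congr (qint _ *: _); weight n4.
have e3 : F (E (F u)) = qint 3 *: F u.
  rewrite (XX_inv n4 (b := true) (i := i) wFE') /=; last by weight n4.
  by congr (qint _ *: _); weight n4.
have FEw : F (E (E (F u))) = (qint 3 + 1) *: E (F u).
  have wEF := wt_XX false i wE'.
  have := XX_sl2 false i wEF; rewrite /= => ->; rewrite -/u e3 XZ scalerDl; congr (_ + _).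
  by rewrite -qint1; congr (qint _ *: _); weight n4.
have FFEE : F (F (E (E u))) = (qint 3 + 1) *: E (F u).
  have -> : F (E (E u)) = E (F (E u)) - E u.
    rewrite [LHS](XX_sl2 false i wEE') /=; congr (_ + _).
    by rewrite -scaleN1r -qint1 -qintN; congr (qint _ *: _); weight n4.
  by rewrite uF XB !XD FEw addrK.
have -> : F' (F (F (E (E u)))) = (qint 2 * qint 2) *: F' (E (F u)).
  by rewrite FFEE XZ qint3 -qint2.
rewrite scalerA mulrACA mulVf ?qint_eq0 // mulr1 scale1r.
have -> : F' (E' (F (E (F' u)))) = F' (F (E u)).
  rewrite E'FC EF'C; do 2 congr (X P _ _ _).
  by apply: (XX_inv1 n4 (b := false) (i := j) wEE'); weight n4.
by rewrite uF XD addrK.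
Qed.

Lemma swap_braid_111 : lam i = 1 -> lam j = 1 -> lam k = 1 ->
  swap i (swap j (swap i x)) = swap j (swap i (swap j x)).
Proof.
move=> li lj lk; have h := FE_braid li lj lk.
have f2 := FE_square w li lj; have g2 := FE_square w lj lk.
rewrite /swap !(XB, XZ) f2 g2 qint2.
have -> : F (E (F' (E' (F (E x))))) = F' (E' (F (E (F' (E' x))))) - F' (E' x) + F (E x).
  by rewrite -h subrK.
lmod_field.
Qed.

End ThreeSites2.
End RankTwo.

(** Each crossing is positive or negative according to the order of two labels, so the six orders of
    three labels give six sign patterns. All follow from the positive one by cancelling inverses;
    the two remaining patterns belong to no order and do not occur. *)
Lemma mixed_braids (T : Type) (A : T -> Prop) (a a' b b' : T -> T) :
  (forall y, A y -> A (a y)) -> (forall y, A y -> A (a' y)) ->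
  (forall y, A y -> A (b y)) -> (forall y, A y -> A (b' y)) ->
  (forall y, A y -> a' (a y) = y) -> (forall y, A y -> a (a' y) = y) ->
  (forall y, A y -> b' (b y) = y) -> (forall y, A y -> b (b' y) = y) ->
  (forall y, A y -> a (b (a y)) = b (a (b y))) ->
  [/\ forall y, A y -> a' (b (a y)) = b (a (b' y)),
      forall y, A y -> a (b (a' y)) = b' (a (b y)) &
      [/\ forall y, A y -> a' (b' (a y)) = b (a' (b' y)),
          forall y, A y -> a (b' (a' y)) = b' (a' (b y)) &
          forall y, A y -> a' (b' (a' y)) = b' (a' (b' y))]].
Proof.
move=> Aa Aa' Ab Ab' aK aK' bK bK' B; split; last split; move=> y Ay.
- by rewrite -{1}(bK' y Ay) -B ?aK; auto.
- by rewrite -{2}(aK' y Ay) B ?bK; auto.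
- have [z Az ->] : exists2 z, A z & y = b (a z).
    by exists (a' (b' y)); rewrite ?aK' ?bK'; auto.
  by rewrite B ?bK ?aK; auto.
- have [z Az ->] : exists2 z, A z & y = a (b z).
    by exists (b' (a' y)); rewrite ?bK' ?aK'; auto.
  by rewrite -B ?aK ?bK; auto.
- have [z Az ->] : exists2 z, A z & y = a (b (a z)).
    by exists (a' (b' (a' y))); rewrite ?aK' ?bK' ?aK'; auto.
  by rewrite {2}B ?aK ?bK ?aK ?bK; auto.
Qed.

(** * Exchanging arbitrary contents: inverses, commutation, braid relation *)

Section SiteOperators.
Variables (n r : nat) (P : schur_module n r).
Hypothesis (n4 : (3 < n)%N).
Implicit Types (o : option 'I_r) (i j : 'I_n) (x : P).

(* Exchanges the contents [o1], [o2] (a labelled particle or a hole) of the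
   sites [i] and [i+1].  On the tensor space it maps basis vectors to basis
   vectors, whence the choice between [swap] and its inverse. *)
Definition exch o1 o2 i x : P :=
  match o1, o2 with
  | None, None => x
  | Some _, None => X P false i x
  | None, Some _ => X P true i x
  | Some k, Some l => if (k < l)%N then swap i x else swap' i x
  end.

Definition occ_wt (o : 'I_n -> option 'I_r) (i : 'I_n) : int := (isSome (o i))%:Z.

Definition osep o1 o2 := if o1 is Some k then o2 != Some k else true.

Lemma wt_exch (o : 'I_n -> option 'I_r) i x : wt (occ_wt o) x ->
  wt (occ_wt (o \o tperm i (ordS i))) (exch (o i) (o (ordS i)) i x).
Proof.
have tpE (p : 'I_n -> option 'I_r) m : p (tperm i (ordS i) m) =
    if m == i then p (ordS i) else if m == ordS i then p i else p m.
  by case: tpermP => [->|->|/eqP/negPf-> /eqP/negPf->] //; rewrite eqxx // (ordS_neqs n4).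
move=> w; rewrite /exch; case e1: (o i) => [k|]; case e2: (o (ordS i)) => [l|].
- have e : occ_wt o =1 occ_wt (o \o tperm i (ordS i)).
    move=> m; rewrite /occ_wt /= tpE; case: eqP => [->|_]; first by rewrite e1 e2.
    by case: eqP => [->|_] //; rewrite e1 e2.
  by apply: wt_ext e _; case: ifP => _; [apply: wt_swap|apply: wt_swap'].
- apply: wt_ext (wt_shift n4 false i w) => m.
  rewrite /occ_wt /shift /= tpE; case: (eqVneq m i) => [->|mi].
    by rewrite (ordS_neqs n4) e1 e2.
  by case: (eqVneq m (ordS i)) => [->|_]; rewrite ?e1 ?e2 //=; lia.
- apply: wt_ext (wt_shift n4 true i w) => m.
  rewrite /occ_wt /shift /= tpE; case: (eqVneq m i) => [->|mi].
    by rewrite (ordS_neqs n4) e1 e2.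
  by case: (eqVneq m (ordS i)) => [->|_]; rewrite ?e1 ?e2 //=; lia.
- apply: wt_ext w => m; rewrite /occ_wt /= tpE; case: eqP => [->|_]; first by rewrite e1 e2.
  by case: eqP => [->|_] //; rewrite e1 e2.
Qed.

Section Local.
Variables (lam : 'I_n -> int) (x : P).
Hypothesis (w : wt lam x).

Lemma exchK o1 o2 i : lam i = (isSome o1)%:Z -> lam (ordS i) = (isSome o2)%:Z ->
  osep o1 o2 -> exch o2 o1 i (exch o1 o2 i x) = x.
Proof.
case: o1 o2 => [k|] [l|] //= li lj; last 2 first.
- by move=> _; apply: (XX_inv1 n4 (b := false) (i := i) w).
- by move=> _; apply: (XX_inv1 n4 (b := true) (i := i) w).
move=> lk; have [kl|lk'|e] := ltngtP k l.
- by apply: swapK w _ _.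
- by apply: swap'K w _ _.
- by case/eqP: lk; congr Some; apply: val_inj.
Qed.

Lemma exch_far o1 o2 o3 o4 i j : i != j -> ~~ adjacent i j ->
  exch o1 o2 i (exch o3 o4 j x) = exch o3 o4 j (exch o1 o2 i x).
Proof.
move=> ij aij.
have ji : j != i by rewrite eq_sym.
have c b b' y : X P b i (X P b' j y) = X P b' j (X P b i y).
  have [->|] := eqVneq b' b; first exact: XX_far.
  by case: b; case: b' => // _; [apply: (XX_opp true)|apply: (XX_opp false)].
have cs b y : X P b i (swap j y) = swap j (X P b i y) by rewrite /swap XB XZ !c.
have sc b y : swap i (X P b j y) = X P b j (swap i y) by rewrite /swap XB XZ !c.
have cs' b y : X P b i (swap' j y) = swap' j (X P b i y) by rewrite /swap' XB XZ !cs.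
have sc' b y : swap' i (X P b j y) = X P b j (swap' i y) by rewrite /swap' XB XZ !sc.
have ss (y : P) : swap i (swap j y) = swap j (swap i y).
  by rewrite [swap j y]/swap [swap j (swap i y)]/swap -!scaleNr swapD swapZ !sc.
have ss' (y : P) : swap i (swap' j y) = swap' j (swap i y).
  by rewrite /swap' -!scaleNr swapD swapZ ss.
have s's (y : P) : swap' i (swap j y) = swap j (swap' i y).
  by rewrite /swap' -!scaleNr swapD swapZ ss.
have s's' (y : P) : swap' i (swap' j y) = swap' j (swap' i y).
  by rewrite [swap' j y]/swap' [swap' j (swap' i y)]/swap' -!scaleNr swap'D swap'Z s's.
case: o1 o2 o3 o4 => [k1|] [k2|] [k3|] [k4|] //=; do ?case: ifP => _ //.
all: by rewrite ?(c, cs, sc, cs', sc', ss, ss', s's, s's').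
Qed.

(** Three particles: a mixed braid relation whose signs are fixed by the labels. Two particles: the
    arrangements with one hole, where passing from [swap] to [swap'] alters both sides by the same
    vector. One particle in the middle: it goes out and back on both sides. *)
Lemma exch_braid o1 o2 o3 i : lam i = (isSome o1)%:Z -> lam (ordS i) = (isSome o2)%:Z ->
  lam (ordS (ordS i)) = (isSome o3)%:Z -> osep o1 o2 -> osep o1 o3 -> osep o2 o3 ->
  exch o2 o3 i (exch o1 o3 (ordS i) (exch o1 o2 i x)) =
  exch o1 o2 (ordS i) (exch o1 o3 i (exch o2 o3 (ordS i) x)).
Proof.
set j := ordS i.
case: o1 o2 o3 => [k1|] [k2|] [k3|] //= li lj lk s12 s13 s23.
- have n12 : k1 != k2 by apply: contraNneq s12 => ->.
  have n13 : k1 != k3 by apply: contraNneq s13 => ->.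
  have n23 : k2 != k3 by apply: contraNneq s23 => ->.
  have B (y : P) : wt lam y -> swap i (swap j (swap i y)) = swap j (swap i (swap j y)).
    by move=> wy; apply: swap_braid_111 wy _ _ _.
  have iK (y : P) : wt lam y -> swap' i (swap i y) = y by move=> wy; apply: swapK wy _ _.
  have iK' (y : P) : wt lam y -> swap i (swap' i y) = y by move=> wy; apply: swap'K wy _ _.
  have jK (y : P) : wt lam y -> swap' j (swap j y) = y by move=> wy; apply: swapK wy _ _.
  have jK' (y : P) : wt lam y -> swap j (swap' j y) = y by move=> wy; apply: swap'K wy _ _.
  have [b1 b2 [b3 b4 b5]] := mixed_braids (fun y => @wt_swap _ _ _ n4 lam i y)
    (fun y => @wt_swap' _ _ _ n4 lam i y) (fun y => @wt_swap _ _ _ n4 lam j y)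
    (fun y => @wt_swap' _ _ _ n4 lam j y) iK iK' jK jK' B.
  by case: (ltngtP k1 k2) n12 => [l12|l12|/val_inj->]; rewrite ?eqxx // => _;
     case: (ltngtP k1 k3) n13 => [l13|l13|/val_inj->]; rewrite ?eqxx // => _;
     case: (ltngtP k2 k3) n23 => [l23|l23|/val_inj->]; rewrite ?eqxx // => _;
     auto; exfalso; lia.
- have := swap_braid_110 n4 w li lj lk; case: ifP => _ //; rewrite /swap'.
  by move: (swap i x) (swap _ _) => y z e; rewrite !XB !XZ e.
- have := swap_braid_101 n4 w li lj lk; case: ifP => _ //; rewrite /swap' -/j => e.
  move: (swap j _) (swap i _) e => y z e; rewrite !XB !XZ e.
  have -> : X P true i (X P false i x) = x by apply: (XX_inv1 n4 (b := false) (i := i) w).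
  by have -> : X P false j (X P true j x) = x by apply: (XX_inv1 n4 (b := true) (i := j) w).
- have := swap_braid_011 n4 w li lj lk; case: ifP => _ //; rewrite /swap' -/j => e.
  by move: (swap j x) (swap i _) e => y z e; rewrite !XB !XZ e.
- have -> : X P false i (X P true i x) = x by apply: (XX_inv1 n4 (b := true) (i := i) w).
  by have -> : X P true j (X P false j x) = x by apply: (XX_inv1 n4 (b := false) (i := j) w).
Qed.

End Local.
End SiteOperators.

(** * Vectors attached to configurations *)

Section Sites.
Variable n : nat.
Hypothesis n0 : (0 < n)%N.

Lemma site_subproof (a : int) : (`|(a %% n)%Z| < n)%N.
Proof. by have := @ltz_pmod a n; have := @modz_ge0 a n; lia. Qed.
Definition site (a : int) : 'I_n := Ordinal (site_subproof a).

Lemma congnE a (i : 'I_n) : congn a i = (site a == i).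
Proof.
have := @modz_ge0 a n; rewrite /congn -val_eqE /= => h.
by apply/eqP/eqP; lia.
Qed.

Lemma eq_site a b : (site a == site b) = (a == b %[mod n])%Z.
Proof.
have := @modz_ge0 a n; have := @modz_ge0 b n; rewrite -val_eqE /= => h1 h2.
by apply/eqP/eqP; lia.
Qed.

Lemma siteS a : site (a + 1) = ordS (site a).
Proof.
apply/val_inj => /=; have h := @modz_ge0 a n; have h' := @modz_ge0 (a + 1) n.
suff : (`|(a %% n)%Z|.+1 %% n)%N%:Z = ((a + 1) %% n)%Z by lia.
rewrite -modz_nat -(modzDml a) -addn1 PoszD; congr ((_ + 1) %% _)%Z; lia.
Qed.

Lemma siteB a : site (a - 1) = ord_pred (site a).
Proof. by apply: (@ordS_inj n); rewrite ord_predK -siteS subrK. Qed.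

End Sites.

Lemma lt3_gt0 n : (3 < n)%N -> (0 < n)%N. Proof. exact: ltn_trans. Qed.

(** * Configurations, exchanges and energy *)

Section States.
Variables (n r : nat) (P : schur_module n r).
Hypothesis (n4 : (3 < n)%N) (rn : (r < n)%N).
Local Notation state := {ffun 'I_r -> int}.
Local Notation site := (site (lt3_gt0 n4)).
Implicit Types (t : state) (i j : 'I_n) (k l : 'I_r).

Definition strict t := forall k l, site (t k) = site (t l) -> k = l.
Definition occ t i : option 'I_r := [pick k | site (t k) == i].
(** The simple reflection s_i of the affine symmetric group, acting on positions. *)
Definition step i t : state :=
  [ffun k => if site (t k) == i then t k + 1 else if site (t k) == ordS i then t k - 1 else t k].
Definition disp t k : int := t k - (k : nat)%:Z.
(** Squared distance to [home]. Exchanging particle k on site i with particle l on site i+1 changes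
    it by 2 (d_k - d_l + 1), where d denotes the displacement. *)
Definition energy t : nat := `|(\sum_k disp t k ^+ 2)%R|%N.
Definition home : state := [ffun k : 'I_r => (k : nat)%:Z].

Lemma occ_some t k : strict t -> occ t (site (t k)) = Some k.
Proof.
by move=> s; rewrite /occ; case: pickP => [l /eqP/s-> //|/(_ k)]; rewrite eqxx.
Qed.

Lemma occP t i k : strict t -> (occ t i == Some k) = (site (t k) == i).
Proof.
move=> s; apply/eqP/eqP => [|<-]; last exact: occ_some.
by rewrite /occ; case: pickP => // l /eqP <- [<-].
Qed.

Lemma site_step i t k : site (step i t k) = tperm i (ordS i) (site (t k)).
Proof.
rewrite ffunE; case: tpermP => [e|e|/eqP/negPf-> /eqP/negPf->] //.
  by rewrite e eqxx siteS e.
by rewrite e (ordS_neqs n4) eqxx siteB e ordSK.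
Qed.

Lemma strict_step i t : strict t -> strict (step i t).
Proof. by move=> s k l; rewrite !site_step => /perm_inj/s. Qed.

Lemma occ_step i t j : strict t -> occ (step i t) j = occ t (tperm i (ordS i) j).
Proof.
move=> s; have s' := strict_step (i := i) s.
have h k : (occ (step i t) j == Some k) = (occ t (tperm i (ordS i) j) == Some k).
  by rewrite !occP // site_step -(inj_eq (@perm_inj _ (tperm i (ordS i)))) tpermK.
case e: (occ t _) h => [k|] h; first by apply/eqP; rewrite h.
by case e': (occ (step i t) j) h => [k|] // /(_ k); rewrite eqxx.
Qed.

(** Labels are smaller than r < n, hence determined by their residues modulo n. *)
Lemma strict_inj t k l (a : int) : strict t -> t k + a - k%:Z = t l - l%:Z ->
  site (t k + a) = site (t l) -> k = l.
Proof.
move=> s h /eqP; rewrite eq_site => e; apply/val_inj => /=.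
have {}e : (k%:Z == l%:Z %[mod n])%Z.
  move: e; rewrite !eqz_mod_dvd; congr (_ %| _)%Z; lia.
by move: e; rewrite !modz_nat eqz_nat !modn_small => [/eqP//||]; apply: ltn_trans rn.
Qed.

Lemma occ_sum (V : nmodType) t i (phi : 'I_r -> V) : strict t ->
  \sum_k (if site (t k) == i then phi k else 0) = oapp phi 0 (occ t i).
Proof.
move=> s; rewrite -big_mkcond /=; case e: (occ t i) => [k|] /=.
  move/eqP: e; rewrite occP // => /eqP <-; rewrite (big_pred1 k) // => l.
  by apply/eqP/eqP => [/s->|->].
by move: e; rewrite /occ; case: pickP => // h _; rewrite big_pred0.
Qed.

Lemma energyE t : (energy t)%:Z = \sum_k disp t k ^+ 2.
Proof. by rewrite /energy gez0_abs // sumr_ge0 // => k _; apply: sqr_ge0. Qed.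

Lemma energy_step t i : strict t ->
  (energy (step i t))%:Z = (energy t)%:Z + oapp (fun k => 2 * disp t k + 1) 0 (occ t i)
     + oapp (fun k => 1 - 2 * disp t k) 0 (occ t (ordS i)).
Proof.
move=> s; rewrite -!occ_sum // !energyE -!big_split /=; apply: eq_bigr => k _.
rewrite /disp ffunE; have [->|ki] := eqVneq (site (t k)) i.
  by rewrite (ordS_neqs n4) addr0; ring.
by have [_|_] := eqVneq (site (t k)) (ordS i); ring.
Qed.

Lemma disp_step t i j k : strict t -> occ t j = Some k ->
  disp (step i t) k = disp t k + (j == i)%:Z - (j == ordS i)%:Z.
Proof.
move=> s /eqP; rewrite occP // => /eqP e; rewrite /disp ffunE e.
have [->|ji] := eqVneq j i; first by rewrite (ordS_neqs n4) /=; lia.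
by have [_|_] := eqVneq j (ordS i) => /=; lia.
Qed.

(** Equality would make two labels congruent modulo n. It is the only case in which exchanging two
    particles would preserve the energy, so every such exchange goes strictly up or down. *)
Lemma disp_neq1 t i k l : strict t -> occ t i = Some k -> occ t (ordS i) = Some l ->
  disp t l != disp t k + 1.
Proof.
move=> s /eqP; rewrite occP // => /eqP ek /eqP; rewrite occP // => /eqP el; apply/eqP => h.
have /strict_inj : t k + 1 - k%:Z = t l - l%:Z by move: h; rewrite /disp; lia.
rewrite siteS ek el => /(_ s erefl) kl.
by move: el; rewrite -kl ek => /esym/eqP; rewrite (ordS_neqs n4).
Qed.

Lemma disp_neq2 t i k l : strict t -> occ t i = Some k -> occ t (ordS (ordS i)) = Some l ->
  disp t l != disp t k + 2.
Proof.
move=> s /eqP; rewrite occP // => /eqP ek /eqP; rewrite occP // => /eqP el; apply/eqP => h.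
have /strict_inj : t k + (1 + 1) - k%:Z = t l - l%:Z by move: h; rewrite /disp; lia.
rewrite addrA !siteS ek el => /(_ s erefl) kl.
by move: el; rewrite -kl ek => /esym/eqP; rewrite (ordS_neqs n4).
Qed.

Lemma occ_neq t i j k l : occ t i = Some k -> occ t j = Some l -> strict t -> i != j -> k != l.
Proof.
move=> ek el s; apply: contraNneq => kl; move/eqP: ek; rewrite occP // => /eqP <-.
by move/eqP: el; rewrite occP // kl => /eqP ->.
Qed.

Lemma stepK i : involutive (step i).
Proof.
move=> t; apply/ffunP => k; rewrite !ffunE.
have [e|ki] := eqVneq (site (t k)) i.
  by rewrite siteS e (ordS_neqs n4) eqxx addrK.
have [e|kj] := eqVneq (site (t k)) (ordS i); last by rewrite (negPf ki) (negPf kj).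
by rewrite siteB e ordSK eqxx subrK.
Qed.

Lemma stepE i t k :
  step i t k = t k + (site (t k) == i)%:Z - (site (t k) == ordS i)%:Z.
Proof.
rewrite ffunE; have [->|_] := eqVneq (site (t k)) i; first by rewrite (ordS_neqs n4) subr0.
by case: ifP; rewrite ?addr0 ?subr0.
Qed.

Lemma tperm_eq i m j : (tperm i (ordS i) m == j) =
  if j == i then m == ordS i else if j == ordS i then m == i else m == j.
Proof.
rewrite -(inj_eq (@perm_inj _ (tperm i (ordS i)))) tpermK.
by case: (tpermP i (ordS i) j) => [->|->|/eqP/negPf-> /eqP/negPf->]; rewrite ?eqxx // (ordS_neqs n4).
Qed.

Lemma step_far i j t : i != j -> ~~ adjacent i j -> step i (step j t) = step j (step i t).
Proof.
rewrite adjacentE negb_or => /negPf ij /andP[/negPf a1 /negPf a2].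
apply/ffunP => k; rewrite [LHS]stepE [RHS]stepE !site_step !stepE !tperm_eq.
have ji : (j == i) = false by rewrite eq_sym.
have a1' : (ordS i == j) = false by rewrite eq_sym.
have a2' : (i == ordS j) = false by rewrite eq_sym.
by rewrite ij ji a1 a2 a1' a2' !(ordS_neqs n4) ij ji; ring.
Qed.

Lemma step_braid i t :
  step i (step (ordS i) (step i t)) = step (ordS i) (step i (step (ordS i) t)).
Proof.
apply/ffunP => k; rewrite [LHS]stepE [RHS]stepE !site_step.
rewrite [step (ordS i) (step i t) k]stepE [step i (step _ t) k]stepE !site_step !stepE.
by do 3!rewrite ?tperm_eq ?(ordS_neqs n4) ?eqxx; ring.
Qed.

Lemma step_none i t : strict t -> occ t i = None -> occ t (ordS i) = None -> step i t = t.
Proof.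
move=> s e1 e2; apply/ffunP => k; rewrite stepE -!occP // e1 e2 /=; lia.
Qed.

(* A particle displaced upwards is preceded on its lower side by particles
   displaced upwards, or else can be moved down; as some site is empty, a state in
   which no exchange lowers the energy is [home]. *)
Lemma home_of_minimal t : strict t ->
  (forall i, (energy t <= energy (step i t))%N) -> t = home.
Proof.
move=> s h.
(* A walk around the whole circle cannot meet occupied sites only, as r < n. *)
have noall (f : nat -> 'I_n) : (forall i, exists c, f c = i) ->
    ~ (forall c, exists k, occ t (f c) = Some k).
  move=> fs fo; suff : (n <= r)%N by rewrite leqNgt rn.
  have g i : exists k, occ t i == Some k.
    by have [c <-] := fs i; have [k ->] := fo c; exists k.
  rewrite -[n]card_ord -[r]card_ord; apply: (@leq_card _ _ (fun i => xchoose (g i))).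
  move=> i j e; have := xchooseP (g i); have := xchooseP (g j); rewrite e !occP //.
  by move=> /eqP h1 /eqP h2; rewrite -h1 -h2.
have hz i : 0 <= oapp (fun k => 2 * disp t k + 1) 0 (occ t i)
     + oapp (fun k => 1 - 2 * disp t k) 0 (occ t (ordS i)).
  by have := h i; have := energy_step i s; lia.
apply/ffunP => k; rewrite ffunE; suff : disp t k = 0 by move/eqP; rewrite subr_eq0 => /eqP.
have [d0|d0|//] := ltrgt0P (disp t k).
- exfalso; apply: (noall (fun c => iter c (@ord_pred n) (site (t k)))).
    by move=> i; have [c _ <-] := iter_ord_pred_surj (site (t k)) i; exists c.
  suff H c : exists2 l, occ t (iter c (@ord_pred n) (site (t k))) = Some l & 0 < disp t l.
    by move=> c; have [l e _] := H c; exists l.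
  elim: c => [|c [l e dl]]; first by exists k => //=; rewrite (occ_some k s).
  rewrite iterS; set p := ord_pred _.
  have {}e : occ t (ordS p) = Some l by rewrite ord_predK.
  have := hz p; rewrite e; case ep: (occ t p) => [q|] /=; last by lia.
  by have := disp_neq1 s ep e; exists q => //; lia.
- exfalso; apply: (noall (fun c => iter c (@ordS n) (site (t k)))).
    by move=> i; have [c _ <-] := iter_ordS_surj (site (t k)) i; exists c.
  suff H c : exists2 l, occ t (iter c (@ordS n) (site (t k))) = Some l & disp t l < 0.
    by move=> c; have [l e _] := H c; exists l.
  elim: c => [|c [l e dl]]; first by exists k => //=; rewrite (occ_some k s).
  rewrite iterS; have := hz (iter c (@ordS n) (site (t k))).
  rewrite e; case ep: (occ t (ordS _)) => [q|] /=; last by lia.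
  by have := disp_neq1 s e ep; exists q => //; lia.
Qed.

End States.

(** * Confluence of the exchanges lowering the energy *)

Section StrictVectors.
Variables (n r : nat) (P : schur_module n r).
Hypothesis (n4 : (3 < n)%N) (rn : (r < n)%N).
Local Notation state := {ffun 'I_r -> int}.
Implicit Types (t : state) (i j : 'I_n) (x : P).
Local Notation occ := (occ n4).
Local Notation step := (step n4).
Local Notation strict := (strict n4).

Definition move t i x : P := exch (occ t i) (occ t (ordS i)) i x.
Definition swt t : 'I_n -> int := occ_wt (occ t).

Lemma osep_occ t i j : strict t -> i != j -> osep (occ t i) (occ t j).
Proof.
move=> s ij; rewrite /osep; case ei: (occ t i) => [k|] //; apply/eqP => ej.
by have := occ_neq ei ej s ij; rewrite eqxx.
Qed.

Lemma occ_step_l t i : strict t -> occ (step i t) i = occ t (ordS i).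
Proof. by move=> s; rewrite occ_step // tpermL. Qed.
Lemma occ_step_r t i : strict t -> occ (step i t) (ordS i) = occ t i.
Proof. by move=> s; rewrite occ_step // tpermR. Qed.
Lemma occ_step_D t i j : strict t -> i != j -> ordS i != j -> occ (step i t) j = occ t j.
Proof. by move=> s ij ij'; rewrite occ_step // tpermD. Qed.

Lemma wt_move t i x : strict t -> wt (swt t) x -> wt (swt (step i t)) (move t i x).
Proof.
by move=> s w; apply: wt_ext (wt_exch n4 i w) => j; rewrite /swt /occ_wt /= occ_step.
Qed.

Lemma moveK t i x : strict t -> wt (swt t) x -> move (step i t) i (move t i x) = x.
Proof.
move=> s w; rewrite /move occ_step_l // occ_step_r //.
refine (exchK n4 w erefl erefl _).
by apply: osep_occ => //; rewrite (ordS_neqs n4).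
Qed.

Lemma move_far t i j x : strict t -> i != j -> ~~ adjacent i j ->
  move (step j t) i (move t j x) = move (step i t) j (move t i x).
Proof.
move=> s ij aij; rewrite /move; have := aij; rewrite adjacentE negb_or => /andP[a1 a2].
have [a1' a2' ji] : [/\ ordS i != j, i != ordS j & j != i].
  by split; rewrite eq_sym.
rewrite !(occ_step_D s) // ?(inj_eq (@ordS_inj n)) //.
exact: exch_far.
Qed.

Lemma move_braid t i x : strict t -> wt (swt t) x -> let j := ordS i in
  move (step j (step i t)) i (move (step i t) j (move t i x)) =
  move (step i (step j t)) j (move (step j t) i (move t j x)).
Proof.
move=> s w j; rewrite /move; have S' := ordS_neqs n4.
have si := strict_step (i := i) s; have sj := strict_step (i := j) s.
rewrite !(occ_step_l, occ_step_r) // !(occ_step_D si) ?S' // !(occ_step_D sj) ?S' //.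
rewrite ?(occ_step_l, occ_step_r) // ?(occ_step_D s) ?S' // ?(occ_step_r, occ_step_l) //.
refine (exch_braid n4 w erefl erefl erefl _ _ _).
all: by apply: osep_occ => //; rewrite ?S'.
Qed.

Lemma energy_neq t i : strict t ->
  occ t i = None /\ occ t (ordS i) = None \/ energy (step i t) != energy t.
Proof.
move=> s; have := energy_step i s.
case ei: (occ t i) => [k|]; case ej: (occ t (ordS i)) => [l|] /= e; last by left.
- by right; apply/eqP; have := disp_neq1 rn s ei ej; lia.
- by right; apply/eqP; lia.
- by right; apply/eqP; lia.
Qed.

Lemma energy_far t i j : strict t -> i != j -> ~~ adjacent i j ->
  (energy (step i t) < energy t)%N -> (energy (step i (step j t)) < energy (step j t))%N.
Proof.
move=> s ij; rewrite adjacentE negb_or => /andP[a1 a2].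
have [a1' a2' ji] : [/\ ordS i != j, i != ordS j & j != i].
  by split; rewrite eq_sym.
have sj := strict_step (i := j) s; have := energy_step i s; have := energy_step i sj.
rewrite !(occ_step_D s) // ?(inj_eq (@ordS_inj n)) //.
case ei: (occ t i) => [k|]; case ej: (occ t (ordS i)) => [l|] /=;
  rewrite ?(disp_step rn j s ei) ?(disp_step rn j s ej) ?(inj_eq (@ordS_inj n)) ?(negPf ij)
     ?(negPf a1') ?(negPf a2') /=; lia.
Qed.

(** A comparison of integers in terms of the displacements of the particles on the three sites. The
    delicate case is a hole between particles k and p: the three exchanges change the energy by 4
    (d_k - d_p + 2), which the hypotheses only make nonpositive, and [disp_neq2] excludes zero. *)
Lemma energy_braid t i : strict t -> let j := ordS i in
  (energy (step i t) < energy t)%N -> (energy (step j t) < energy t)%N ->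
  [/\ (energy (step j (step i t)) < energy t)%N, (energy (step i (step j t)) < energy t)%N &
      (energy (step i (step j (step i t))) < energy t)%N].
Proof.
move=> s j; set a := step i t; set b := step j t; set c := step j a.
have S' := ordS_neqs n4.
have sa : strict a by apply: strict_step.
have sb : strict b by apply: strict_step.
have sc : strict c by apply: strict_step.
have := (energy_step i s, energy_step j s, energy_step j sa, energy_step i sb, energy_step i sc).
rewrite -/a -/b -/c => -[[[[]]]].
have o1 : occ a i = occ t j by apply: occ_step_l.
have o2 : occ a j = occ t i by apply: occ_step_r.
have o3 : occ a (ordS j) = occ t (ordS j) by apply: occ_step_D; rewrite ?S'.
have p1 : occ b i = occ t i by apply: occ_step_D; rewrite ?S'.
have p2 : occ b j = occ t (ordS j) by apply: occ_step_l.
have q1 : occ c i = occ t j by rewrite -o1; apply: occ_step_D; rewrite ?S'.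
have q2 : occ c j = occ t (ordS j) by rewrite -o3; apply: occ_step_l.
rewrite o2 o3 p1 p2 q1 q2.
have D1 u : occ t i = Some u -> disp a u = disp t u + 1 /\ disp b u = disp t u.
  move=> e; rewrite (disp_step rn i s e) (disp_step rn j s e) eqxx !S' /=; lia.
have D2 u : occ t j = Some u -> disp c u = disp t u - 1.
  move=> e; have ea : occ a i = Some u by rewrite o1.
  rewrite (disp_step rn j sa ea) (disp_step rn i s e) eqxx !S' /=; lia.
have D3 u : occ t (ordS j) = Some u ->
    [/\ disp a u = disp t u, disp b u = disp t u - 1 & disp c u = disp t u - 1].
  move=> e; have ea : occ a (ordS j) = Some u by rewrite o3.
  rewrite (disp_step rn j sa ea) (disp_step rn i s e) (disp_step rn j s e) eqxx !S' /=; split; lia.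
case e1: (occ t i) D1 => [k|] D1; case e2: (occ t j) D2 => [l|] D2;
  case e3: (occ t (ordS j)) D3 => [p|] D3 /=.
- have [-> ->] := D1 _ erefl; rewrite (D2 _ erefl); have [-> -> ->] := D3 _ erefl.
  have := disp_neq1 rn s e1 e2; have := disp_neq1 rn s e2 e3; split; lia.
- by have [-> ->] := D1 _ erefl; rewrite (D2 _ erefl); split; lia.
- have [-> ->] := D1 _ erefl; have [-> -> ->] := D3 _ erefl.
  have := disp_neq2 rn s e1 e3; split; lia.
- by have [-> ->] := D1 _ erefl; split; lia.
- by rewrite (D2 _ erefl); have [-> -> ->] := D3 _ erefl; split; lia.
- by rewrite (D2 _ erefl); split; lia.
- by have [-> -> ->] := D3 _ erefl; split; lia.
- by split; lia.
Qed.

Variable m : P.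

(** Exchanges are undone along an arbitrary energy-lowering path, chosen by [pick]; the fuel [N]
    only has to exceed the energy. Independence of the path is proved afterwards. *)
Fixpoint strict_rec (N : nat) t : P :=
  if N is N'.+1 then
    if [pick i | (energy (step i t) < energy t)%N] is Some i
    then move (step i t) i (strict_rec N' (step i t)) else m
  else m.
Definition strict_vec t := strict_rec (energy t).+1 t.

Lemma strict_rec_stable N M t : (energy t < N)%N -> (energy t < M)%N ->
  strict_rec N t = strict_rec M t.
Proof.
elim: N M t => // N IH [|M] t //= tN tM; case: pickP => // i ti.
by congr move; apply: IH; apply: leq_trans ti _; rewrite -ltnS.
Qed.

Lemma strict_vecE t : strict_vec t =
  if [pick i | (energy (step i t) < energy t)%N] is Some i
  then move (step i t) i (strict_vec (step i t)) else m.
Proof.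
rewrite /strict_vec [LHS]/=; case: pickP => // i ti.
by congr move; apply: strict_rec_stable.
Qed.

Hypothesis wm : wt (swt (home r)) m.

(** The second clause says that the value does not depend on the exchange selected by [pick]. *)
Definition strict_ok t := wt (swt t) (strict_vec t) /\
  forall i, (energy (step i t) < energy t)%N ->
    strict_vec t = move (step i t) i (strict_vec (step i t)).

(** Extends compatibility from lowering exchanges to all: a raising one is the inverse of a lowering
    one, and one that keeps the energy involves two empty sites and does nothing. *)
Lemma strict_edge t i : strict t -> strict_ok t -> strict_ok (step i t) ->
  strict_vec (step i t) = move t i (strict_vec t).
Proof.
move=> s [w h] [w' h']; have [[e1 e2]|] := energy_neq i s.
  by rewrite step_none // /move e1 e2.
rewrite neq_ltn => /orP[l|l].
  by rewrite (h i l) -[X in move X](stepK n4 i t) moveK //; apply: strict_step.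
by rewrite (h' i) stepK.
Qed.

Lemma move_inj t i x y : strict t -> wt (swt t) x -> wt (swt t) y ->
  move t i x = move t i y -> x = y.
Proof. by move=> s wx wy e; rewrite -[x](moveK i s wx) e moveK. Qed.

(** Diamond-lemma induction on the energy: two lowering exchanges are joined by a square when they
    commute and by a hexagon when they are adjacent. *)
Lemma strict_vec_ok t : strict t -> strict_ok t.
Proof.
have [N] := ubnP (energy t); elim: N t => // N IH t; rewrite ltnS => tN s.
have {}IH u : strict u -> (energy u < energy t)%N -> strict_ok u.
  by move=> su ut; apply: IH su; apply: leq_trans ut tN.
have S i : strict (step i t) by apply: strict_step.
have back i : (energy (step i t) < energy t)%N ->
    wt (swt t) (move (step i t) i (strict_vec (step i t))).
  move=> l; have := wt_move i (S i) (IH _ (S i) l).1.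
  by rewrite stepK.
(* Two energy-lowering exchanges at adjacent nodes start a hexagon whose other
   vertices all have lower energy. *)
have adj i : let j := ordS i in
    (energy (step i t) < energy t)%N -> (energy (step j t) < energy t)%N ->
    move (step i t) i (strict_vec (step i t)) = move (step j t) j (strict_vec (step j t)).
  move=> j li lj; have [l1 l2 l3] := energy_braid s li lj.
  have oi := IH _ (S i) li; have oj := IH _ (S j) lj.
  have sji : strict (step j (step i t)) by apply: strict_step.
  have sij : strict (step i (step j t)) by apply: strict_step.
  have oji := IH _ sji l1; have oij := IH _ sij l2.
  have oc : strict_ok (step i (step j (step i t))) by apply: IH l3; apply: strict_step.
  (* Let z be the candidate for t coming from the side of i. The two paths from z to the opposite
     vertex agree by [move_braid]; cancelling the last moves identifies z with the candidate coming
     from the side of j. *)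
  set z := move (step i t) i (strict_vec (step i t)).
  have wz : wt (swt t) z by apply: back.
  have ez : strict_vec (step i t) = move t i z.
    by rewrite -[X in move X](stepK n4 i t) moveK //; exact: oi.1.
  have ec := strict_edge sji oji oc.
  rewrite (strict_edge (i := j) (S i) oi oji) ez (move_braid i s wz) in ec.
  rewrite step_braid in ec oc.
  rewrite (strict_edge (i := j) sij oij oc) (strict_edge (i := i) (S j) oj oij) in ec.
  have wj : wt (swt (step j t)) (move t j z) by apply: wt_move.
  have /move_inj : move (step i (step j t)) j (move (step j t) i (strict_vec (step j t))) =
      move (step i (step j t)) j (move (step j t) i (move t j z)) by [].
  move=> /(_ sij (wt_move i (S j) oj.1) (wt_move i (S j) wj)).
  move/(move_inj (S j) oj.1 wj) => ->.
  by rewrite moveK.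
have conf i j : (energy (step i t) < energy t)%N -> (energy (step j t) < energy t)%N ->
    move (step i t) i (strict_vec (step i t)) = move (step j t) j (strict_vec (step j t)).
  move=> li lj; have [->//|ij] := eqVneq i j.
  have [|aij] := boolP (adjacent i j).
    by rewrite adjacentE => /orP[/eqP e|/eqP e]; [rewrite e; apply: adj; rewrite -?e|
       rewrite -e; apply/esym/adj; rewrite ?e].
  (* The fourth vertex of the square lies below both neighbours of t, so the induction hypothesis
     covers it. *)
  have l1 := energy_far s ij aij li.
  have aji : ~~ adjacent j i by move: aij; rewrite !adjacentE orbC ![_ == ordS _]eq_sym.
  have l2 : (energy (step j (step i t)) < energy (step i t))%N.
    by apply: energy_far => //; rewrite eq_sym.
  have su : strict (step i (step j t)) by do 2!apply: strict_step.
  have eu : step i (step j t) = step j (step i t) by apply: step_far.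
  have ou : strict_ok (step i (step j t)) by apply: IH su _; apply: ltn_trans l1 lj.
  have oi := IH _ (S i) li; have oj := IH _ (S j) lj.
  rewrite (oi.2 j l2) (oj.2 i l1) -eu.
  have := move_far (strict_vec (step i (step j t))) su ij aij.
  have -> : step j (step i (step j t)) = step i t by rewrite eu stepK.
  by rewrite stepK => ->.
split.
  rewrite strict_vecE; case: pickP => [i li|h]; first exact: back.
  have -> : t = home r; last exact: wm.
  by apply: (@home_of_minimal _ _ n4 rn t s) => i; rewrite leqNgt h.
move=> i li; rewrite strict_vecE; case: pickP => [j lj|/(_ i)]; last by rewrite li.
exact: conf.
Qed.

Lemma strict_vec_step t i : strict t -> strict_vec (step i t) = move t i (strict_vec t).
Proof. by move=> s; apply: strict_edge => //; apply: strict_vec_ok => //; apply: strict_step. Qed.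

Lemma wt_strict_vec t : strict t -> wt (swt t) (strict_vec t).
Proof. by move/strict_vec_ok => []. Qed.

Lemma strict_vec_home : strict_vec (home r) = m.
Proof.
have e0 : energy (home r) = 0%N.
  by apply/eqP; rewrite -eqz_nat energyE big1 // => k _; rewrite /disp ffunE subrr expr0n.
by rewrite strict_vecE; case: pickP => // i; rewrite e0.
Qed.

End StrictVectors.

(** * Stability under the generators *)

Section Walks.
Variables (n r : nat).
Implicit Types (lam : 'I_n -> int) (i j s : 'I_n) (b : bool).

Definition composition lam := (forall i, 0 <= lam i) /\ \sum_i lam i = r%:Z.

(** The node at which the move [b] delivers into the site from which the move [b] at [i] takes. *)
Definition nbr b i : 'I_n := if b then ordS i else ord_pred i.

Lemma tgt_nbr b i : tgt b (nbr b i) = src b i.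
Proof. by case: b => //=; rewrite ord_predK. Qed.

Lemma src_inj b : injective (@src n b).
Proof. by case: b => i j //= /ordS_inj. Qed.

Lemma iter_nbr_surj b i j : exists k, iter k (nbr b) i = j.
Proof.
by case: b; [have [k _ <-] := iter_ordS_surj i j|have [k _ <-] := iter_ord_pred_surj i j]; exists k.
Qed.

Lemma sum_shift lam b i (f : 'I_n -> int) :
  \sum_j shift lam b i j * f j = \sum_j lam j * f j + f (tgt b i) - f (src b i).
Proof.
have d a : \sum_j (j == a)%:Z * f j = f a.
  by rewrite (bigD1 a) //= eqxx mul1r big1 ?addr0 // => j /negPf->; rewrite mul0r.
by rewrite -(d (tgt b i)) -(d (src b i)) -big_split -sumrB; apply: eq_bigr => j _ /=;
  rewrite /shift; ring.
Qed.

Lemma composition_shift lam b i : composition lam -> 1 <= lam (src b i) ->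
  composition (shift lam b i).
Proof.
move=> [l0 l1] h; split=> [j|].
  by rewrite /shift; have := l0 j; case: eqP => _; case: eqP => [->|_] /=; lia.
transitivity (\sum_j shift lam b i j * 1); first by apply: eq_bigr => j _; rewrite mulr1.
rewrite (sum_shift lam b i (fun=> 1)) addrK -l1.
by apply: eq_bigr => j _; rewrite mulr1.
Qed.

Hypothesis (n4 : (3 < n)%N) (rn : (r < n)%N).

Lemma exists_empty lam : composition lam -> exists i, lam i = 0.
Proof.
move=> [l0 l1]; have [/existsP[i /eqP]|] := boolP [exists i, lam i == 0]; first by exists i.
rewrite negb_exists => /forallP h; suff : n%:Z <= r%:Z by lia.
rewrite -l1 -[n in n%:Z]card_ord -sum1_card -natz natr_sum; apply: ler_sum => i _.
by have := l0 i; have := h i; lia.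
Qed.

Lemma first_empty lam b j : composition lam ->
  exists k, lam (src b (iter k (nbr b) j)) = 0 /\
    forall l, (l < k)%N -> 1 <= lam (src b (iter l (nbr b) j)).
Proof.
move=> cl; have [e e0] := exists_empty cl.
have ex : exists k, lam (src b (iter k (nbr b) j)) == 0.
  have [k h] := iter_nbr_surj b j (if b then ord_pred e else e).
  by exists k; rewrite h; case: (b) => /=; rewrite ?ord_predK e0.
exists (ex_minn ex); case: ex_minnP => k /eqP k0 kmin; split=> // l lk.
have := cl.1 (src b (iter l (nbr b) j)); rewrite le_eqVlt => /orP[/eqP/esym/eqP/kmin|//].
by rewrite leqNgt lk.
Qed.

Lemma empty_beside lam b j : composition lam -> 1 <= lam (src b j) ->
  exists s, [/\ s != j, lam (src b s) = 0 & 1 <= lam (tgt b s)].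
Proof.
move=> cl lj; have [[|k] [k0 h]] := first_empty b j cl; first by move: k0 lj => /= ->.
exists (iter k.+1 (nbr b) j); split=> //; last by rewrite iterS tgt_nbr h.
by apply/eqP => e; rewrite e in k0; lia.
Qed.

End Walks.

(** * From moves of lone particles to all E_i and F_i *)

Section Closure.
Variables (n r : nat) (P : schur_module n r).
Hypothesis (n4 : (3 < n)%N) (rn : (r < n)%N).
Implicit Types (lam : 'I_n -> int) (i j s : 'I_n) (b : bool) (x : P).

(* [Y lam] abstracts a family of subspaces of the weight spaces which is stable
   under moves of a particle that is alone on its site. *)
Variable Y : ('I_n -> int) -> P -> Prop.
Hypothesis Yext : forall lam lam' x, lam =1 lam' -> Y lam x -> Y lam' x.
Hypothesis Y0 : forall lam, Y lam 0.
Hypothesis YD : forall lam x y, Y lam x -> Y lam y -> Y lam (x + y).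
Hypothesis YZ : forall lam c x, Y lam x -> Y lam (c *: x).
Hypothesis Ywt : forall lam x, Y lam x -> wt lam x.
Hypothesis YL : forall lam b i x, composition r lam -> Y lam x -> lam (src b i) = 1 ->
  Y (shift lam b i) (X P b i x).
(** The converse of [YL]: a vector with an empty source is pulled back to one in which that site
    holds a lone particle. This permits arguing on a more convenient weight and pushing forward
    again. *)
Hypothesis YU : forall lam b i x, composition r lam -> Y lam x -> lam (src b i) = 0 ->
  1 <= lam (tgt b i) -> exists2 z, Y (shift lam (~~ b) i) z & x = X P b i z.
Hypothesis YFE0 : forall lam i x, composition r lam -> Y lam x -> (forall j, lam j <= 1) ->
  lam i = 1 -> lam (ordS i) = 1 -> Y lam (X P false i (X P true i x)).

Definition far_node i s := [&& s != i, s != ordS i & ordS s != i].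

Lemma X_farC b c i s x : far_node i s -> X P c i (X P b s x) = X P b s (X P c i x).
Proof.
case/and3P => si s1 s2; have [->|] := eqVneq c b.
  by apply: XX_far; rewrite adjacentE negb_or s1 s2.
by case: b; case: c => // _; [apply: (XX_opp false)|apply: (XX_opp true)]; rewrite eq_sym.
Qed.

Definition num_empty lam := #|[set i | lam i == 0]|.

Lemma shift_unshift lam b i : shift (shift lam (~~ b) i) b i =1 lam.
Proof. by move=> j; rewrite /shift; case: b => /=; lia. Qed.

Lemma far_shift lam b i s : far_node i s ->
  (shift lam b s i = lam i) * (shift lam b s (ordS i) = lam (ordS i)).
Proof.
case/and3P => /negPf s1 /negPf s2 /negPf s3; have S' := ordS_neqs n4.
have [e1 e2 e3] : [/\ (i == s) = false, (ordS i == s) = false & (i == ordS s) = false].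
  by rewrite ![_ == s]eq_sym [i == _]eq_sym.
by rewrite /shift; case: b; rewrite /= ?S' ?e1 ?e2 ?e3 /=; split; lia.
Qed.

(** Pull the vector back along a move at a far node, apply F_i E_i there, and push the result
    forward as the move of a lone particle. *)
Lemma YFE_unshift lam b i s x : far_node i s -> composition r lam -> Y lam x ->
  lam (src b s) = 0 -> 1 <= lam (tgt b s) ->
  (forall z, Y (shift lam (~~ b) s) z -> Y (shift lam (~~ b) s) (X P false i (X P true i z))) ->
  Y lam (X P false i (X P true i x)).
Proof.
move=> far cl Yx l0 l1 IH; have [z Yz ->] := YU cl Yx l0 l1.
rewrite !(X_farC _ _ _ far); apply: Yext (shift_unshift lam b s) _.
apply: YL; [|exact: IH|].
  by apply: composition_shift => //; case: (b) l1.
by rewrite /shift; case: (b) l0 => /= ->; rewrite eqxx (ordS_neqs n4) //=; lia.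
Qed.

Lemma num_empty_shift lam b s : composition r lam -> lam (src b s) = 0 -> 1 <= lam (tgt b s) ->
  (num_empty (shift lam (~~ b) s) + (2 <= lam (tgt b s))%R <= num_empty lam)%N.
Proof.
move=> cl l0 l1; set lam' := shift _ _ _; set p := src b s; set q := tgt b s.
have pq : p != q by apply/eqP => e; move: l1; rewrite -/q -e l0.
have e j : lam' j = lam j + (j == p)%:Z - (j == q)%:Z by rewrite /lam' /shift /p /q; case: (b).
rewrite /num_empty (cardsD1 p [set i | lam i == 0]) inE l0 eqxx.
have sub : [set i | lam' i == 0] \subset
    (if 2 <= lam q then [set i | lam i == 0] :\ p else q |: ([set i | lam i == 0] :\ p)).
  apply/subsetP => j; rewrite inE e => /eqP ej; have l0' := cl.1 j.
  have jp : j != p.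
    apply/eqP => jp; have {}l0 : lam p = 0 by [].
    by rewrite jp eqxx (negPf pq) l0 in ej.
  rewrite (negPf jp) in ej; have [jq|jq] := eqVneq j q.
    rewrite jq eqxx /= in ej; move/eqP: ej => ej.
    by case: ifP => h; [lia|rewrite jq !inE eqxx].
  rewrite (negPf jq) /= !(addr0, subr0) in ej.
  by case: ifP => _; rewrite !inE jp ?(negPf jq) ?ej.
apply: leq_trans (leq_add (subset_leq_card sub) (leqnn _)) _.
case: ifP => h; first by rewrite addnC.
by rewrite addn0 cardsU1 leq_add2r; case: (_ \notin _).
Qed.

(* Moves far from [i] commute with [F_i E_i]; filling the empty site from a crowded
   one by such moves lowers the number of empty sites. *)
Lemma YFE_spread i (N : nat) :
  (forall lam x, (num_empty lam < N)%N -> composition r lam -> Y lam x ->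
     lam i = 1 -> lam (ordS i) = 1 -> Y lam (X P false i (X P true i x))) ->
  forall k b s lam x, (num_empty lam <= N)%N -> composition r lam -> Y lam x ->
     lam i = 1 -> lam (ordS i) = 1 -> lam (src b s) = 0 ->
     2 <= lam (tgt b (iter k (nbr (~~ b)) s)) ->
     (forall l, (l <= k)%N -> far_node i (iter l (nbr (~~ b)) s)) ->
  Y lam (X P false i (X P true i x)).
Proof.
move=> IH; elim=> [|k IHk] b s lam x eN cl Yx li lj l0 l2 far.
  have f0 : far_node i s := far 0%N isT; have l1 : 1 <= lam (tgt b s) by move: l2 => /=; lia.
  have l1' : 1 <= lam (src (~~ b) s) by case: (b) l1.
  have cl' := composition_shift cl l1'.
  apply: (YFE_unshift f0 cl Yx l0 l1) => z Yz.
  have := num_empty_shift cl l0 l1; rewrite /= in l2; rewrite l2 => en.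
  by apply: IH; rewrite ?(far_shift _ (~~ b) f0) //; lia.
have f0 : far_node i s := far 0%N isT.
have far' l : (l <= k)%N -> far_node i (iter l (nbr (~~ b)) (nbr (~~ b) s)).
  by move=> lk; rewrite -iterSr; apply: far.
have es : src b (nbr (~~ b) s) = tgt b s.
  by rewrite -{1}(negbK b) -tgt_nbr; case: (b) => /=; rewrite ?ordSK ?ord_predK.
(* If the next site is empty too, it serves as a hole one step closer to the crowded site and
   nothing moves. *)
have := cl.1 (tgt b s); rewrite le_eqVlt => /orP[/eqP/esym l1|l1].
  by apply: (IHk b (nbr (~~ b) s)) => //; rewrite ?es // -iterSr.
have {}l1 : 1 <= lam (tgt b s) by lia.
have l1' : 1 <= lam (src (~~ b) s) by case: (b) l1.
have cl' := composition_shift cl l1'.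
apply: (YFE_unshift f0 cl Yx l0 l1) => z Yz.
have := num_empty_shift cl l0 l1; have [l3|l3] := leP 2 (lam (tgt b s)) => en.
  by apply: IH; rewrite ?(far_shift _ (~~ b) f0) //; lia.
(* The next site holds exactly one particle, which fills the hole: the hole advances by one step
   while the number of empty sites does not grow. *)
have e j : shift lam (~~ b) s j = lam j + (j == src b s)%:Z - (j == tgt b s)%:Z.
  by rewrite /shift; case: (b).
apply: (IHk b (nbr (~~ b) s)) => //; rewrite ?(far_shift _ (~~ b) f0) //; first by lia.
  by rewrite es e eqxx tgt_neq_src /=; lia.
rewrite -iterSr e; move: l2; set t := tgt b _ => l2.
have -> : (t == src b s) = false by apply/eqP => e'; move: l2; rewrite e' l0.
have -> : (t == tgt b s) = false by apply/eqP => e'; move: l2; rewrite e'; lia.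
by rewrite /=; lia.
Qed.

(** For l < n - 2 this lists the sites other than i and i+1 as an arc. As nodes only l < n - 3 are
    far from i, because the last one borders site i. *)
Definition sites_above i l : 'I_n := iter l (@ordS n) (ordS (ordS i)).

Lemma sites_aboveP i j : j != i -> j != ordS i ->
  exists2 l, (l < n - 2)%N & sites_above i l = j.
Proof.
move=> ji jSi; have [[|[|l]] ln e] := iter_ordS_surj i j.
- by move: e ji => /= ->; rewrite eqxx.
- by move: e jSi => /= ->; rewrite eqxx.
by exists l; [lia|rewrite -e /sites_above !iterSr].
Qed.

Lemma far_sites_above i l : (l < n - 3)%N -> far_node i (sites_above i l).
Proof.
have small (a c : nat) : (a < n)%N -> (c < n)%N ->
    (iter a (@ordS n) i == iter c (@ordS n) i) = (a == c).
  move=> an bn; rewrite -val_eqE /= !iter_ordS eqn_modDl !modn_small //.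
move=> ln; rewrite /far_node.
have e0 : sites_above i l = iter l.+2 (@ordS n) i by rewrite /sites_above !iterSr.
rewrite e0; apply/and3P; split.
- by rewrite (small l.+2 0%N) //; lia.
- by rewrite (small l.+2 1%N) //; lia.
- by rewrite (small l.+3 0%N) //; lia.
Qed.

(** If some site is crowded then, as r < n, some site is empty; both lie on the arc avoiding i and
    i+1, so the crowd can be thinned along it without touching node i. *)
Lemma YFE lam i x : composition r lam -> Y lam x -> lam i = 1 -> lam (ordS i) = 1 ->
  Y lam (X P false i (X P true i x)).
Proof.
have [N] := ubnP (num_empty lam); elim: N lam x => // N IH lam x; rewrite ltnS => eN cl Yx li lj.
have [/forallP h|] := boolP [forall j, lam j <= 1]; first exact: YFE0.
rewrite negb_forall => /existsP[B]; rewrite -ltNge => lB.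
have [e e0] := exists_empty n4 rn cl.
have [l1 l1n E1] : exists2 l, (l < n - 2)%N & sites_above i l = B.
  by apply: sites_aboveP; apply/eqP => h; move: lB; rewrite h ?li ?lj.
have [l2 l2n E2] : exists2 l, (l < n - 2)%N & sites_above i l = e.
  by apply: sites_aboveP; apply/eqP => h; move: e0; rewrite h ?li ?lj.
have predE l k : (k <= l)%N -> iter k (@ord_pred n) (sites_above i l) = sites_above i (l - k).
  elim: k => [|k IHk] kl; first by rewrite subn0.
  rewrite iterS IHk ?(ltnW kl) // (_ : (l - k)%N = (l - k.+1).+1); last by lia.
  by rewrite /sites_above iterS ordSK.
have succE l k : iter k (@ordS n) (sites_above i l) = sites_above i (l + k).
  by rewrite /sites_above -iterD addnC.
have [l12|l21|l12] := ltngtP l1 l2.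
(* The hole lies above the crowd: the starting node is the one below the hole, whence the
   predecessor of [l2]. In the other order it is the node carrying the index of the hole. *)
- apply: (YFE_spread IH (k := l2.-1 - l1) (b := true) (s := sites_above i l2.-1)) => //=.
  + rewrite -[ordS _]/(iter 1 (@ordS n) _) succE (_ : (l2.-1 + 1)%N = l2) ?E2 //; lia.
  + rewrite predE; last by lia.
    by rewrite (_ : (l2.-1 - (l2.-1 - l1))%N = l1) ?E1 //; lia.
  + by move=> l lk; rewrite predE; [apply: far_sites_above|]; lia.
- apply: (YFE_spread IH (k := l1.-1 - l2) (b := false) (s := sites_above i l2)) => //=.
  + by rewrite E2.
  + rewrite -iterS succE (_ : (l2 + (l1.-1 - l2).+1)%N = l1) ?E1 //; lia.
  + by move=> l lk; rewrite succE; apply: far_sites_above; lia.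
- by move: lB; rewrite -E1 l12 E2 e0.
Qed.

(** Cyclic distance from [o] to [a], upwards if [b] and downwards otherwise. With [o = src b i], a
    move [b] at any node other than i lowers the rank of its particle by one, and [tgt b i] has the
    largest rank. *)
Definition rank b (o a : 'I_n) : int :=
  if b then if (o <= a)%N then a%:Z - o%:Z else a%:Z + n%:Z - o%:Z
  else if (a <= o)%N then o%:Z - a%:Z else o%:Z + n%:Z - a%:Z.

Lemma rank_step b i s : s != i ->
  rank b (src b i) (tgt (~~ b) s) = rank b (src b i) (src (~~ b) s) + 1.
Proof.
move=> si; have vi := val_ordS i; have vs := val_ordS s; have ln := ltn_ord.
have nsi : (s : nat) <> i by move/val_inj/eqP; rewrite (negPf si).
have := (ltn_ord s, ltn_ord i) => -[sn iN]; move: vi vs.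
by case: b => /=; rewrite /rank; do 2!case: eqP => ?; do 2!case: leqP => ?; lia.
Qed.

Lemma rank_ge0 b o a : 0 <= rank b o a.
Proof.
by rewrite /rank; have := (ltn_ord a, ltn_ord o) => -[? ?]; case: b; case: leqP => ?; lia.
Qed.

(** It suffices to treat an empty target. Its particles are pulled away the long way round the
    circle by moves of the opposite type at nodes other than i, which commute with X b i; the
    rank-weighted sum [M] decreases. *)
Lemma Y_clear lam b i x : composition r lam -> Y lam x -> 1 <= lam (src b i) ->
  (forall lam' x', composition r lam' -> Y lam' x' -> lam' (src b i) = lam (src b i) ->
     lam' (tgt b i) = 0 -> Y (shift lam' b i) (X P b i x')) ->
  Y (shift lam b i) (X P b i x).
Proof.
pose M mu := `|(\sum_j mu j * rank b (src b i) j)%R|%N.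
have [N] := ubnP (M lam); elim: N lam x => // N IH lam x; rewrite ltnS => MN cl Yx l1 H.
have := cl.1 (tgt b i); rewrite le_eqVlt => /orP[/eqP/esym l0|l0]; first exact: H.
have [] := @empty_beside _ _ n4 rn lam (~~ b) i cl; first by case: (b) l0.
move=> s [si s0 s1]; have [z Yz ->] := YU cl Yx s0 s1.
rewrite negbK in Yz; rewrite -[in X P (~~ b) s]/(~~ b) XX_opp //; last by rewrite eq_sym.
have l1' : 1 <= lam (src b s) by case: (b) s1.
have cl' := composition_shift cl l1'.
set lam' := shift lam b s in Yz cl'.
have s0' : lam (tgt b s) = 0 by case: (b) s0.
have nS : (src b i == src b s) = false by apply/eqP => /src_inj e; rewrite e eqxx in si.
have e1 : lam' (src b i) = lam (src b i).
  rewrite /lam' /shift nS /=; case: eqP => [e|_] /=; last by lia.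
  by move: l1; rewrite e s0'.
have MN' : (M lam' < N)%N.
  apply: leq_trans MN; rewrite -ltz_nat /M !gez0_abs ?sumr_ge0 // => [|j _|j _].
  - by rewrite sum_shift; have := rank_step b si; case: (b) => /=; lia.
  - by apply: mulr_ge0; [exact: cl.1|exact: rank_ge0].
  - by apply: mulr_ge0; [exact: cl'.1|exact: rank_ge0].
have Y' : Y (shift lam' b i) (X P b i z).
  by apply: (IH lam' z MN' cl' Yz); rewrite e1 // => mu y cm Ym e2; apply: H.
have cl2 : composition r (shift lam' b i) by apply: composition_shift => //; rewrite e1.
have e3 : shift lam' b i (src (~~ b) s) = 1.
  have nT : (tgt b s == src b i) = false.
    by apply/eqP => e; move: l1; rewrite -e s0'.
  rewrite (_ : src (~~ b) s = tgt b s); last by case: (b).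
  have tI : injective (@tgt n b) by case: (b) => k l //= /ordS_inj.
  by rewrite /shift nT (inj_eq tI) (negPf si) /lam' /shift s0' eqxx tgt_neq_src //=; lia.
by have := YL cl2 Y' e3; apply: Yext => j; rewrite /lam' /shift; case: (b) => /=; lia.
Qed.

(** Induction on the source, which holds q + 1 particles. After clearing the target, x = X (~~ b) i
    z with one particle of z on the target, and the sl_2 relation replaces X b i x by X (~~ b) i (X
    b i z) plus a multiple of z. *)
Lemma stable_under_generators_aux q b i lam x : composition r lam -> Y lam x ->
  lam (src b i) = q.+1%:Z ->
  Y (shift lam b i) (X P b i x).
Proof.
elim/ltn_ind: q b i lam x => -[|q] IH b i lam x cl Yx lq; first exact: YL.
apply: Y_clear => //; first by lia.
move=> mu {x cl Yx}x cl Yx; rewrite {}lq => l1 l0.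
have [l0' l1'] : mu (src (~~ b) i) = 0 /\ mu (tgt (~~ b) i) = q.+2%:Z by case: (b) l0 l1.
have [|z Yz ->] := YU cl Yx l0'; first by rewrite l1'.
rewrite negbK in Yz; have cl' : composition r (shift mu b i).
  by apply: composition_shift => //; rewrite l1.
rewrite (XX_sl2 b i (Ywt Yz)); apply: YD; last exact: YZ.
have e1 : shift mu b i (src b i) = q.+1%:Z.
  by rewrite /shift l1 eqxx eq_sym tgt_neq_src //=; lia.
have e2 : shift mu b i (tgt b i) = 1.
  by rewrite /shift l0 eqxx tgt_neq_src //=; lia.
have Yz' := IH q (ltnSn q) b i _ _ cl' Yz e1.
case: q IH l1 l1' e1 Yz' => [|q] IH l1 l1' e1 Yz'.
  (* The source held two particles, so z has one on each side: this is the F_i E_i case, up to a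
     multiple of z when the product is E_i F_i. *)
  have FE := YFE cl' Yz; case: (b) e1 e2 Yz FE => /= e1 e2 Yz FE; first exact: FE.
  rewrite (XX_sl2 true i (Ywt Yz)) /=; apply: YD; [exact: FE|exact: YZ].
(* The move back now takes from a site with two particles, a smaller case because the original
   source held at least three. *)
apply: Yext (shift_unshift (shift mu b i) (~~ b) i) _; rewrite negbK.
apply: (IH 1%N) => //; first by apply: composition_shift => //; rewrite e1.
have -> : src (~~ b) i = tgt b i by case: (b).
by rewrite {1}/shift e2 eqxx tgt_neq_src //=; lia.
Qed.

Theorem stable_under_generators b i lam x : composition r lam -> Y lam x -> 1 <= lam (src b i) ->
  Y (shift lam b i) (X P b i x).
Proof.
move=> cl Yx l1; apply: (@stable_under_generators_aux `|lam (src b i) - 1|%N) => //; lia.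
Qed.

End Closure.

Lemma adjacentC n (i j : 'I_n) : adjacent i j = adjacent j i.
Proof. by rewrite !adjacentE orbC ![_ == ordS _]eq_sym. Qed.

(** * Heights over a 0/1 weight, and transport to other weights *)

Section Heights.
Variables (n r : nat).
Hypothesis (n4 : (3 < n)%N) (rn : (r < n)%N) (r0 : (0 < r)%N).
Variable omega : 'I_n -> int.
Hypothesis om01 : forall i, 0 <= omega i <= 1.
Hypothesis om_total : \sum_i omega i = r%:Z.
Local Notation height := {ffun 'I_n -> int}.
Implicit Types (h : height) (i j s : 'I_n) (b : bool).

(* [h i] is the net number of particles which have crossed the node [i]
   upwards, starting from the distribution [omega]. *)
Definition hwt h i : int := omega i + h (ord_pred i) - h i.
Definition upd h b i : height := [ffun j => h j + if j == i then if b then -1 else 1 else 0].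
(** Net number of crossings of node i in the direction of [X b]; the sign reflects that E_i moves
    particles downwards. *)
Definition sgh b h i : int := if b then - h i else h i.
(** The height may have been reached by a last move [b] at i of a lone particle, and undoing that
    move decreases the area. *)
Definition homeward b i h := [&& 0 < sgh b h i, hwt h (src b i) == 0 & 1 <= hwt h (tgt b i)].
Definition area h : nat := \sum_i `|h i|%N.
Definition admissible h := forall i, 0 <= hwt h i.

Lemma src_neq_tgt b i : (src b i == tgt b i) = false.
Proof. by rewrite eq_sym tgt_neq_src. Qed.

Lemma hwt_upd h b i : hwt (upd h b i) =1 shift (hwt h) b i.
Proof.
move=> j; rewrite /hwt /upd /shift !ffunE.
rewrite [ord_pred j == i]eq_sym eq_ord_pred [ordS i == j]eq_sym.
by case: b => /=; case: eqP => _; case: eqP => _ /=; lia.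
Qed.

Lemma updK h b i : upd (upd h b i) (~~ b) i = h.
Proof. by apply/ffunP => j; rewrite !ffunE; case: eqP => _; case: b => /=; lia. Qed.

Lemma updNK h b i : upd (upd h (~~ b) i) b i = h.
Proof. by rewrite -{2}(negbK b) updK. Qed.

Lemma updC h b i b' i' : upd (upd h b i) b' i' = upd (upd h b' i') b i.
Proof. by apply/ffunP => j; rewrite !ffunE addrAC. Qed.

Lemma sum_hwt h : \sum_i hwt h i = r%:Z.
Proof.
rewrite /hwt sumrB big_split /= om_total.
by rewrite (reindex_inj (@ordS_inj n)) /= (eq_bigr h) ?addrK // => i _; rewrite ordSK.
Qed.

Lemma admissible_composition h : admissible h -> composition r (hwt h).
Proof. by move=> ah; split=> //; exact: sum_hwt. Qed.

Lemma admissible_upd h b i : admissible h -> 1 <= hwt h (src b i) -> admissible (upd h b i).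
Proof.
move=> ah l1 j; rewrite hwt_upd; exact: (composition_shift (admissible_composition ah) l1).1.
Qed.

Lemma area_upd h b i : 0 < sgh b h i -> (area (upd h (~~ b) i) < area h)%N.
Proof.
move=> s0; rewrite /area (bigD1 i) //= [X in (_ < X)%N](bigD1 i) //=.
rewrite (eq_bigr (fun j => `|h j|%N)); last by move=> j /negPf ji; rewrite ffunE ji addr0.
by rewrite ltn_add2r ffunE eqxx; move: s0; rewrite /sgh; case: b => /=; lia.
Qed.

(** As [omega] is at most 1, an occupied site has been entered at least as often as left. The
    companion below uses that [omega] is nonnegative. *)
Lemma sgh_next h b i : 1 <= hwt h (src b i) -> sgh b h i <= sgh b h (nbr b i).
Proof.
by have := om01 (src b i); rewrite /sgh /hwt; case: b => /=; rewrite ?ordSK; lia.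
Qed.

Lemma sgh_prev h b i : hwt h (tgt b i) = 0 -> sgh b h i <= sgh b h (nbr (~~ b) i).
Proof.
by have := om01 (tgt b i); rewrite /sgh /hwt; case: b => /=; rewrite ?ordSK; lia.
Qed.

Lemma homeward_from h b j : admissible h -> 0 < sgh b h j -> 1 <= hwt h (tgt b j) ->
  exists s, homeward b s h.
Proof.
move=> ah sj tj; have [k [k0 kl]] := first_empty n4 rn b j (admissible_composition ah).
exists (iter k (nbr b) j); rewrite /homeward k0 eqxx.
suff [-> ->] : 0 < sgh b h (iter k (nbr b) j) /\ 1 <= hwt h (tgt b (iter k (nbr b) j)) by [].
elim: k kl {k0} => [|k IH] kl //=.
have [|s1 t1] := IH; first by move=> l lk; apply: kl; apply: ltnW.
have l1 := kl k (ltnSn k); split; last by rewrite tgt_nbr.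
exact: lt_le_trans s1 (sgh_next l1).
Qed.

(** From a node with nonzero crossings walk back to an occupied target, then forward to an empty
    source; the crossings keep their sign on the way. The first walk ends because r > 0, the second
    because r < n. *)
Lemma exists_homeward h i : admissible h -> h i != 0 -> exists b s, homeward b s h.
Proof.
move=> ah hi; pose b := h i < 0.
have si : 0 < sgh b h i.
  by move/eqP: hi => hi; rewrite /sgh /b; case: ifP => h0; lia.
have [p p1] : exists p, 1 <= hwt h p.
  have [/existsP[p hp]|] := boolP [exists p, 1 <= hwt h p]; first by exists p.
  rewrite negb_exists => /forallP H; have := sum_hwt h; rewrite big1 => [|p _]; first by lia.
  by have := ah p; have := H p; lia.
have ex : exists k, 1 <= hwt h (tgt b (iter k (nbr (~~ b)) i)).
  have [k e] := iter_nbr_surj (~~ b) i (if b then p else ord_pred p).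
  by exists k; rewrite e; case: (b); rewrite //= ord_predK.
have [k k1 kmin] := ex_minnP ex.
suff sk : 0 < sgh b h (iter k (nbr (~~ b)) i).
  by have [s hs] := homeward_from ah sk k1; exists b, s.
have kz l : (l < k)%N -> hwt h (tgt b (iter l (nbr (~~ b)) i)) = 0.
  move=> lk; apply/eqP; rewrite eq_le ah andbT leNgt; apply/negP => t1.
  by have := kmin l t1; rewrite leqNgt lk.
elim: k kz {k1 kmin} => [|k IH] kz //=.
apply: lt_le_trans (sgh_prev (kz k (ltnSn k))); apply: IH => l lk; apply: kz; exact: ltnW.
Qed.

Lemma hwt_src h b i : hwt h (src b i) = omega (src b i) + sgh b h (nbr b i) - sgh b h i.
Proof. by rewrite /hwt /sgh; case: b => /=; rewrite ?ordSK; lia. Qed.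

Lemma tgt_inj b : injective (@tgt n b).
Proof. by case: b => i j //= /ordS_inj. Qed.

Lemma sgh_upd h b c i j : j != i -> sgh b (upd h c i) j = sgh b h j.
Proof. by move=> /negPf ji; rewrite /sgh /upd ffunE ji addr0. Qed.

Lemma shiftN lam b i j :
  shift lam (~~ b) i j = lam j + (j == src b i)%:Z - (j == tgt b i)%:Z.
Proof. by case: b. Qed.

Lemma homeward_upd_same h b i i' : i != i' -> homeward b i h -> homeward b i' h ->
  homeward b i' (upd h (~~ b) i) /\ ~~ adjacent i i'.
Proof.
move=> ii /and3P[p /eqP z o] /and3P[p' /eqP z' o'].
have i'i : i' != i by rewrite eq_sym.
have st j k : hwt h (src b j) = 0 -> 1 <= hwt h (tgt b k) -> (src b j == tgt b k) = false.
  by move=> zj ok; apply/eqP => e; move: ok; rewrite -e zj.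
split; last first.
  have := (st _ _ z o', st _ _ z' o); rewrite adjacentE negb_or.
  by case: (b) => /= -[e1 e2]; rewrite ?e1 ?e2 ?[i' == _]eq_sym ?[ordS i' == _]eq_sym ?e1 ?e2.
apply/and3P; split; first by rewrite sgh_upd.
  by rewrite hwt_upd shiftN z' (inj_eq (@src_inj _ b)) (negPf i'i) st.
by rewrite hwt_upd shiftN (inj_eq (@tgt_inj b)) (negPf i'i) [_ == src b i]eq_sym st //=; lia.
Qed.

(** Moves of opposite types could only interfere at a shared site. If i' feeds the empty source of
    i, [omega] would be at least 2 there; if both deliver into the same site, it holds at least two
    particles and one is left. *)
Lemma homeward_upd_opp h b i i' : admissible h -> homeward b i h -> homeward (~~ b) i' h ->
  homeward (~~ b) i' (upd h (~~ b) i) /\ i != i'.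
Proof.
move=> ah /and3P[p /eqP z o] /and3P[p' /eqP z' o'].
have {}p' : sgh b h i' < 0 by move: p'; rewrite /sgh; case: (b) => /=; lia.
have {}z' : hwt h (tgt b i') = 0 by case: (b) z'.
have {}o' : 1 <= hwt h (src b i') by case: (b) o'.
have ii : i != i' by apply: contraTneq p' => <-; rewrite -leNgt ltW.
have i'i : i' != i by rewrite eq_sym.
split=> //; apply/and3P; split.
- by rewrite sgh_upd //; move: p'; rewrite /sgh; case: (b) => /=; lia.
- rewrite (_ : src (~~ b) i' = tgt b i'); last by case: (b).
  rewrite hwt_upd shiftN z' (inj_eq (@tgt_inj b)) (negPf i'i).
  have [e|//] := eqVneq (tgt b i') (src b i).
  have e' : i' = nbr b i by apply: (@tgt_inj b); rewrite e tgt_nbr.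
  by have := hwt_src h b i; have := om01 (src b i); rewrite -e' z; lia.
- rewrite (_ : tgt (~~ b) i' = src b i'); last by case: (b).
  rewrite hwt_upd shiftN (inj_eq (@src_inj _ b)) (negPf i'i).
  have [e|_] := eqVneq (src b i') (tgt b i) => /=; last by lia.
  have e' : i = nbr b i' by apply: (@tgt_inj b); rewrite -e tgt_nbr.
  by have := hwt_src h b i'; have := om01 (src b i'); rewrite -e'; lia.
Qed.

Section Vectors.
Variable P : schur_module n r.
Implicit Types x y : P.

Fixpoint transport_rec (N : nat) h y : P :=
  if N is N'.+1 then
    if [pick c : bool * 'I_n | homeward c.1 c.2 h] is Some c
    then X P c.1 c.2 (transport_rec N' (upd h (~~ c.1) c.2) y) else y
  else y.
Definition transport h y : P := transport_rec (area h).+1 h y.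

Lemma transport_rec_stable N M h y : (area h < N)%N -> (area h < M)%N ->
  transport_rec N h y = transport_rec M h y.
Proof.
elim: N M h => // N IH [|M] h //= hN hM; case: pickP => // c /and3P[p _ _].
by congr (X P _ _ _); apply: IH; apply: leq_trans (area_upd p) _; rewrite -ltnS.
Qed.

Lemma transportE h y : transport h y =
  if [pick c : bool * 'I_n | homeward c.1 c.2 h] is Some c
  then X P c.1 c.2 (transport (upd h (~~ c.1) c.2) y) else y.
Proof.
rewrite /transport [LHS]/=; case: pickP => // c /and3P[p _ _].
by congr (X P _ _ _); apply: transport_rec_stable => //; exact: area_upd.
Qed.

Lemma transportZD h (c : Qv) y z : transport h (c *: y + z) = c *: transport h y + transport h z.
Proof.
rewrite /transport; move: (area h).+1 => M; elim: M h => //= N IH h; case: pickP => // d _.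
by rewrite IH XD XZ.
Qed.

Lemma admissible_homeward h b i : admissible h -> homeward b i h -> admissible (upd h (~~ b) i).
Proof. by move=> ah /and3P[_ _ t1]; apply: admissible_upd => //; case: (b) t1. Qed.

(** Confluence by induction on the area: distinct homeward moves commute, being at non-adjacent
    nodes if of the same type and by (Q5) otherwise, and each remains homeward after the other. *)
Lemma transport_homeward h b i y : admissible h -> homeward b i h ->
  transport h y = X P b i (transport (upd h (~~ b) i) y).
Proof.
have [N] := ubnP (area h); elim: N h b i => // N IH h b i; rewrite ltnS => hN ah hw.
rewrite transportE; case: pickP => [[b' i'] /= hw'|/(_ (b, i))]; last by rewrite /= hw.
have [[-> ->]//|ne] := eqVneq (b', i') (b, i).
have a1 := admissible_homeward ah hw; have a2 := admissible_homeward ah hw'.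
have s1 : (area (upd h (~~ b) i) < N)%N.
  by apply: leq_trans hN; case/and3P: hw => p _ _; exact: area_upd.
have s2 : (area (upd h (~~ b') i') < N)%N.
  by apply: leq_trans hN; case/and3P: hw' => p _ _; exact: area_upd.
have [eb|/eqP] := eqVneq b' b.
  rewrite eb in ne hw' a2 s2 *.
  have ii : i != i' by apply: contraNneq ne => ->.
  have [h1 aii] := homeward_upd_same ii hw hw'.
  have i'i : i' != i by rewrite eq_sym.
  have [h2 _] := homeward_upd_same i'i hw' hw.
  rewrite (IH _ _ _ s1 a1 h1) (IH _ _ _ s2 a2 h2) updC.
  by rewrite XX_far // adjacentC.
move=> nb; have eb : b' = ~~ b by case: (b) (b') nb => -[].
rewrite eb in ne hw' a2 s2 *.
have [h1 ii] := homeward_upd_opp ah hw hw'.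
have hwN : homeward (~~ ~~ b) i h by rewrite negbK.
have [h2 _] := homeward_upd_opp ah hw' hwN; rewrite !negbK in h2.
rewrite !negbK in s2 a2 *; rewrite (IH _ _ _ s1 a1 h1) (IH _ _ _ s2 a2 h2) negbK updC.
by rewrite XX_opp.
Qed.

Lemma height_ind (Q : height -> Prop) :
  (forall h, (forall i, h i = 0) -> Q h) ->
  (forall h b i, admissible h -> homeward b i h -> Q (upd h (~~ b) i) -> Q h) ->
  forall h, admissible h -> Q h.
Proof.
move=> Q0 QS h; have [N] := ubnP (area h); elim: N h => // N IH h; rewrite ltnS => hN ah.
have [/forallP h0|] := boolP [forall i, h i == 0]; first by apply: Q0 => i; apply/eqP.
rewrite negb_forall => /existsP[i /(exists_homeward ah)[b [s hw]]].
apply: (QS h b s) => //; apply: IH; last exact: admissible_homeward.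
by apply: leq_trans hN; case/and3P: hw => p _ _; exact: area_upd.
Qed.

Lemma hwt0 h : (forall i, h i = 0) -> hwt h =1 omega.
Proof. by move=> h0 i; rewrite /hwt !h0; lia. Qed.

Lemma transport0 h y : (forall i, h i = 0) -> transport h y = y.
Proof.
move=> h0; rewrite transportE; case: pickP => // -[b i] /and3P[].
by rewrite /sgh h0; case: (b).
Qed.

Lemma wt_transport h y : admissible h -> wt omega y -> wt (hwt h) (transport h y).
Proof.
move=> ah wy; elim/height_ind: h / ah => [h h0|h b i ah hw IH].
  by rewrite transport0 //; apply: wt_ext wy => i; rewrite hwt0.
rewrite (transport_homeward y ah hw); apply: wt_ext (wt_shift n4 b i IH) => j.
by rewrite -hwt_upd updNK.
Qed.

(** Whether or not the move goes homeward, transport follows it. If it increases the crossings at i,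
    it is itself the last homeward move of the new height. *)
Lemma transport_lone h b i y : admissible h -> wt omega y -> hwt h (src b i) = 1 ->
  X P b i (transport h y) = transport (upd h b i) y.
Proof.
have [N] := ubnP (area h); elim: N h => // N IH h; rewrite ltnS => hN ah wy l1.
have au : admissible (upd h b i) by apply: admissible_upd; rewrite ?l1.
have [si|si] := leP 0 (sgh b h i).
  rewrite (transport_homeward (b := b) (i := i) y au) ?updK //.
  apply/and3P; split.
  - by move: si; rewrite /sgh /upd ffunE eqxx; case: (b) => /=; lia.
  - by rewrite hwt_upd /shift l1 eqxx src_neq_tgt.
  - by rewrite hwt_upd /shift eqxx tgt_neq_src //=; have := ah (tgt b i); lia.
have si' : 0 < sgh (~~ b) h i by move: si; rewrite /sgh; case: (b) => /=; lia.
have eN : src (~~ b) i = tgt b i by case: (b).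
have eN' s : tgt (~~ b) s = src b s by case: (b).
(* The move retraces earlier crossings. With an empty target it cancels the last homeward move;
   otherwise another homeward move at some s distinct from i is commuted out first. *)
have := ah (tgt b i); rewrite le_eqVlt => /orP[/eqP/esym l0|l0].
  have hw : homeward (~~ b) i h by rewrite /homeward si' eN l0 eqxx eN' l1.
  rewrite (transport_homeward y ah hw) negbK -{1}[b]negbK.
  apply: (XX_inv1 n4 (wt_transport au wy)); rewrite ?eN ?eN' hwt_upd /shift.
    by rewrite l1 eqxx src_neq_tgt.
  by rewrite l0 eqxx tgt_neq_src.
have [s hw] : exists s, homeward (~~ b) s h.
  apply: (@homeward_from _ _ (nbr (~~ b) i)) => //; last by rewrite tgt_nbr eN.
  by apply: lt_le_trans si' _; apply: sgh_next; rewrite eN.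
have /and3P[p /eqP z o] := hw.
have es : src (~~ b) s = tgt b s by case: (b).
rewrite es in z; rewrite eN' in o.
have si0 : s != i by apply/eqP => e; move: l0; rewrite -e z.
have ns : (src b i == tgt b s) = false by apply/eqP => e; move: l1; rewrite e z.
have as' : admissible (upd h b s) by apply: admissible_upd.
have hw' : homeward (~~ b) s (upd h b i).
  apply/and3P; split; first by rewrite sgh_upd.
    by rewrite es hwt_upd /shift z (inj_eq (@tgt_inj b)) (negPf si0) [_ == src b i]eq_sym ns.
  by rewrite eN' hwt_upd /shift (inj_eq (@src_inj _ b)) (negPf si0) /=; lia.
rewrite (transport_homeward y ah hw) negbK XX_opp; last by rewrite eq_sym.
rewrite IH //; last 2 first.
- by apply: leq_trans hN; rewrite -{1}[b]negbK; exact: area_upd.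
- by rewrite hwt_upd /shift l1 ns (inj_eq (@src_inj _ b)) eq_sym (negPf si0).
by rewrite (transport_homeward y au hw') negbK updC.
Qed.

(** The height is the partial sum of [omega - lam]; it closes up around the circle because both
    weights have total r. *)
Lemma exists_height (lam : 'I_n -> int) : composition r lam ->
  exists2 h, admissible h & hwt h =1 lam.
Proof.
move=> cl; pose d j := omega j - lam j.
pose h : height := [ffun i : 'I_n => \sum_(j < n | (j <= i)%N) d j].
have d0 : \sum_j d j = 0 by rewrite /d sumrB om_total cl.2 subrr.
have e : hwt h =1 lam.
  move=> i; suff : h (ord_pred i) - h i = - d i by rewrite /hwt /d; lia.
  (* The predecessor of site 0 is the last site, whose partial sum is the full sum, hence zero. *)
  have [i0|i0] := posnP i.
    rewrite !ffunE (eq_bigl predT); last first.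
      move=> j; rewrite /= i0 add0n modn_small; last by have := ltn_ord j; lia.
      by have := ltn_ord j; lia.
    rewrite d0 sub0r (big_pred1 i) // => j.
    by rewrite /= -val_eqE /= i0 leqn0.
  rewrite !ffunE [X in _ - X](bigD1 i) //= opprD addrCA.
  rewrite [X in _ + (X - _)](eq_bigl (fun j : 'I_n => (j <= i)%N && (j != i))) ?subrr ?addr0 // => j.
  rewrite (_ : ((i + n).-1 %% n)%N = i.-1); last first.
    rewrite (_ : (i + n).-1 = (i.-1 + n)%N) ?modnDr ?modn_small //; last by lia.
    by have := ltn_ord i; lia.
  by rewrite -val_eqE /=; lia.
by exists h => // i; rewrite e; exact: cl.1.
Qed.

Variable W : ('I_n -> int) -> P -> Prop.
Hypothesis Wext : forall lam lam' x, lam =1 lam' -> W lam x -> W lam' x.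
Hypothesis W0 : forall lam, W lam 0.
Hypothesis WD : forall lam x y, W lam x -> W lam y -> W lam (x + y).
Hypothesis WZ : forall lam c x, W lam x -> W lam (c *: x).
Hypothesis Wwt : forall lam x, W lam x -> wt lam x.
Hypothesis WX : forall lam b i x, W lam x -> lam (tgt b i) = 0 -> lam (src b i) = 1 ->
  W (shift lam b i) (X P b i x).
Hypothesis WFE : forall lam i x, W lam x -> lam i = 1 -> lam (ordS i) = 1 ->
  W lam (X P false i (X P true i x)).

(** Heights of equal weight differ by a constant, a rotation of all the particles around the circle,
    so many heights contribute to one weight and their span is taken. *)
Inductive transported lam : P -> Prop :=
  | transported0 : transported lam 0
  | transportedD h y x : admissible h -> hwt h =1 lam -> W omega y -> transported lam x ->
      transported lam (transport h y + x).

Lemma strict_upd h b i : admissible h -> homeward b i h -> (forall j, hwt h j <= 1) ->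
  (forall j, hwt (upd h (~~ b) i) j <= 1) /\ hwt h (tgt b i) = 1.
Proof.
move=> ah /and3P[p /eqP z o] st.
have t1 : hwt h (tgt b i) = 1 by apply/eqP; rewrite eq_le st o.
split=> // j; rewrite hwt_upd shiftN; case: eqP => [->|_] /=.
  by rewrite z src_neq_tgt.
by have := st j; case: eqP => _ /=; lia.
Qed.

(** In weights with entries 0 and 1 every homeward move takes a lone particle to an empty site, so
    it preserves [W] and is invertible; hence also the converse that follows. *)
Lemma transport_strict h y : admissible h -> (forall j, hwt h j <= 1) -> W omega y ->
  W (hwt h) (transport h y).
Proof.
move=> ah st wy; elim/height_ind: h / ah st => [h h0 _|h b i ah hw IH st].
  by rewrite transport0 //; apply: Wext wy => i; rewrite hwt0.
have [st' t1] := strict_upd ah hw st; have /and3P[_ /eqP z _] := hw.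
rewrite (transport_homeward y ah hw).
apply: (Wext (lam := shift (hwt (upd h (~~ b) i)) b i)) => [j|]; first by rewrite -hwt_upd updNK.
apply: WX (IH st') _ _; rewrite hwt_upd shiftN eqxx.
  by rewrite t1 tgt_neq_src.
by rewrite z src_neq_tgt.
Qed.

Lemma strict_transport h x : admissible h -> (forall j, hwt h j <= 1) -> W (hwt h) x ->
  exists2 y, W omega y & x = transport h y.
Proof.
move=> ah st wx; elim/height_ind: h / ah st x wx => [h h0 _ x wx|h b i ah hw IH st x wx].
  by exists x; rewrite ?transport0 //; apply: Wext wx; exact: hwt0.
have [st' t1] := strict_upd ah hw st; have /and3P[_ /eqP z _] := hw.
have eS : src (~~ b) i = tgt b i by case: (b).
have eT : tgt (~~ b) i = src b i by case: (b).
have wx' : W (hwt (upd h (~~ b) i)) (X P (~~ b) i x).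
  apply: (Wext (lam := shift (hwt h) (~~ b) i)) => [j|]; first by rewrite hwt_upd.
  by apply: WX; rewrite ?eS ?eT.
have [y wy e] := IH st' _ wx'; exists y => //.
rewrite (transport_homeward y ah hw) -e -{1}[b]negbK.
by apply/esym/(XX_inv1 n4 (Wwt wx)); rewrite ?eS ?eT.
Qed.

Lemma transported_ext lam lam' x : lam =1 lam' -> transported lam x -> transported lam' x.
Proof.
move=> e; elim=> [|h y z ah el wy _ IH]; first exact: transported0.
by apply: transportedD => // i; rewrite el.
Qed.

Lemma transported_add lam x y : transported lam x -> transported lam y -> transported lam (x + y).
Proof.
by move=> hx hy; elim: hx => [|h u z ah el wu _ IH]; rewrite ?add0r // -addrA; exact: transportedD.
Qed.

Lemma transportZ h (c : Qv) y : transport h (c *: y) = c *: transport h y.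
Proof.
have z0 : transport h 0 = 0.
  by have := transportZD h (- 1) 0 0; rewrite !scaleN1r oppr0 addr0 addNr.
by have := transportZD h c y 0; rewrite z0 !addr0.
Qed.

Lemma transported_scale lam c x : transported lam x -> transported lam (c *: x).
Proof.
elim=> [|h y z ah el wy _ IH]; first by rewrite scaler0; exact: transported0.
by rewrite scalerDr -transportZ; apply: transportedD => //; exact: WZ.
Qed.

Lemma wt_transported lam x : transported lam x -> wt lam x.
Proof.
elim=> [|h y z ah el wy _ IH]; first exact: wt0.
by apply: wtD => //; apply: wt_ext el _; apply: wt_transport => //; exact: Wwt.
Qed.

Lemma transported_lone lam b i x : composition r lam -> transported lam x -> lam (src b i) = 1 ->
  transported (shift lam b i) (X P b i x).
Proof.
move=> _ hx l1; elim: hx => [|h y z ah el wy _ IH].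
  by rewrite linear0; exact: transported0.
rewrite XD transport_lone ?el //; last exact: Wwt.
apply: transportedD => //; first by apply: admissible_upd; rewrite ?el ?l1.
by move=> j; rewrite hwt_upd /shift el.
Qed.

Lemma transported_unshift lam b i x : composition r lam -> transported lam x ->
  lam (src b i) = 0 -> 1 <= lam (tgt b i) ->
  exists2 z, transported (shift lam (~~ b) i) z & x = X P b i z.
Proof.
move=> _ hx l0 l1; elim: hx => [|h y x' ah el wy _ [z hz ->]].
  by exists 0; [exact: transported0|rewrite linear0].
exists (transport (upd h (~~ b) i) y + z).
  apply: transportedD => //; first by apply: admissible_upd => //; case: (b) l1 => /=; rewrite el.
  by move=> j; rewrite hwt_upd /shift el.
rewrite XD transport_lone ?updNK //; last 2 first.
- exact: Wwt.
- by rewrite hwt_upd shiftN el l0 eqxx src_neq_tgt.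
by apply: admissible_upd => //; case: (b) l1 => /=; rewrite el.
Qed.

Lemma transported_FE lam i x : composition r lam -> transported lam x ->
  (forall j, lam j <= 1) -> lam i = 1 -> lam (ordS i) = 1 ->
  transported lam (X P false i (X P true i x)).
Proof.
move=> _ hx st li lj; elim: hx => [|h y z ah el wy _ IH].
  by rewrite !linear0; exact: transported0.
have st' j : hwt h j <= 1 by rewrite el.
rewrite !XD; have w := transport_strict ah st' wy.
have /strict_transport[||y' wy' ->] : W (hwt h) (X P false i (X P true i (transport h y))).
- by apply: WFE; rewrite ?el.
- by [].
- by [].
exact: transportedD.
Qed.

Theorem transported_closed lam b i x : composition r lam -> transported lam x ->
  1 <= lam (src b i) -> transported (shift lam b i) (X P b i x).
Proof.
apply: (@stable_under_generators n r P n4 rn transported) => //.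
- exact: transported_ext.
- exact: transported_add.
- exact: transported_scale.
- exact: wt_transported.
- exact: transported_lone.
- exact: transported_unshift.
- exact: transported_FE.
Qed.

(** Rotations lead back to weight [omega], but through 0/1 weights only as far as [W] is concerned,
    so transport adds nothing to [W omega]. *)
Lemma transported_omega x : transported omega x -> W omega x.
Proof.
elim=> [|h y z ah el wy _ IH]; first exact: W0.
have st j : hwt h j <= 1 by rewrite el; have /andP[] := om01 j.
by apply: WD IH; apply: Wext el (transport_strict ah st wy).
Qed.

End Vectors.
End Heights.

(** * The regular module and the tensor module *)

Local Open Scope quotient_scope.

Section FormalCombinations.
Variable T : choiceType.
Implicit Types (p q : seq (Qv * T)) (t : T) (c : Qv).

Definition fcoef p t : Qv := \sum_(x <- p | x.2 == t) x.1.
Definition fscale c p := [seq (c * x.1, x.2) | x <- p].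
Definition fext (T' : Type) (phi : T -> seq (Qv * T')) p : seq (Qv * T') :=
  flatten [seq [seq (x.1 * y.1, y.2) | y <- phi x.2] | x <- p].

Lemma fcoef_cat p q t : fcoef (p ++ q) t = fcoef p t + fcoef q t.
Proof. by rewrite /fcoef big_cat. Qed.

Lemma fcoef_scale c p t : fcoef (fscale c p) t = c * fcoef p t.
Proof. by rewrite /fcoef big_map mulr_sumr. Qed.

Lemma sum_fext (T' : Type) (P : lmodType Qv) (phi : T -> seq (Qv * T')) (f : T' -> P) p :
  \sum_(y <- fext phi p) y.1 *: f y.2 = \sum_(x <- p) x.1 *: \sum_(y <- phi x.2) y.1 *: f y.2.
Proof.
rewrite /fext big_flatten big_map; apply: eq_bigr => x _.
by rewrite big_map scaler_sumr; apply: eq_bigr => y _; rewrite scalerA.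
Qed.

(** A subspace of the free vector space on [T], phrased on unnormalised lists. Both the presented
    algebra and the tensor space are obtained as quotients of this kind. *)
Record nullspace := NullSpace {
  null :> seq (Qv * T) -> Prop;
  null0 : null [::];
  null_cat : forall p q, null p -> null q -> null (p ++ q);
  null_scale : forall c p, null p -> null (fscale c p);
  null_ext : forall p q, (forall t, fcoef p t = fcoef q t) -> null p -> null q
}.

Variable N : nullspace.

Definition fequiv p q : bool := `[< N (p ++ fscale (- 1) q) >].

Lemma fequiv_refl : reflexive fequiv.
Proof.
move=> p; apply/asboolP; apply: null_ext (null0 N) => t.
by rewrite fcoef_cat fcoef_scale mulN1r subrr /fcoef big_nil.
Qed.

Lemma fequiv_sym : symmetric fequiv.
Proof.
suff h p q : fequiv p q -> fequiv q p by move=> p q; apply/idP/idP; apply: h.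
move=> /asboolP e; apply/asboolP; apply: null_ext (null_scale (- 1) e) => t.
by rewrite fcoef_scale !fcoef_cat !fcoef_scale mulrDr !mulN1r opprK addrC.
Qed.

Lemma fequiv_trans : transitive fequiv.
Proof.
move=> q p s /asboolP e1 /asboolP e2; apply/asboolP; apply: null_ext (null_cat e1 e2) => t.
by rewrite !fcoef_cat !fcoef_scale !mulN1r addrA subrK.
Qed.

Canonical fequiv_equiv := EquivRel fequiv fequiv_refl fequiv_sym fequiv_trans.
Definition fquot := {eq_quot fequiv}.
HB.instance Definition _ := Choice.on fquot.
HB.instance Definition _ := EqQuotient.on fquot.

Definition cls p : fquot := \pi_fquot p.

Lemma cls_eq p q : cls p = cls q <-> N (p ++ fscale (- 1) q).
Proof.
by split=> [/eqmodP/asboolP|h] //; apply/eqmodP; apply/asboolP.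
Qed.

Lemma cls_surj (x : fquot) : exists p, x = cls p.
Proof. by exists (repr x); rewrite /cls reprK. Qed.

Lemma cls_ext p q : (forall t, fcoef p t = fcoef q t) -> cls p = cls q.
Proof.
move=> e; apply/cls_eq; apply: null_ext (null0 N) => t.
by rewrite fcoef_cat fcoef_scale mulN1r e subrr /fcoef big_nil.
Qed.

Definition fadd (x y : fquot) := cls (repr x ++ repr y).
Definition fmul c (x : fquot) := cls (fscale c (repr x)).

Lemma repr_cls p : N (repr (cls p) ++ fscale (- 1) p).
Proof. by apply/cls_eq; rewrite /cls reprK. Qed.

Lemma faddE p q : fadd (cls p) (cls q) = cls (p ++ q).
Proof.
apply/cls_eq; apply: null_ext (null_cat (repr_cls p) (repr_cls q)) => t.
by rewrite !fcoef_cat !fcoef_scale !fcoef_cat; ring.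
Qed.

Lemma fmulE c p : fmul c (cls p) = cls (fscale c p).
Proof.
apply/cls_eq; apply: null_ext (null_scale c (repr_cls p)) => t.
by rewrite !fcoef_scale !fcoef_cat !fcoef_scale; ring.
Qed.

Lemma faddA : associative fadd.
Proof.
move=> x y z; have [p ->] := cls_surj x; have [q ->] := cls_surj y; have [s ->] := cls_surj z.
by rewrite !faddE catA.
Qed.

Lemma faddC : commutative fadd.
Proof.
move=> x y; have [p ->] := cls_surj x; have [q ->] := cls_surj y.
by rewrite !faddE; apply: cls_ext => t; rewrite !fcoef_cat addrC.
Qed.

Lemma fadd0 : left_id (cls [::]) fadd.
Proof. by move=> x; have [p ->] := cls_surj x; rewrite faddE. Qed.

Lemma faddN : left_inverse (cls [::]) (fmul (- 1)) fadd.
Proof.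
move=> x; have [p ->] := cls_surj x; rewrite fmulE faddE; apply: cls_ext => t.
by rewrite fcoef_cat fcoef_scale mulN1r addNr /fcoef big_nil.
Qed.

HB.instance Definition _ := GRing.isZmodule.Build fquot faddA faddC fadd0 faddN.

Lemma fmulA c d x : fmul c (fmul d x) = fmul (c * d) x.
Proof.
by have [p ->] := cls_surj x; rewrite !fmulE; apply: cls_ext => t; rewrite !fcoef_scale mulrA.
Qed.

Lemma fmul1 : left_id 1 fmul.
Proof.
by move=> x; have [p ->] := cls_surj x; rewrite fmulE; apply: cls_ext => t; rewrite fcoef_scale mul1r.
Qed.

Lemma fmulDr : right_distributive fmul +%R.
Proof.
move=> c x y; have [p ->] := cls_surj x; have [q ->] := cls_surj y.
rewrite /GRing.add /= faddE !fmulE faddE; apply: cls_ext => t.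
by rewrite fcoef_scale !fcoef_cat !fcoef_scale mulrDr.
Qed.

Lemma fmulDl x : {morph fmul^~ x : c d / c + d}.
Proof.
move=> c d; have [p ->] := cls_surj x; rewrite !fmulE [RHS]faddE; apply: cls_ext => t.
by rewrite fcoef_cat !fcoef_scale mulrDl.
Qed.

HB.instance Definition _ := GRing.Zmodule_isLmodule.Build Qv fquot fmulA fmul1 fmulDr fmulDl.

Lemma clsD p q : cls p + cls q = cls (p ++ q).
Proof. exact: faddE. Qed.

Lemma clsZ c p : c *: cls p = cls (fscale c p).
Proof. exact: fmulE. Qed.

Lemma cls_eq0 p : cls p = 0 <-> N p.
Proof.
split=> [/cls_eq|h]; last apply/cls_eq; last by rewrite cats0.
by rewrite cats0.
Qed.

Definition fgen t : fquot := cls [:: (1, t)].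

Lemma clsE p : cls p = \sum_(x <- p) x.1 *: fgen x.2.
Proof.
elim: p => [|[c t] p IH]; first by rewrite big_nil.
rewrite big_cons -IH clsZ clsD; apply: cls_ext => u.
by rewrite /fcoef /= !big_cons /= mulr1.
Qed.

Section Extension.
Variable phi : T -> seq (Qv * T).
Hypothesis phiN : forall p, N p -> N (fext phi p).

Definition flin (x : fquot) : fquot := cls (fext phi (repr x)).

Lemma cls_fext p : cls (fext phi p) = \sum_(x <- p) x.1 *: cls (phi x.2).
Proof. by rewrite clsE sum_fext; apply: eq_bigr => x _; rewrite clsE. Qed.

Lemma flinE p : flin (cls p) = cls (fext phi p).
Proof.
have /phiN/cls_eq0 := repr_cls p.
rewrite cls_fext big_cat -cls_fext /= big_map /= => e.
apply/eqP; rewrite -subr_eq0 -{}e; apply/eqP; congr (_ + _).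
rewrite cls_fext -sumrN; apply: eq_bigr => x _.
by rewrite /= mulN1r scaleNr.
Qed.

Lemma flin_is_linear : linear flin.
Proof.
move=> c x y; have [p ->] := cls_surj x; have [q ->] := cls_surj y.
rewrite clsZ clsD !flinE !cls_fext big_cat big_map /= scaler_sumr; congr (_ + _).
by apply: eq_bigr => z _; rewrite scalerA.
Qed.

Lemma flin_gen t : flin (fgen t) = cls (phi t).
Proof. by rewrite flinE cls_fext big_seq1 scale1r. Qed.

End Extension.
End FormalCombinations.

Lemma fext_coef (T T' : choiceType) (phi : T -> seq (Qv * T')) p q :
  (forall t, fcoef p t = fcoef q t) -> forall u, fcoef (fext phi p) u = fcoef (fext phi q) u.
Proof.
move=> e u.
have cE l : fcoef (fext phi l) u = \sum_(x <- l) x.1 * fcoef (phi x.2) u.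
  rewrite /fcoef /fext big_flatten big_map; apply: eq_bigr => x _.
  by rewrite big_map /= mulr_sumr.
have z : \sum_(x <- p ++ fscale (- 1) q) x.1 * fcoef (phi x.2) u = 0.
  apply: (@sum_coef_eq0 T Qv^o (fun t => fcoef (phi t) u)) => t.
  by have := fcoef_cat p (fscale (- 1) q) t; rewrite fcoef_scale e mulN1r subrr.
rewrite !cE; apply/eqP; rewrite -subr_eq0; apply/eqP; rewrite -[RHS]z big_cat big_map.
by congr (_ + _); rewrite -sumrN; apply: eq_bigr => x _; rewrite /= mulN1r mulNr.
Qed.

HB.instance Definition _ n := Choice.copy (gen n) (pcan_type (@gen_codeK n)).

(** * The presented algebra as a left module over itself *)

Section RegularModule.
Variables (n r : nat).

Lemma fa_coefE (p : fa n) w : fa_coef p w = fcoef p w.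
Proof. by []. Qed.

Lemma ideal0 : @in_rel_ideal n r [::].
Proof. by exists [::]; split. Qed.

Lemma ideal_cat (p q : fa n) : in_rel_ideal r p -> in_rel_ideal r q -> in_rel_ideal r (p ++ q).
Proof.
move=> [s [sr se]] [t [tr te]]; exists (s ++ t); split=> [x|w].
  by rewrite mem_cat => /orP[/sr|/tr].
by rewrite /ideal_expand map_cat flatten_cat !fa_coefE !fcoef_cat -!fa_coefE se te.
Qed.

Lemma ideal_scale c (p : fa n) : in_rel_ideal r p -> in_rel_ideal r (fscale c p).
Proof.
move=> [s [sr se]]; exists [seq ((c * x.1.1.1, x.1.1.2), x.1.2, x.2) | x <- s]; split=> [x|w].
  by case/mapP => y /sr h ->.
rewrite !fa_coefE fcoef_scale -fa_coefE se fa_coefE -fcoef_scale; congr fcoef.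
rewrite /fscale /ideal_expand map_flatten -!map_comp.
by congr flatten; apply: eq_map => x /=; rewrite -map_comp; apply: eq_map => y /=; rewrite mulrA.
Qed.

Lemma ideal_ext (p q : fa n) : (forall t, fcoef p t = fcoef q t) ->
  in_rel_ideal r p -> in_rel_ideal r q.
Proof. by move=> e [s [sr se]]; exists s; split=> // w; rewrite -se; exact/esym/e. Qed.

Definition ideal_null := NullSpace ideal0 ideal_cat ideal_scale ideal_ext.
Definition prepend (g : gen n) (w : word n) : seq (Qv * word n) := [:: (1, g :: w)].

Lemma prepend_null g p : ideal_null p -> ideal_null (fext (prepend g) p).
Proof.
move=> [s [sr se]]; exists [seq ((x.1.1.1, g :: x.1.1.2), x.1.2, x.2) | x <- s]; split=> [x|w].
  by case/mapP => y /sr h ->.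
have := @fext_coef _ _ (prepend g) p (ideal_expand s) se w.
rewrite !fa_coefE => ->; congr fcoef; rewrite /fext /ideal_expand /prepend /=.
elim: s {sr se} => //= x s IH; rewrite map_cat flatten_cat IH; congr (_ ++ _).
by elim: (x.1.2) => //= y l ->; rewrite mulr1.
Qed.

Definition regular_op g := flin (N := ideal_null) (prepend g).
HB.instance Definition _ g :=
  GRing.isLinear.Build _ _ _ _ (regular_op g) (flin_is_linear (@prepend_null g)).

Definition regular_act (g : gen n) : {linear fquot ideal_null -> fquot ideal_null} := regular_op g.

Lemma regular_wact u w : wact regular_act u (fgen ideal_null w) = fgen ideal_null (u ++ w).
Proof. by elim: u => //= g u ->; apply: (flin_gen (@prepend_null g)). Qed.

Lemma regular_rel rho : relator r rho -> forall x, faact regular_act rho x = 0.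
Proof.
move=> h x; have [p ->] := cls_surj x; rewrite clsE linear_sum big1 // => -[c w] _ /=.
rewrite linearZ /=; suff -> : faact regular_act rho (fgen ideal_null w) = 0 by rewrite scaler0.
rewrite /faact (eq_bigr (fun y => y.1 *: fgen ideal_null (y.2 ++ w))); last first.
  by move=> y _; rewrite regular_wact.
rewrite -(big_map (fun y => (y.1, y.2 ++ w)) predT (fun y => y.1 *: fgen ideal_null y.2)) /= -clsE.
apply/cls_eq0; exists [:: ((1, [::]), rho, w)]; split=> [y|u].
  by rewrite inE => /eqP->.
rewrite /ideal_expand /= cats0; congr fa_coef.
by apply: eq_map => y; rewrite mul1r.
Qed.

Definition regular_module : schur_module n r := SchurModule regular_rel.

(** The class of the empty word is the unit, so p sends it to the class of p. *)
Lemma regular_faact (p : fa n) :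
  faact (gact regular_module) p (fgen ideal_null [::]) = 0 -> in_rel_ideal r p.
Proof.
move=> h; apply/(cls_eq0 ideal_null); rewrite clsE -[RHS]h /faact.
by apply: eq_bigr => y _; rewrite regular_wact cats0.
Qed.

End RegularModule.

(** * Tensor spaces and the recursive form of the action *)

Section Tensors.
Variable n : nat.
Implicit Types (i j : 'I_n) (a : int) (s : seq int).

Section Sizes.
Variable D : pred nat.

(** Basis vectors whose length fails [D] become zero. With [predT] all tensor powers are present
    together, so that prepending a factor is an operator and relations can be proved by induction on
    length; the length-r part is obtained from [D]. *)
Definition tensor_zero (p : seq (Qv * seq int)) := forall s, D (size s) -> fcoef p s = 0.

Lemma tensor_zero0 : tensor_zero [::].
Proof. by move=> s _; rewrite /fcoef big_nil. Qed.
Lemma tensor_zero_cat p q : tensor_zero p -> tensor_zero q -> tensor_zero (p ++ q).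
Proof. by move=> hp hq s Ds; rewrite fcoef_cat hp ?hq ?addr0. Qed.
Lemma tensor_zero_scale c p : tensor_zero p -> tensor_zero (fscale c p).
Proof. by move=> hp s Ds; rewrite fcoef_scale hp ?mulr0. Qed.
Lemma tensor_zero_ext p q : (forall t, fcoef p t = fcoef q t) -> tensor_zero p -> tensor_zero q.
Proof. by move=> e hp s Ds; rewrite -e hp. Qed.

Definition tensor_null :=
  NullSpace tensor_zero0 tensor_zero_cat tensor_zero_scale tensor_zero_ext.
Local Notation V := (fquot tensor_null).

Lemma tE_size i s y : y \in tE i s -> size y.2 = size s.
Proof.
elim: s y => //= a s IH y; rewrite mem_cat => /orP[/mapP[z _ ->]//|/mapP[z /IH e ->] /=].
by rewrite e.
Qed.

Lemma tF_size i s y : y \in tF i s -> size y.2 = size s.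
Proof.
elim: s y => //= a s IH y; rewrite mem_cat => /orP[/mapP[z /IH e ->] /=|/mapP[z _ ->]//].
by rewrite e.
Qed.

Lemma tgen_size (g : gen n) s y : y \in tgen g s -> size y.2 = size s.
Proof.
by case: g => i /=; [exact: tE_size|exact: tF_size|rewrite inE => /eqP->|rewrite inE => /eqP->].
Qed.

Lemma tgen_null (g : gen n) p : tensor_null p -> tensor_null (fext (tgen g) p).
Proof.
move=> hp s Ds.
have -> : fcoef (fext (tgen g) p) s =
    \sum_(x <- [seq x <- p | D (size x.2)]) x.1 * fcoef (tgen g x.2) s.
  rewrite big_filter [RHS]big_mkcond /fcoef /fext big_flatten big_map; apply: eq_bigr => x _.
  rewrite big_map -mulr_sumr; case: ifP => // Dx; rewrite [X in _ * X]big1_seq ?mulr0 // => y.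
  by case/andP => /= /eqP ys yx; rewrite -(tgen_size yx) ys Ds in Dx.
apply: (@sum_coef_eq0 _ Qv^o (fun t => fcoef (tgen g t) s)) => t.
rewrite big_filter_cond; case Dt: (D (size t)).
  by rewrite -[RHS](hp t Dt); apply: eq_bigl => x; case: eqP => [->|_]; rewrite ?Dt ?andbF.
by rewrite big1 // => x /andP[Dx /eqP e]; rewrite e Dt in Dx.
Qed.

Definition tensor_op (g : gen n) := flin (N := tensor_null) (tgen g).
HB.instance Definition _ g :=
  GRing.isLinear.Build _ _ _ _ (tensor_op g) (flin_is_linear (@tgen_null g)).
Definition tensor_act (g : gen n) : {linear V -> V} := tensor_op g.

Lemma tensor_wact (w : word n) s : wact tensor_act w (fgen tensor_null s) = cls tensor_null (tword w s).
Proof. by elim: w => //= g w ->; apply: (flinE (@tgen_null g)). Qed.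

Lemma tensor_faact (p : fa n) s : faact tensor_act p (fgen tensor_null s) = cls tensor_null (tact p s).
Proof.
rewrite /faact (eq_bigr (fun x => x.1 *: cls tensor_null (tword x.2 s))) => [|x _].
  elim: p => [|x p IH]; first by rewrite big_nil.
  by rewrite big_cons IH clsZ clsD.
by rewrite tensor_wact.
Qed.

End Sizes.

Local Notation Vinf := (fquot (tensor_null predT)).
Local Notation e := (fgen (tensor_null predT)).
Local Notation E i := (tensor_act predT (GE i)).
Local Notation F i := (tensor_act predT (GF i)).
Local Notation K i := (tensor_act predT (GK i)).
Local Notation Ki i := (tensor_act predT (GKi i)).

Definition cons1 a s : seq (Qv * seq int) := [:: (1, a :: s)].
Lemma cons1_null a p : tensor_null predT p -> tensor_null predT (fext (cons1 a) p).
Proof.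
move=> hp s _; rewrite (@fext_coef _ _ (cons1 a) p [::]) ?/fcoef ?big_nil // => t.
by rewrite -/(fcoef p t) hp // big_nil.
Qed.
Definition cons_op a := flin (N := tensor_null predT) (cons1 a).
HB.instance Definition _ a :=
  GRing.isLinear.Build _ _ _ _ (cons_op a) (flin_is_linear (@cons1_null a)).
Definition tcons a : {linear Vinf -> Vinf} := cons_op a.

Lemma tcons_e a s : tcons a (e s) = e (a :: s).
Proof. exact: (flin_gen (@cons1_null a)). Qed.

Lemma act_e g s : tensor_act predT g (e s) = cls _ (tgen g s).
Proof. exact: (flin_gen (@tgen_null predT g)). Qed.

Lemma K_e i s : K i (e s) = diag (vK i) s *: e s.
Proof. by rewrite act_e clsE big_seq1. Qed.
Lemma Ki_e i s : Ki i (e s) = diag (vKi i) s *: e s.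
Proof. by rewrite act_e clsE big_seq1. Qed.

Lemma lin_ext (P : lmodType Qv) (f g : {linear Vinf -> P}) : (forall s, f (e s) = g (e s)) -> f =1 g.
Proof.
move=> h x; have [p ->] := cls_surj x; rewrite clsE !linear_sum; apply: eq_bigr => y _.
by rewrite !linearZ /= h.
Qed.

Definition Kt i : {linear Vinf -> Vinf} := K i \o Ki (ordS i).

Lemma diagM f g s : diag f s * diag g s = diag (fun a => f a * g a) s.
Proof. by elim: s => [|a s IH] /=; rewrite ?mulr1 // -IH mulrACA. Qed.

Lemma Kt_e i s : Kt i (e s) = diag (vKt i) s *: e s.
Proof. by rewrite /= Ki_e linearZ /= K_e scalerA mulrC diagM. Qed.

Lemma E_cons i a x : E i (tcons a x) =
  (if congn (a - 1) i then tcons (a - 1) (Kt i x) else 0) + tcons a (E i x).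
Proof.
case: ifP => c; last first.
  rewrite add0r; apply: (lin_ext (f := E i \o tcons a) (g := tcons a \o E i)) => s /=.
  by rewrite tcons_e !act_e /= /vE c /= clsE big_map /= clsE linear_sum;
     apply: eq_bigr => y _; rewrite linearZ /= tcons_e.
apply: (lin_ext (f := E i \o tcons a) (g := (tcons (a - 1) \o Kt i) \+ (tcons a \o E i))) => s /=.
rewrite tcons_e -[K i _]/(Kt i (e s)) Kt_e linearZ /= tcons_e !act_e /= /vE c /=.
rewrite clsE big_cons mul1r /= clsE linear_sum big_map; congr (_ + _).
by apply: eq_bigr => y _; rewrite linearZ /= tcons_e.
Qed.

Lemma F_cons i a x : F i (tcons a x) =
  vKti i a *: tcons a (F i x) + (if congn a i then tcons (a + 1) x else 0).
Proof.
have h s : \sum_(y <- [seq (vKti i a * y.1, a :: y.2) | y <- tF i s]) y.1 *: e y.2 =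
    vKti i a *: tcons a (F i (e s)).
  rewrite act_e /= big_map clsE linear_sum scaler_sumr; apply: eq_bigr => y _.
  by rewrite linearZ /= tcons_e scalerA.
case: ifP => c.
  apply: (lin_ext (f := F i \o tcons a) (g := (vKti i a \*: (tcons a \o F i)) \+ tcons (a + 1))).
  move=> s /=; rewrite -h tcons_e act_e /= /vF c clsE big_cat; congr (_ + _).
  by rewrite big_seq1 scale1r tcons_e.
rewrite addr0; apply: (lin_ext (f := F i \o tcons a) (g := vKti i a \*: (tcons a \o F i))).
by move=> s /=; rewrite -h tcons_e act_e /= /vF c clsE cats0.
Qed.

Lemma K_cons i a x : K i (tcons a x) = vK i a *: tcons a (K i x).
Proof.
apply: (lin_ext (f := K i \o tcons a) (g := vK i a \*: (tcons a \o K i))) => s /=.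
by rewrite tcons_e !K_e linearZ /= tcons_e scalerA.
Qed.

End Tensors.

(** * The relations (Q1)-(Q9) on tensors of all lengths *)

Section TensorRelations.
Variable n : nat.
Hypothesis n4 : (3 < n)%N.
Implicit Types (i j : 'I_n) (a : int) (s : seq int).
Local Notation Vinf := (fquot (tensor_null predT)).
Local Notation e := (fgen (tensor_null predT)).
Local Notation E i := (tensor_act predT (GE i)).
Local Notation F i := (tensor_act predT (GF i)).
Local Notation K i := (tensor_act predT (GK i)).
Local Notation Ki i := (tensor_act predT (GKi i)).
Local Notation site := (site (lt3_gt0 n4)).
Implicit Types x : Vinf.

Lemma opD (g : gen n) x y : tensor_act predT g (x + y) = tensor_act predT g x + tensor_act predT g y.
Proof. exact: linearD. Qed.
Lemma opZ (g : gen n) (c : Qv) x : tensor_act predT g (c *: x) = c *: tensor_act predT g x.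
Proof. exact: linearZ. Qed.
Lemma op0 (g : gen n) : tensor_act predT g 0 = 0.
Proof. exact: linear0. Qed.
Lemma tcD a x y : tcons a (x + y) = tcons a x + tcons a y.
Proof. exact: linearD. Qed.
Lemma tcZ a (c : Qv) x : tcons a (c *: x) = c *: tcons a x.
Proof. exact: linearZ. Qed.
Lemma tc0 a : tcons a 0 = 0.
Proof. exact: linear0. Qed.

Definition tens_lin := (opD, opZ, op0, tcD, tcZ, tc0).

Lemma E_nil i : E i (e [::]) = 0.
Proof. by rewrite act_e clsE big_nil. Qed.
Lemma F_nil i : F i (e [::]) = 0.
Proof. by rewrite act_e clsE big_nil. Qed.

Lemma vKE i a : vK i a = vv ^ (site a == i)%:Z.
Proof. by rewrite /vK (congnE (lt3_gt0 n4)); case: ifP; rewrite ?expr1z ?expr0z. Qed.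
Lemma vKiE i a : vKi i a = vv ^ (- (site a == i)%:Z).
Proof. by rewrite /vKi (congnE (lt3_gt0 n4)); case: ifP; rewrite ?exprN1 ?oppr0 ?expr0z. Qed.
Lemma vKtE i a : vKt i a = vv ^ ((site a == i)%:Z - (site a == ordS i)%:Z).
Proof. by rewrite /vKt vKE vKiE -expfzDr ?vv_neq0. Qed.
Lemma vKtiE i a : vKti i a = vv ^ ((site a == ordS i)%:Z - (site a == i)%:Z).
Proof. by rewrite /vKti vKE vKiE -expfzDr ?vv_neq0 // addrC. Qed.
Lemma site_pred a : site a = ordS (site (a - 1)).
Proof. by rewrite -siteS subrK. Qed.

Lemma eps_plusE i j : eps_plus i j = (j == i)%:Z - (ordS j == i)%:Z.
Proof.
rewrite /eps_plus eq_ord_pred; case: eqP => [->|_]; first by rewrite (ordS_neqs n4).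
by case: eqP.
Qed.

Lemma K_E i j x : K i (E j x) = vv ^ eps_plus i j *: E j (K i x).
Proof.
suff h s : K i (E j (e s)) = vv ^ eps_plus i j *: E j (K i (e s)).
  exact: (lin_ext (f := K i \o E j) (g := vv ^ eps_plus i j \*: (E j \o K i)) h x).
elim: s => [|a s IH].
  by rewrite K_e opZ E_nil op0 !scaler0.
rewrite -tcons_e E_cons K_cons K_e !tens_lin E_cons K_cons IH K_e !tens_lin.
rewrite (congnE (lt3_gt0 n4)); case: eqP => [c|_]; last by rewrite op0; lmod_coefs Qv; ring.
rewrite K_cons Kt_e opZ K_e !tens_lin !vKE (site_pred a) c eps_plusE.
rewrite expfzDr ?vv_neq0 //.
have : vv ^ (- (ordS j == i)%:Z) * vv ^ (ordS j == i)%:Z = 1 by rewrite -expfzDr ?vv_neq0 // addNr.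
move: (vv ^ (j == i)%:Z) (vv ^ (- (ordS j == i)%:Z)) (vv ^ (ordS j == i)%:Z) => v1 v2 v3 h.
move: (diag _ _) (diag _ _) => d1 d2.
lmod_coefs Qv; first by ring.
by transitivity (v1 * d2 * d1 * (v2 * v3)); [rewrite h|]; ring.
Qed.

Lemma KKi i x : K i (Ki i x) = x.
Proof.
apply: (lin_ext (f := K i \o Ki i) (g := idfun)) => s /=.
rewrite Ki_e opZ K_e scalerA mulrC diagM (_ : diag _ s = 1) ?scale1r //.
by elim: s => //= a s ->; rewrite vKE vKiE -expfzDr ?vv_neq0 // subrr expr0z mulr1.
Qed.

Lemma KiK i x : Ki i (K i x) = x.
Proof.
apply: (lin_ext (f := Ki i \o K i) (g := idfun)) => s /=.
rewrite K_e opZ Ki_e scalerA diagM (_ : diag _ s = 1) ?scale1r //.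
by elim: s => //= a s ->; rewrite vKE vKiE -expfzDr ?vv_neq0 // subrr expr0z mulr1.
Qed.

Lemma KK i j x : K i (K j x) = K j (K i x).
Proof.
apply: (lin_ext (f := K i \o K j) (g := K j \o K i)) => s /=.
by rewrite !(K_e, opZ) !scalerA mulrC.
Qed.

Lemma Ki_E i j x : Ki i (E j x) = vv ^ (- eps_plus i j) *: E j (Ki i x).
Proof.
have := K_E i j (Ki i x); rewrite KKi => h; have := congr1 (Ki i) h.
by rewrite KiK opZ => ->; rewrite scalerA -expfzDr ?vv_neq0 // addNr expr0z scale1r.
Qed.

Lemma K_F i j x : K i (F j x) = vv ^ eps_minus i j *: F j (K i x).
Proof.
suff h s : K i (F j (e s)) = vv ^ eps_minus i j *: F j (K i (e s)).
  exact: (lin_ext (f := K i \o F j) (g := vv ^ eps_minus i j \*: (F j \o K i)) h x).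
elim: s => [|a s IH].
  by rewrite K_e opZ F_nil op0 !scaler0.
rewrite -tcons_e F_cons K_cons K_e !tens_lin F_cons K_cons IH K_e !tens_lin.
rewrite (congnE (lt3_gt0 n4)); case: eqP => [c|_]; last by rewrite op0; lmod_coefs Qv; ring.
rewrite K_cons K_e !tens_lin !vKE siteS c /eps_minus eps_plusE opprB.
rewrite expfzDr ?vv_neq0 //.
have : vv ^ (- (j == i)%:Z) * vv ^ (j == i)%:Z = 1 by rewrite -expfzDr ?vv_neq0 // addNr.
move: (vv ^ (ordS j == i)%:Z) (vv ^ (- (j == i)%:Z)) (vv ^ (j == i)%:Z) => v1 v2 v3 h.
move: (vKti _ _) (diag _ _) => d1 d2.
lmod_coefs Qv; last by ring.
by transitivity (v1 * d2 * (v2 * v3)); [rewrite h|]; ring.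
Qed.

Lemma Ki_F i j x : Ki i (F j x) = vv ^ (- eps_minus i j) *: F j (Ki i x).
Proof.
have := K_F i j (Ki i x); rewrite KKi => h; have := congr1 (Ki i) h.
by rewrite KiK opZ => ->; rewrite scalerA -expfzDr ?vv_neq0 // addNr expr0z scale1r.
Qed.

Lemma Kt_E i j x : Kt i (E j x) = vv ^ (eps_plus i j - eps_plus (ordS i) j) *: E j (Kt i x).
Proof. by rewrite /= Ki_E opZ K_E scalerA -expfzDr ?vv_neq0 // addrC. Qed.

Lemma Kt_F i j x : Kt i (F j x) = vv ^ (eps_minus i j - eps_minus (ordS i) j) *: F j (Kt i x).
Proof. by rewrite /= Ki_F opZ K_F scalerA -expfzDr ?vv_neq0 // addrC. Qed.

Lemma congn1 a i : congn a i = (site a == i).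
Proof. exact: congnE. Qed.

Lemma site_predE a i : (site (a - 1) == i) = (site a == ordS i).
Proof. by rewrite (site_pred a) (inj_eq (@ordS_inj n)). Qed.

(** The mixed terms of the two coproducts cancel by commuting K past E and F, leaving the commutator
    on the tail and, for i = j, the one on the first factor. *)
Lemma EF_cons i j a x :
  E i (F j (tcons a x)) - F j (E i (tcons a x)) =
  vKti j a *: tcons a (E i (F j x) - F j (E i x)) +
  (if i == j then (if site a == i then tcons a (Kt i x) else 0) -
     (if site a == ordS i then tcons a (Kt i x) else 0) else 0).
Proof.
have S' := ordS_neqs n4; have tcB y z : tcons a (y - z) = tcons a y - tcons a z by exact: linearB.
rewrite F_cons E_cons opD opZ E_cons opD F_cons tcB.
rewrite !congn1 !site_predE; case: (eqVneq (site a) (ordS i)) => [ui|ui].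
  rewrite F_cons congn1 subrK site_predE ui Kt_F tcZ.
  have -> : vKti j (a - 1) = vKti j a * vv ^ (eps_minus i j - eps_minus (ordS i) j).
    rewrite !vKtiE -expfzDr ?vv_neq0 // !site_predE ui /eps_minus !eps_plusE !S'.
    by congr (_ ^ _); rewrite ![ordS j == _]eq_sym ![j == _]eq_sym; lia.
  move: (vKti j a) (vv ^ _) => c d; case: (eqVneq i j) => [<-|ij].
    by rewrite !S' !eqxx op0; lmod_coefs Qv; ring.
  rewrite !S' (negPf ij); case: eqP => _; rewrite ?op0 ?E_cons ?addrK ?congn1 ?ui ?S'.
    by lmod_coefs Qv; ring.
  by lmod_coefs Qv; ring.
rewrite op0; move: (vKti j a) => c; case: (eqVneq (site a) j) => [uj|uj].
  rewrite E_cons addrK congn1 uj; case: (eqVneq i j) => [->|ij].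
    by lmod_coefs Qv; ring.
  by lmod_coefs Qv; ring.
case: (eqVneq i j) => [->|ij]; rewrite op0 ?(negPf uj); lmod_coefs Qv; ring.
Qed.

Definition Kt' i : {linear Vinf -> Vinf} := Ki i \o K (ordS i).

Lemma Kt'_e i s : Kt' i (e s) = diag (vKti i) s *: e s.
Proof. by rewrite /= K_e opZ Ki_e scalerA mulrC diagM. Qed.

Lemma E_F i j x : E i (F j x) - F j (E i x) =
  if i == j then (vv - vv^-1)^-1 *: (Kt i x - Kt' i x) else 0.
Proof.
have S' := ordS_neqs n4.
case: (eqVneq i j) => [<-|ij]; last first.
  apply/eqP; rewrite subr_eq0; apply/eqP.
  apply: (lin_ext (f := E i \o F j) (g := F j \o E i)) => s.
  rewrite -[LHS]/(E i (F j (e s))) -[RHS]/(F j (E i (e s))).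
  elim: s => [|a s IH]; first by rewrite F_nil E_nil !op0.
  apply/eqP; rewrite -subr_eq0 -tcons_e EF_cons IH (negPf ij) subrr tc0 scaler0 addr0 //.
apply/eqP; rewrite subr_eq; apply/eqP.
apply: (lin_ext (f := E i \o F i) (g := ((vv - vv^-1)^-1 \*: (Kt i \- Kt' i)) \+ (F i \o E i))) => s.
rewrite -[LHS]/(E i (F i (e s))).
rewrite -[RHS]/((vv - vv^-1)^-1 *: (Kt i (e s) - Kt' i (e s)) + F i (E i (e s))).
apply/eqP; rewrite -subr_eq; apply/eqP.
elim: s => [|a s IH]; first by rewrite F_nil E_nil !op0 Kt_e Kt'_e /= !subrr scaler0.
rewrite -tcons_e EF_cons IH eqxx tcons_e 2!Kt_e !Kt'_e -scalerBl !tcZ !tcons_e /=.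
rewrite vKtE vKtiE; move: (diag _ _) (diag _ _) => d' d.
have := mulVf vv_sub_inv_neq0; move: ((vv - vv^-1)^-1) => D hD.
have [ui|ui] := eqVneq (site a) i.
  rewrite ui S' /= subr0 sub0r expr1z exprN1 //; lmod_coefs Qv; move: (vv) (vv^-1) hD => v w hD.
  by transitivity (w * (D * (d - d')) + D * (v - w) * d); [rewrite hD|]; ring.
have [ui'|ui'] := eqVneq (site a) (ordS i).
  rewrite /= subr0 sub0r expr1z exprN1 //; lmod_coefs Qv; move: (vv) (vv^-1) hD => v w hD.
  by transitivity (v * (D * (d - d')) - D * (v - w) * d); [rewrite hD|]; ring.
rewrite /= subrr expr0z !mul1r scale1r; lmod_coefs Qv; ring.
Qed.

Lemma KtC i j x : Kt i (Kt j x) = Kt j (Kt i x).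
Proof.
apply: (lin_ext (f := Kt i \o Kt j) (g := Kt j \o Kt i)) => s.
rewrite -[LHS]/(Kt i (Kt j (e s))) -[RHS]/(Kt j (Kt i (e s))).
by rewrite !Kt_e !linearZ_LR !Kt_e !scalerA mulrC.
Qed.

Lemma Kt_Esame i x : Kt i (E i x) = (vv * vv) *: E i (Kt i x).
Proof. by rewrite Kt_E !eps_plusE !(ordS_neqs n4) !eqxx. Qed.
Lemma Kt_Eadj i j x : adjacent i j -> Kt i (E j x) = vv^-1 *: E j (Kt i x).
Proof.
rewrite adjacentE Kt_E !eps_plusE => /orP[/eqP->|/eqP<-]; rewrite !(ordS_neqs n4) ?eqxx.
  by rewrite -exprN1.
by rewrite -exprN1.
Qed.
Lemma Kt_Efar i j x : i != j -> ~~ adjacent i j -> Kt i (E j x) = E j (Kt i x).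
Proof.
rewrite adjacentE negb_or Kt_E !eps_plusE => ij /andP[/negPf a1 /negPf a2].
by rewrite !(ordS_neqs n4) eq_sym (negPf ij) a1 a2 expr0z scale1r.
Qed.

Lemma E_far i j x : ~~ adjacent i j -> E i (E j x) = E j (E i x).
Proof.
move=> fij; case: (eqVneq i j) => [->//|ij].
have fji : ~~ adjacent j i by rewrite adjacentC.
apply: (lin_ext (f := E i \o E j) (g := E j \o E i)) => s.
rewrite -[LHS]/(E i (E j (e s))) -[RHS]/(E j (E i (e s))).
elim: s => [|a s IH]; first by rewrite !E_nil !op0.
rewrite -tcons_e !E_cons !opD !E_cons IH !congn1 !site_predE.
rewrite !Kt_Efar 1?[j == i]eq_sym //.
move: (fij); rewrite adjacentE negb_or => /andP[/negPf a1 /negPf a2].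
have u k l (y : Vinf) : (ordS k == l) = false ->
   E k (if site a == ordS l then tcons (a - 1) y else 0) =
   (if site a == ordS l then tcons (a - 1) (E k y) else 0).
  move=> kl; case: eqP => [ul|_]; last exact: op0.
  have ul' : site (a - 1) = l by apply: (@ordS_inj n); rewrite -site_pred.
  by rewrite E_cons congn1 site_predE ul' eq_sym kl add0r.
rewrite !u //; last by rewrite eq_sym.
by rewrite !addrA; congr (_ + _); rewrite addrC.
Qed.

Definition serre (g : bool -> {linear Vinf -> Vinf}) x :=
  g true (g true (g false x)) =
  (vv + vv^-1) *: g true (g false (g true x)) - g false (g true (g true x)).

(** If E_i and E_j kill the first factor, the relation is that of the tail. Otherwise all K are
    moved inside the E by the rules [R], and coefficients in v are compared. *)
Lemma E_serre_cons i j a x : adjacent i j ->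
  serre (fun b => if b then E i else E j) x -> serre (fun b => if b then E i else E j) (tcons a x).
Proof.
move=> ij; have ji : adjacent j i by rewrite adjacentC.
have S' := ordS_neqs n4.
rewrite /serre => h; have K1 y := Kt_Esame i y.
have K2 y := Kt_Eadj y ij.
have K3 y := Kt_Eadj y ji.
have K4 y : Kt j (Kt i y) = Kt i (Kt j y) by exact: KtC.
have KZ k (c : Qv) y : Kt k (c *: y) = c *: Kt k y by exact: linearZ.
have st k y : E k (tcons a y) =
    (if site a == ordS k then tcons (a - 1) (Kt k y) else 0) + tcons a (E k y).
  by rewrite E_cons congn1 site_predE.
have tt k y : E k (tcons (a - 1) y) =
    (if site a == ordS (ordS k) then tcons (a - 1 - 1) (Kt k y) else 0) + tcons (a - 1) (E k y).
  by rewrite E_cons congn1 !site_predE.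
have ttt k y : E k (tcons (a - 1 - 1) y) =
    (if site a == ordS (ordS (ordS k)) then tcons (a - 1 - 1 - 1) (Kt k y) else 0) +
    tcons (a - 1 - 1) (E k y).
  by rewrite E_cons congn1 !site_predE.
pose R := (tens_lin, st, tt, ttt, K1, K2, K3, K4, KZ, h, add0r).
have [|[ui|ui]] : site a != ordS i /\ site a != ordS j \/ (site a = ordS i \/ site a = ordS j).
- by case: eqP; case: eqP; auto.
- by case=> /negPf u1 /negPf u2; rewrite !(R, u1, u2); lmod_coefs Qv; ring.
- have u1 : (ordS i == ordS (ordS i)) = false by rewrite S'.
  have u2 : (ordS i == ordS j) = false.
    by move: ij; rewrite adjacentE => /orP[/eqP->|/eqP<-]; rewrite S'.
  have u3 : (ordS i == ordS (ordS (ordS i))) = false by rewrite S'.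
  have u4 : (ordS i == ordS (ordS (ordS j))) = false.
    by move: ij; rewrite adjacentE => /orP[/eqP->|/eqP<-]; rewrite !S'.
  rewrite !(R, ui, u1, u2, u3, u4, eqxx).
  by case: eqP => _; rewrite !(R, ui, u1, u2, u3, u4); lmod_coefs Qv; scalar_field.
have u1 : (ordS j == ordS (ordS j)) = false by rewrite S'.
have u2 : (ordS j == ordS i) = false.
  by move: ij; rewrite adjacentE => /orP[/eqP->|/eqP<-]; rewrite S'.
have u3 : (ordS j == ordS (ordS (ordS i))) = false.
  by move: ij; rewrite adjacentE => /orP[/eqP->|/eqP<-]; rewrite !S'.
rewrite !(R, ui, u1, u2, u3, eqxx).
by case: eqP => _; rewrite !(R, ui, u1, u2, u3); lmod_coefs Qv; scalar_field.
Qed.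

Lemma E_serre i j x : adjacent i j ->
  E i (E i (E j x)) + E j (E i (E i x)) = (vv + vv^-1) *: E i (E j (E i x)).
Proof.
move=> ij; suff h s : serre (fun b => if b then E i else E j) (e s).
  apply: (lin_ext (f := (E i \o E i \o E j) \+ (E j \o E i \o E i))
    (g := (vv + vv^-1) \*: (E i \o E j \o E i))) => s.
  rewrite -[LHS]/(E i (E i (E j (e s))) + E j (E i (E i (e s)))).
  by rewrite (h s : _ = _) subrK.
elim: s => [|a s IH]; last by rewrite -tcons_e; apply: E_serre_cons.
by rewrite /serre !E_nil !op0 scaler0 subrr.
Qed.

Lemma vKti_site i a k : site a = k ->
  vKti i a = if k == ordS i then vv else if k == i then vv^-1 else 1.
Proof.
move=> <-; rewrite /vKti /vKi /vK !congn1.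
by case: (eqVneq (site a) (ordS i)) => [->|_]; rewrite ?(ordS_neqs n4) ?mul1r ?mulr1.
Qed.

Lemma F_far i j x : ~~ adjacent i j -> F i (F j x) = F j (F i x).
Proof.
move=> fij; have S' := ordS_neqs n4; case: (eqVneq i j) => [->//|ij].
have [/negPf a1 /negPf a2] : j != ordS i /\ ordS j != i.
  by move: fij; rewrite adjacentE negb_or => /andP[].
have a3 : (ordS i == j) = false by rewrite eq_sym.
have a4 : (i == ordS j) = false by rewrite eq_sym.
have ji : (j == i) = false by rewrite eq_sym; exact: negPf ij.
apply: (lin_ext (f := F i \o F j) (g := F j \o F i)) => s.
rewrite -[LHS]/(F i (F j (e s))) -[RHS]/(F j (F i (e s))).
elim: s => [|a s IH]; first by rewrite !F_nil !op0.
have st k y : F k (tcons a y) =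
    vKti k a *: tcons a (F k y) + (if site a == k then tcons (a + 1) y else 0).
  by rewrite F_cons congn1.
have tt k y : F k (tcons (a + 1) y) =
    vKti k (a + 1) *: tcons (a + 1) (F k y) + (if ordS (site a) == k then tcons (a + 1 + 1) y else 0).
  by rewrite F_cons congn1 siteS.
rewrite -tcons_e; have [ui|ui] := eqVneq (site a) i.
  have c1 : vKti j (a + 1) = 1 by rewrite (vKti_site _ (siteS _ _)) ui S' (negPf ij) a3.
  have c2 : vKti j a = 1 by rewrite (vKti_site _ ui) a4 (negPf ij).
  rewrite !(tens_lin, st, tt, IH, ui, c1, c2, a3, a4, ji, negPf ij, eqxx, scale1r, addr0).
  by lmod_coefs Qv; ring.
have [uj|uj] := eqVneq (site a) j; last first.
  by rewrite !(tens_lin, st, IH, negPf ui, negPf uj, addr0); lmod_coefs Qv; ring.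
have c1 : vKti i (a + 1) = 1 by rewrite (vKti_site _ (siteS _ _)) uj S' ji a2.
have c2 : vKti i a = 1 by rewrite (vKti_site _ uj) a1 ji.
rewrite !(tens_lin, st, tt, IH, uj, c1, c2, a2, a1, ji, negPf ij, eqxx, scale1r, addr0).
by lmod_coefs Qv; ring.
Qed.

Lemma F_serre_cons i j a x : adjacent i j ->
  serre (fun b => if b then F i else F j) x -> serre (fun b => if b then F i else F j) (tcons a x).
Proof.
have S' := ordS_neqs n4.
have st k y : F k (tcons a y) =
    vKti k a *: tcons a (F k y) + (if site a == k then tcons (a + 1) y else 0).
  by rewrite F_cons congn1.
have tt k y : F k (tcons (a + 1) y) =
    vKti k (a + 1) *: tcons (a + 1) (F k y) + (if ordS (site a) == k then tcons (a + 1 + 1) y else 0).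
  by rewrite F_cons congn1 siteS.
have ttt k y : F k (tcons (a + 1 + 1) y) = vKti k (a + 1 + 1) *: tcons (a + 1 + 1) (F k y) +
    (if ordS (ordS (site a)) == k then tcons (a + 1 + 1 + 1) y else 0).
  by rewrite F_cons congn1 !siteS.
have s1 := siteS (lt3_gt0 n4) a.
have s2 : site (a + 1 + 1) = ordS (ordS (site a)) by rewrite !siteS.
rewrite /serre adjacentE => /orP[/eqP->|/eqP<-] h.
- pose R := (tens_lin, st, h, addr0).
  have [ui|u1] := eqVneq (site a) i.
    rewrite ui in s1 s2.
    have c0i : vKti i a = vv^-1 by rewrite (vKti_site _ ui) !S' ?eqxx.
    have c0j : vKti (ordS i) a = 1 by rewrite (vKti_site _ ui) !S' ?eqxx.
    have c1i : vKti i (a + 1) = vv by rewrite (vKti_site _ s1) ?eqxx.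
    have c1j : vKti (ordS i) (a + 1) = vv^-1 by rewrite (vKti_site _ s1) !S' ?eqxx.
    have c2i : vKti i (a + 1 + 1) = 1 by rewrite (vKti_site _ s2) !S' ?eqxx.
    have c2j : vKti (ordS i) (a + 1 + 1) = vv by rewrite (vKti_site _ s2) ?eqxx.
    rewrite !(R, tt, ttt, ui, c0i, c0j, c1i, c1j, c2i, c2j, S', eqxx).
    by lmod_coefs Qv; scalar_field.
  have [ui|u2] := eqVneq (site a) (ordS i); last first.
    by rewrite !(R, negPf u1, negPf u2); lmod_coefs Qv; ring.
  rewrite ui in s1 s2.
  have c0i : vKti i a = vv by rewrite (vKti_site _ ui) ?eqxx.
  have c0j : vKti (ordS i) a = vv^-1 by rewrite (vKti_site _ ui) !S' ?eqxx.
  have c1i : vKti i (a + 1) = 1 by rewrite (vKti_site _ s1) !S' ?eqxx.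
  have c1j : vKti (ordS i) (a + 1) = vv by rewrite (vKti_site _ s1) ?eqxx.
  rewrite !(R, tt, ttt, ui, c0i, c0j, c1i, c1j, S', eqxx).
  by lmod_coefs Qv; scalar_field.
pose R := (tens_lin, st, h, addr0).
have [ui|u1] := eqVneq (site a) j.
  rewrite ui in s1 s2.
  have c0j : vKti j a = vv^-1 by rewrite (vKti_site _ ui) !S' ?eqxx.
  have c0i : vKti (ordS j) a = 1 by rewrite (vKti_site _ ui) !S' ?eqxx.
  have c1j : vKti j (a + 1) = vv by rewrite (vKti_site _ s1) ?eqxx.
  have c1i : vKti (ordS j) (a + 1) = vv^-1 by rewrite (vKti_site _ s1) !S' ?eqxx.
  have c2j : vKti j (a + 1 + 1) = 1 by rewrite (vKti_site _ s2) !S' ?eqxx.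
  have c2i : vKti (ordS j) (a + 1 + 1) = vv by rewrite (vKti_site _ s2) ?eqxx.
  rewrite !(R, tt, ttt, ui, c0i, c0j, c1i, c1j, c2i, c2j, S', eqxx).
  by lmod_coefs Qv; scalar_field.
have [ui|u2] := eqVneq (site a) (ordS j); last first.
  by rewrite !(R, negPf u1, negPf u2); lmod_coefs Qv; ring.
rewrite ui in s1 s2.
have c0i : vKti (ordS j) a = vv^-1 by rewrite (vKti_site _ ui) !S' ?eqxx.
have c0j : vKti j a = vv by rewrite (vKti_site _ ui) ?eqxx.
have c1i : vKti (ordS j) (a + 1) = vv by rewrite (vKti_site _ s1) ?eqxx.
have c1j : vKti j (a + 1) = 1 by rewrite (vKti_site _ s1) !S' ?eqxx.
rewrite !(R, tt, ttt, ui, c0i, c0j, c1i, c1j, S', eqxx).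
by lmod_coefs Qv; scalar_field.
Qed.

Lemma F_serre i j x : adjacent i j ->
  F i (F i (F j x)) + F j (F i (F i x)) = (vv + vv^-1) *: F i (F j (F i x)).
Proof.
move=> ij; suff h s : serre (fun b => if b then F i else F j) (e s).
  apply: (lin_ext (f := (F i \o F i \o F j) \+ (F j \o F i \o F i))
    (g := (vv + vv^-1) \*: (F i \o F j \o F i))) => s.
  rewrite -[LHS]/(F i (F i (F j (e s))) + F j (F i (F i (e s)))).
  by rewrite (h s : _ = _) subrK.
elim: s => [|a s IH]; last by rewrite -tcons_e; apply: F_serre_cons.
by rewrite /serre !F_nil !op0 scaler0 subrr.
Qed.

End TensorRelations.

Ltac expand_faact := rewrite /faact !big_cons !big_nil /wact; cbn [foldr fst snd].

Section TensorModule.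
Variables n r : nat.
Hypothesis n4 : (3 < n)%N.
Implicit Types (i j : 'I_n) (a : int) (s : seq int).
Local Notation D := (fun k : nat => k == r).
Local Notation T := (fquot (tensor_null D)).
Local Notation e := (fgen (tensor_null D)).
Local Notation K i := (tensor_act D (GK i)).

Lemma fgen_size s : size s != r -> e s = 0.
Proof.
move=> sr; apply/cls_eq0 => t /eqP tr; rewrite /fcoef big_cons big_nil /=.
by case: eqP => // st; rewrite st tr eqxx in sr.
Qed.

(** Vanishing in all lengths means that all coefficients vanish, in particular those of length r. *)
Lemma tensor_transfer (rho : fa n) :
  (forall x, faact (tensor_act predT) rho x = 0) -> forall x, faact (tensor_act D) rho x = 0.
Proof.
move=> h x; have [p ->] := cls_surj x; rewrite clsE linear_sum big1 // => y _.
rewrite linearZ /= tensor_faact; have := h (fgen _ y.2); rewrite tensor_faact => /cls_eq0 z.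
suff -> : cls (tensor_null D) (tact rho y.2) = 0 by rewrite scaler0.
by apply/cls_eq0 => t _; apply: z.
Qed.

Lemma K_gen i s : K i (e s) = diag (vK i) s *: e s.
Proof. by rewrite [LHS](flin_gen (@tgen_null n D (GK i))) clsE big_seq1. Qed.

Lemma prod_K (l : seq 'I_n) s :
  wact (tensor_act D) [seq GK i | i <- l] (e s) = (\prod_(i <- l) diag (vK i) s) *: e s.
Proof.
elim: l => [|i l IH] /=; first by rewrite big_nil scale1r.
by rewrite IH linearZ /= K_gen scalerA big_cons mulrC.
Qed.

Lemma prod_diag s : \prod_(i <- enum 'I_n) diag (vK i) s = vv ^+ size s.
Proof.
rewrite big_enum; elim: s => [|a s IH] /=; first by rewrite big1.
rewrite big_split exprS -IH; congr (_ * _).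
rewrite (bigD1 (site (lt3_gt0 n4) a)) //= big1 => [|i ia]; last first.
  by rewrite (vKE n4) eq_sym (negPf ia).
by rewrite (vKE n4) eqxx mulr1.
Qed.

Lemma diag_count i s : diag (vK i) s = vv ^+ count (fun a => congn a i) s.
Proof.
elim: s => //= a s ->; rewrite /vK; case: congn => /=; last by rewrite mul1r add0n.
by rewrite add1n exprS.
Qed.

Lemma tensor_rel (rho : fa n) : relator r rho -> forall x : T, faact (tensor_act D) rho x = 0.
Proof.
case.
- move=> i j; apply: tensor_transfer => x; expand_faact.
  by rewrite scale1r scaleN1r addr0; apply/eqP; rewrite subr_eq0; apply/eqP; exact: KK.
- move=> i; apply: tensor_transfer => x; expand_faact.
  by rewrite scale1r scaleN1r addr0; apply/eqP; rewrite subr_eq0; apply/eqP; exact: KKi.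
- move=> i; apply: tensor_transfer => x; expand_faact.
  by rewrite scale1r scaleN1r addr0; apply/eqP; rewrite subr_eq0; apply/eqP; exact: KiK.
- move=> i j; apply: tensor_transfer => x; expand_faact.
  by rewrite scale1r scaleNr addr0 (K_E n4) subrr.
- move=> i j; apply: tensor_transfer => x; expand_faact.
  by rewrite scale1r scaleNr addr0 (K_F n4) subrr.
- move=> i j; apply: tensor_transfer => x; rewrite faact_cat.
  have := E_F n4 i j x; case: eqP => [<-|_] h; expand_faact; last first.
    by rewrite !addr0 scale1r scaleN1r.
  rewrite scale1r scaleN1r !addr0 h scaleNr scalerBr; set c := _^-1.
  by rewrite [X in _ + X]addrC -[X in _ + X]opprB; apply/eqP; rewrite subr_eq0.
- move=> i j ij; apply: tensor_transfer => x; expand_faact.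
  by rewrite scale1r scaleN1r addr0 (E_far n4 x ij) subrr.
- move=> i j ij; apply: tensor_transfer => x; expand_faact.
  by rewrite scale1r scaleN1r addr0 (F_far n4 x ij) subrr.
- move=> i j ij; apply: tensor_transfer => x; expand_faact.
  by rewrite scaleNr -(E_serre n4 x ij) !scale1r addr0 addrC -addrA [X in _ + X]addrC addNr.
- move=> i j ij; apply: tensor_transfer => x; expand_faact.
  by rewrite scaleNr -(F_serre n4 x ij) !scale1r addr0 addrC -addrA [X in _ + X]addrC addNr.
(* (Q15), and (Q16) after it, involve r and are checked directly in length r: K_i multiplies a basis
   vector by v to the number of its entries congruent to i, which lies between 0 and r. *)
- move=> x; have [p ->] := cls_surj x; rewrite clsE linear_sum big1 // => y _.
  rewrite linearZ /=; case: (eqVneq (size y.2) r) => [sr|/fgen_size->]; last first.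
    by rewrite !linear0.
  rewrite /faact !big_cons big_nil prod_K prod_diag sr /= addr0 scale1r scaleNr subrr.
  by rewrite scaler0.
move=> i x; have [p ->] := cls_surj x; rewrite clsE linear_sum big1 // => y _.
rewrite linearZ /=; case: (eqVneq (size y.2) r) => [sr|/fgen_size->]; last first.
  by rewrite !linear0.
have h l : faact (tensor_act D)
      (fa_prod [seq [:: (1, [:: GK i]); (- vv ^+ m, [::])] | m <- l]) (e y.2)
    = \prod_(m <- l) (diag (vK i) y.2 - vv ^+ m) *: e y.2.
  elim: l => [|m l IH] /=; first by rewrite big_nil /fa_one faact_word scale1r.
  rewrite faact_mul IH linearZ /= big_cons /faact !big_cons big_nil /= K_gen addr0 scale1r -scalerDl.
  by rewrite scalerA mulrC.
rewrite (h (iota 0 r.+1)) diag_count; set c := count _ _.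
have cr : (c <= r)%N by rewrite -sr count_size.
have cm : c \in iota 0 r.+1 by rewrite mem_iota add0n ltnS cr.
by rewrite (bigD1_seq c cm (iota_uniq _ _)) /= subrr mul0r scale0r scaler0.
Qed.

Definition tensor_module : schur_module n r := SchurModule tensor_rel.

End TensorModule.

(** * Exchanges permute the basis vectors with distinct residues *)

Section Monomials.
Variables n r : nat.
Hypothesis n4 : (3 < n)%N.
Implicit Types (i j : 'I_n) (a : int) (s : seq int) (k l : 'I_r).
Local Notation state := {ffun 'I_r -> int}.
Local Notation T := (tensor_module r n4).
Local Notation site := (site (lt3_gt0 n4)).
Implicit Types t u : state.

Lemma diagE (f : int -> Qv) s : diag f s = \prod_(a <- s) f a.
Proof. by elim: s => [|a s IH]; rewrite ?big_nil // big_cons -IH. Qed.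

Lemma tE_sum (V : lmodType Qv) i s (f : seq int -> V) :
  \sum_(y <- tE i s) y.1 *: f y.2 =
  \sum_(0 <= m < size s | site s`_m == ordS i)
     diag (vKt i) (drop m.+1 s) *: f (set_nth 0 s m (s`_m - 1)).
Proof.
elim: s f => [|a s IH] f /=; first by rewrite big_nil big_geq.
rewrite big_cat big_map /= [RHS]big_mkcond big_nat_recl //= drop0 big_map /=.
congr (_ + _).
  by rewrite /vE (congn1 n4) (site_predE n4); case: eqP => _; rewrite ?big_nil ?big_seq1 ?mul1r.
by rewrite (IH (fun s => f (a :: s))) big_mkcond.
Qed.

Lemma tF_sum (V : lmodType Qv) i s (f : seq int -> V) :
  \sum_(y <- tF i s) y.1 *: f y.2 =
  \sum_(0 <= m < size s | site s`_m == i)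
     diag (vKti i) (take m s) *: f (set_nth 0 s m (s`_m + 1)).
Proof.
elim: s f => [|a s IH] f /=; first by rewrite big_nil big_geq.
rewrite big_cat big_map /= [RHS]big_mkcond big_nat_recl //= big_map /= addrC.
congr (_ + _).
  by rewrite /vF (congn1 n4); case: eqP => _; rewrite ?big_nil ?big_seq1.
under eq_bigr do rewrite -scalerA.
rewrite -scaler_sumr (IH (fun s => f (a :: s))) big_mkcond scaler_sumr; apply: eq_bigr => m _.
by case: eqP => _; rewrite ?scaler0 ?scalerA.
Qed.

Definition entries t := [seq t k | k <- enum 'I_r].
Definition ev t : T := fgen (tensor_null (fun m => m == r)) (entries t).
Definition put t k a : state := [ffun l => if l == k then a else t l].

Lemma size_entries t : size (entries t) = r.
Proof. by rewrite size_map size_enum_ord. Qed.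

Lemma nth_entries t k : (entries t)`_k = t k.
Proof. by rewrite (nth_map k) ?size_enum_ord // nth_ord_enum. Qed.

Lemma set_entries t k a : set_nth 0 (entries t) k a = entries (put t k a).
Proof.
apply: (@eq_from_nth _ 0).
  by rewrite size_set_nth !size_entries; apply/maxn_idPr; exact: ltn_ord.
move=> m; rewrite size_set_nth size_entries (maxn_idPr (ltn_ord k)) => mr.
rewrite nth_set_nth /= (nth_entries (put t k a) (Ordinal mr)) ffunE -val_eqE /=.
by case: eqP => // _; rewrite (nth_entries _ (Ordinal mr)).
Qed.

Lemma diag_drop (f : int -> Qv) t k :
  diag f (drop k.+1 (entries t)) = \prod_(l : 'I_r | (k < l)%N) f (t l).
Proof.
rewrite diagE (big_nth 0) size_drop size_entries big_mkord.
rewrite -(big_mkord xpredT (fun m => f (drop k.+1 (entries t))`_m)).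
rewrite (eq_bigr (fun m => f (entries t)`_(m + k.+1))); last by move=> m _; rewrite nth_drop addnC.
rewrite -(big_addn 0 r k.+1 xpredT (fun m => f (entries t)`_m)) add0n.
rewrite (big_nat_widenl k.+1 0%N) // big_mkord.
by apply: eq_bigr => l _; rewrite nth_entries.
Qed.

Lemma diag_take (f : int -> Qv) t k :
  diag f (take k (entries t)) = \prod_(l : 'I_r | (l < k)%N) f (t l).
Proof.
have kr : (k <= r)%N by apply/ltnW/ltn_ord.
rewrite diagE (big_nth 0) size_take size_entries ltn_ord.
rewrite (big_nat_widen _ _ _ _ _ kr) big_mkord; apply: eq_big => // l /andP[_ lk].
by rewrite nth_take // nth_entries.
Qed.

Lemma E_ev i t : X T true i (ev t) =
  \sum_(k : 'I_r | site (t k) == ordS i)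
    (\prod_(l : 'I_r | (k < l)%N) vKt i (t l)) *: ev (put t k (t k - 1)).
Proof.
rewrite [LHS](flin_gen (@tgen_null n (fun m => m == r) (GE i))) clsE tE_sum size_entries big_mkord.
by apply: eq_big => k; rewrite nth_entries // set_entries diag_drop.
Qed.

Lemma F_ev i t : X T false i (ev t) =
  \sum_(k : 'I_r | site (t k) == i)
    (\prod_(l : 'I_r | (l < k)%N) vKti i (t l)) *: ev (put t k (t k + 1)).
Proof.
rewrite [LHS](flin_gen (@tgen_null n (fun m => m == r) (GF i))) clsE tF_sum size_entries big_mkord.
by apply: eq_big => k; rewrite nth_entries // set_entries diag_take.
Qed.

Lemma prod_two (Q : pred 'I_r) (f : 'I_r -> Qv) k l : k != l ->
  (forall m, m != k -> m != l -> f m = 1) ->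
  \prod_(m | Q m) f m = (if Q k then f k else 1) * (if Q l then f l else 1).
Proof.
move=> kl h; rewrite big_mkcond (bigD1 k) //= (bigD1 l) //= 1?eq_sym //.
by rewrite big1 ?mulr1 // => m /andP[mk ml]; rewrite h // if_same.
Qed.

Lemma prod_one (Q : pred 'I_r) (f : 'I_r -> Qv) k :
  (forall m, m != k -> f m = 1) -> \prod_(m | Q m) f m = if Q k then f k else 1.
Proof.
by move=> h; rewrite big_mkcond (bigD1 k) //= big1 ?mulr1 // => m mk; rewrite h // if_same.
Qed.

(** This is where the choice in [exch] comes from: F E sends the basis vector to the exchanged one
    plus v^-1 or v times itself, according to which of the two particles is the left tensor
    factor. *)
Lemma move_ev i t : (r < n)%N -> strict n4 t -> move n4 t i (ev t) = ev (step n4 i t).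
Proof.
move=> rn s; have S' := ordS_neqs n4.
have vt a : site a != i -> site a != ordS i -> vKt i a = 1 /\ vKti i a = 1.
  by move=> /negPf h1 /negPf h2; rewrite (vKtE n4) (vKtiE n4) h1 h2 subrr expr0z.
have o j k : occ n4 t j = Some k -> site (t k) = j by move/eqP; rewrite occP // => /eqP.
have o' j k : occ n4 t j = Some k -> forall m, m != k -> site (t m) != j.
  by move=> h m mk; apply: contraNneq mk => e; apply/eqP/s; rewrite e (o _ _ h).
have oN j : occ n4 t j = None -> forall m, site (t m) != j.
  by rewrite /occ; case: pickP => // h _ m; rewrite h.
rewrite /move; case e1: (occ n4 t i) => [k|]; case e2: (occ n4 t (ordS i)) => [l|] /=.
- have ek := o _ _ e1; have el := o _ _ e2.
  have kl : k != l by apply/eqP => e; move: el; rewrite -e ek => /eqP; rewrite S'.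
  have t1 m : m != k -> m != l -> vKt i (t m) = 1 /\ vKti i (t m) = 1.
    by move=> mk ml; apply: vt; [exact: o' e1 m mk|exact: o' e2 m ml].
  pose u := put t l (t l - 1).
  have ul : u l = t l - 1 by rewrite ffunE eqxx.
  have uD m : m != l -> u m = t m by move=> ml; rewrite ffunE (negPf ml).
  have sul : site (u l) = i by rewrite ul siteB el ordSK.
  have suk : site (u k) = i by rewrite uD.
  have eE : X T true i (ev t) = (if (l < k)%N then vv else 1) *: ev u.
    rewrite E_ev big_mkcond occ_sum // e2 /= (prod_two _ kl) => [|m mk ml]; last first.
      by case: (t1 m mk ml).
    by rewrite ltnn mulr1 (vKtE n4) ek eqxx S' expr1z.
  have eF : X T false i (ev u) = (if (l < k)%N then vv^-1 else 1) *: ev (step n4 i t) +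
      (if (k < l)%N then vv^-1 else 1) *: ev t.
    have v1 m : m != k -> m != l -> vKti i (u m) = 1.
      by move=> mk ml; rewrite uD //; case: (t1 m mk ml).
    have vi a : site a = i -> vKti i a = vv^-1.
      by move=> e; rewrite (vKtiE n4) e eqxx S' sub0r exprN1.
    rewrite F_ev (bigD1 k) /=; last by rewrite suk.
    rewrite [X in _ + X](bigD1 l) /=; last by rewrite sul eqxx eq_sym kl.
    rewrite [X in _ + (_ + X)]big1 ?addr0 => [|m /andP[/andP[/eqP sm mk] ml]]; last first.
      by have := o' _ _ e1 m mk; rewrite -uD // sm eqxx.
    rewrite !(prod_two _ kl) // !vi // !ltnn mul1r mulr1.
    congr (_ *: ev _ + _ *: ev _); apply/ffunP => m; rewrite !ffunE.
      have [->|mk] := eqVneq m k; first by rewrite (negPf kl) ek eqxx.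
      have [->|ml] := eqVneq m l; first by rewrite el eqxx S'.
      by rewrite (negPf (o' _ _ e1 m mk)) (negPf (o' _ _ e2 m ml)).
    by have [->|ml] := eqVneq m l; rewrite ?eqxx ?subrK.
  rewrite /swap' /swap eE XZ eF; move: kl.
  case: (ltngtP k l) => [kl|kl|/val_inj->]; last by rewrite eqxx.
  - by rewrite !scale1r addrK.
  - by move=> _; lmod_coefs Qv; scalar_field.
- rewrite F_ev big_mkcond occ_sum // e1 /=.
  rewrite (prod_one _ (k := k)) => [|m mk]; last first.
    by case: (vt (t m) (o' _ _ e1 m mk) (oN _ e2 m)).
  rewrite ltnn scale1r; congr ev; apply/ffunP => m; rewrite !ffunE.
  have [->|mk] := eqVneq m k; first by rewrite (o _ _ e1) eqxx.
  by rewrite (negPf (o' _ _ e1 m mk)) (negPf (oN _ e2 m)).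
- rewrite E_ev big_mkcond occ_sum // e2 /=.
  rewrite (prod_one _ (k := l)) => [|m mk]; last first.
    by case: (vt (t m) (oN _ e1 m) (o' _ _ e2 m mk)).
  rewrite ltnn scale1r; congr ev; apply/ffunP => m; rewrite !ffunE.
  have [->|mk] := eqVneq m l; first by rewrite (o _ _ e2) eqxx S'.
  by rewrite (negPf (o' _ _ e2 m mk)) (negPf (oN _ e1 m)).
by rewrite step_none.
Qed.

End Monomials.

(** * The graph inside the product with the tensor module *)

Section ProductModule.
Variables (n r : nat) (P Q : schur_module n r).

Definition prod_op (g : gen n) (x : P * Q) : P * Q := (gact P g x.1, gact Q g x.2).
Lemma prod_op_linear g : linear (prod_op g).
Proof. by move=> c x y; rewrite /prod_op /= !linearP. Qed.
HB.instance Definition _ g := GRing.isLinear.Build _ _ _ _ (prod_op g) (prod_op_linear g).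
Definition prod_act (g : gen n) : {linear (P * Q)%type -> (P * Q)%type} := prod_op g.

Lemma prod_wact w x : wact prod_act w x = (wact (gact P) w x.1, wact (gact Q) w x.2).
Proof. by elim: w => [|g w IH]; [case: x|rewrite /= IH]. Qed.

Lemma prod_faact p x : faact prod_act p x = (faact (gact P) p x.1, faact (gact Q) p x.2).
Proof.
rewrite /faact; elim: p => [|y p IH]; first by rewrite !big_nil.
by rewrite !big_cons IH prod_wact.
Qed.

Lemma prod_rel (rho : fa n) : relator r rho -> forall x, faact prod_act rho x = 0.
Proof. by move=> h x; rewrite prod_faact !gactP. Qed.

Definition product_module : schur_module n r := SchurModule prod_rel.

End ProductModule.

Section StrictSpan.
Variables (n r : nat) (P : schur_module n r).
Hypothesis (n4 : (3 < n)%N) (rn : (r < n)%N).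
Local Notation state := {ffun 'I_r -> int}.
Local Notation T := (tensor_module r n4).
Local Notation Q := (product_module T P).
Local Notation strict := (strict n4).
Local Notation step := (step n4).
Local Notation occ := (occ n4).
Local Notation swt := (swt n4).
Local Notation site := (site (lt3_gt0 n4)).
Implicit Types (t : state) (lam : 'I_n -> int) (i : 'I_n) (b : bool).

Lemma strict_home : strict (home r).
Proof.
move=> k l; rewrite !ffunE => /eqP; rewrite eq_site !modz_nat eqz_nat.
have := ltn_ord k; have := ltn_ord l => lr kr.
by rewrite !modn_small => [/eqP/val_inj//| |]; lia.
Qed.

Lemma wt_ev t : strict t -> wt (swt t) (ev n4 t).
Proof.
move=> s i; rewrite [LHS](K_gen _ i) diagE big_map big_enum /=; congr (_ *: _).
rewrite /swt /occ_wt; case e: (occ t i) => [k|] /=.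
  have ek : site (t k) = i by move/eqP: e; rewrite occP // => /eqP.
  rewrite (prod_one _ (k := k)) => [|m mk]; first by rewrite (vKE n4) ek eqxx.
  by rewrite (vKE n4); case: eqP => // em; case/eqP: mk; apply: s; rewrite em.
rewrite big1 ?expr0z // => k _; rewrite (vKE n4).
by move: e; rewrite /occ; case: pickP => // /(_ k) /= ->.
Qed.

Lemma swt_step t b i : strict t -> swt t (tgt b i) = 0 -> swt t (src b i) = 1 ->
  swt (step i t) =1 shift (swt t) b i.
Proof.
move=> s; rewrite /swt /shift /occ_wt => h0 h1 j; rewrite occ_step //.
case: tpermP => [->|->|/eqP/negPf ji /eqP/negPf jSi].
- by case: b h0 h1; cbn [src tgt]; rewrite eqxx (ordS_neqs n4); do 2!case: (occ t _).
- by case: b h0 h1; cbn [src tgt]; rewrite eqxx (ordS_neqs n4); do 2!case: (occ t _).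
by case: (b) => /=; rewrite ji jSi addr0 subr0.
Qed.

Lemma swt_step_full t i : strict t -> swt t i = 1 -> swt t (ordS i) = 1 -> swt (step i t) =1 swt t.
Proof.
move=> s; rewrite /swt /occ_wt => h0 h1 j; rewrite occ_step //.
by case: tpermP => [->|->|_ _] //; rewrite ?h0 ?h1.
Qed.

Variable m : P.
Hypothesis wm : wt (swt (home r)) m.
Local Notation m0 := ((ev n4 (home r), m) : Q).

Lemma wt_m0 : wt (swt (home r)) m0.
Proof.
by move=> i; rewrite [LHS]/(prod_op _ _) /prod_op /= (wt_ev strict_home i) wm.
Qed.

Definition graph_vec t : Q := strict_vec n4 m0 t.

Lemma fst_X b i (x : Q) : (X Q b i x).1 = X T b i x.1.
Proof. by []. Qed.

Lemma fst_move t i (x : Q) : (move n4 t i x).1 = move n4 t i x.1.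
Proof.
rewrite /move; case: (occ t i) (occ t (ordS i)) => [k|] [l|] //=.
by case: ifP.
Qed.

(** The construction of [strict_vec] is compatible with projection to the tensor space, where
    [move_ev] evaluates it. *)
Lemma fst_graph_vec t : strict t -> (graph_vec t).1 = ev n4 t.
Proof.
have [N] := ubnP (energy t); elim: N t => // N IH t; rewrite ltnS => tN s.
case: (pickP (fun i => (energy (step i t) < energy t)%N)) => [i ti|h].
  have si := strict_step (i := i) s.
  rewrite -{1}(stepK n4 i t) /graph_vec strict_vec_step //; last exact: wt_m0.
  rewrite fst_move -/(graph_vec _) IH //; last exact: leq_trans ti tN.
  by rewrite move_ev // stepK.
have -> : t = home r by apply: (@home_of_minimal _ _ n4 rn t s) => i; rewrite leqNgt h.
by rewrite /graph_vec strict_vec_home.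
Qed.

Definition strict_span lam (x : Q) := exists l : seq (Qv * state),
  (forall y, y \in l -> strict y.2 /\ swt y.2 =1 lam) /\ x = \sum_(y <- l) y.1 *: graph_vec y.2.

Lemma strict_span_ext lam lam' x : lam =1 lam' -> strict_span lam x -> strict_span lam' x.
Proof.
by move=> e [l [h ->]]; exists l; split=> // y /h[s el]; split=> // i; rewrite el.
Qed.

Lemma strict_span0 lam : strict_span lam 0.
Proof. by exists [::]; rewrite big_nil. Qed.

Lemma strict_spanD lam x y : strict_span lam x -> strict_span lam y -> strict_span lam (x + y).
Proof.
move=> [l [h ->]] [l' [h' ->]]; exists (l ++ l'); rewrite big_cat; split=> // z.
by rewrite mem_cat => /orP[/h|/h'].
Qed.

Lemma strict_spanZ lam c x : strict_span lam x -> strict_span lam (c *: x).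
Proof.
move=> [l [h ->]]; exists [seq (c * y.1, y.2) | y <- l]; split=> [z /mapP[y /h hy ->] //|].
by rewrite big_map scaler_sumr; apply: eq_bigr => y _; rewrite scalerA.
Qed.

Lemma strict_span_gen lam t : strict t -> swt t =1 lam -> strict_span lam (graph_vec t).
Proof.
move=> s e; exists [:: (1, t)]; rewrite big_seq1 scale1r; split=> // y.
by rewrite inE => /eqP->.
Qed.

Lemma strict_span_sum lam (l : seq (Qv * state)) (f : state -> Q) :
  (forall y, y \in l -> strict_span lam (f y.2)) -> strict_span lam (\sum_(y <- l) y.1 *: f y.2).
Proof.
move=> h; rewrite big_seq; elim/big_ind: _ => [|x y|y yl];
  [exact: strict_span0|exact: strict_spanD|].
by apply/strict_spanZ/h.
Qed.

Lemma wt_strict_span lam x : strict_span lam x -> wt lam x.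
Proof.
move=> [l [h ->]]; rewrite big_seq; apply: wt_sum => y /h[s e].
by apply: wtZ; apply: wt_ext e _; apply: wt_strict_vec => //; exact: wt_m0.
Qed.

Lemma strict_spanX lam b i x : strict_span lam x -> lam (tgt b i) = 0 -> lam (src b i) = 1 ->
  strict_span (shift lam b i) (X Q b i x).
Proof.
move=> [l [h ->]] h0 h1.
rewrite linear_sum (eq_bigr (fun y => y.1 *: X Q b i (graph_vec y.2))); last first.
  by move=> y _; rewrite linearZ.
apply: (strict_span_sum (f := fun t => X Q b i (graph_vec t))) => -[c t] /h /= [s e].
have -> : X Q b i (graph_vec t) = graph_vec (step i t).
  rewrite /graph_vec strict_vec_step //; last exact: wt_m0.
  move: (e (tgt b i)) (e (src b i)); rewrite h0 h1 /swt /occ_wt /move.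
  by case: (b) => /=; case: (occ t i) => [k|]; case: (occ t (ordS i)) => [k'|].
apply: strict_span_gen; first exact: strict_step.
by move=> j; rewrite (swt_step (b := b)) ?e // /shift e.
Qed.

Lemma strict_spanFE lam i x : strict_span lam x -> lam i = 1 -> lam (ordS i) = 1 ->
  strict_span lam (X Q false i (X Q true i x)).
Proof.
move=> [l [h ->]] h0 h1.
rewrite !linear_sum (eq_bigr (fun y => y.1 *: X Q false i (X Q true i (graph_vec y.2)))); last first.
  by move=> y _; rewrite !linearZ.
apply: (strict_span_sum (f := fun t => X Q false i (X Q true i (graph_vec t))))
  => -[c t] /h /= [s e].
have [d ->] : exists d,
    X Q false i (X Q true i (graph_vec t)) = graph_vec (step i t) + d *: graph_vec t.
  rewrite /graph_vec strict_vec_step //; last exact: wt_m0.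
  move: (e i) (e (ordS i)); rewrite h0 h1 /swt /occ_wt /move.
  case: (occ t i) => [k|] //; case: (occ t (ordS i)) => [k'|] // _ _ /=.
  (* [swap] is F E - v^-1 and [swap'] is F E - v. *)
  case: ifP => _; [exists vv^-1|exists vv]; rewrite /swap' /swap.
    by rewrite subrK.
  by rewrite scalerBl opprB addrA !subrK.
apply: strict_spanD; last by apply: strict_spanZ; exact: strict_span_gen.
apply: strict_span_gen; first exact: strict_step.
by move=> j; rewrite swt_step_full ?e.
Qed.

Lemma entries_inj : injective (@entries r).
Proof. by move=> t u e; apply/ffunP => k; rewrite -!nth_entries e. Qed.

(** The first coordinates are basis vectors, distinct for distinct states, so a vanishing first
    coordinate forces every total coefficient to vanish. *)
Lemma strict_span_graph lam x : strict_span lam x -> x.1 = 0 -> x = 0.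
Proof.
move=> [l [h ->]]; set s := \sum_(y <- l) _ => s0.
have fs : s.1 = cls (tensor_null (fun k => k == r)) [seq (y.1, entries y.2) | y <- l].
  rewrite clsE big_map /= /s; elim: l h {s s0} => [|y l IH] h; first by rewrite !big_nil.
  rewrite !big_cons -IH => [|z zl]; last by apply: h; rewrite inE zl orbT.
  have [sy _] := h y (mem_head _ _).
  by rewrite -[fgen _ _]/(ev n4 y.2) -(fst_graph_vec sy).
rewrite fs in s0; apply: (sum_coef_eq0 graph_vec) => t.
have := (cls_eq0 _ _).1 s0 (entries t); rewrite size_entries => /(_ (eqxx _)).
rewrite /fcoef big_map; apply: etrans.
by apply: eq_bigl => y /=; rewrite (inj_eq entries_inj).
Qed.

End StrictSpan.

(** A vector killed by a product of K - v^j with distinct j is a sum of eigenvectors; the form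
    chosen here avoids naming them and works inside the stable subspace [S]. *)
Lemma diagonalize (V W : lmodType Qv) (K : {linear V -> V}) (f : {linear V -> W}) (S : V -> Prop)
    (js : seq nat) :
  (forall c x y, S x -> S y -> S (c *: x + y)) -> (forall x, S x -> S (K x)) ->
  (forall (j : nat) x, S x -> K x = vv ^+ j *: x -> f x = 0) -> uniq js ->
  forall x, S x -> foldr (fun j y => K y - vv ^+ j *: y) x js = 0 -> f x = 0.
Proof.
move=> SZD SK Sf; pose T j y := K y - vv ^+ j *: y.
have TZD j c x y : T j (c *: x + y) = c *: T j x + T j y.
  by rewrite /T linearD linearZ /= scalerDr !scalerA; lmod_coefs Qv; ring.
have ST j x : S x -> S (T j x).
  by move=> Sx; rewrite /T addrC -scaleNr; apply: SZD => //; exact: SK.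
have TC j l y : T j (T l y) = T l (T j y).
  by rewrite /T -!scaleNr !linearD !linearZ /= !scalerA addrACA mulrC.
elim: js => [|j js IH] /=; first by move=> _ x _ ->; rewrite linear0.
move=> /andP[jjs ujs] x Sx; rewrite -/(T _ _).
set y := foldr _ x js => Ty.
have Sy : S y by rewrite /y; elim: (js) => //= l ls; exact: ST.
have Ky : K y = vv ^+ j *: y by apply/eqP; rewrite -subr_eq0; apply/eqP.
have foldZD c u w ls : foldr (fun j y => T j y) (c *: u + w) ls =
    c *: foldr (fun j y => T j y) u ls + foldr (fun j y => T j y) w ls.
  by elim: ls => //= l ls ->.
(* On the eigenvector y the remaining factors act by the product of the v^j - v^l, which is nonzero;
   hence x - c^-1 y is killed by the shorter product. *)
have [c c0 yc] : exists2 c, c != 0 & foldr (fun j y => T j y) y js = c *: y.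
  elim: (js) jjs => [|l ls IHl]; first by exists 1; rewrite ?oner_neq0 ?scale1r.
  rewrite inE negb_or => /andP[jl /IHl[c c0 e]].
  exists (c * (vv ^+ j - vv ^+ l)).
    apply: mulf_neq0; first exact: c0.
    rewrite subr_eq0; apply: contra jl => /eqP h.
    by rewrite -eqz_nat; apply/eqP/vv_expz_inj.
  by rewrite /= e /T linearZ /= Ky !scalerA -scalerBl; congr (_ *: _); ring.
have fy : f y = 0 by apply: Sf Ky.
have := IH ujs (- c^-1 *: y + x) (SZD _ _ _ Sy Sx).
rewrite [foldr _ _ _](foldZD _ _ _ js) yc -/y scalerA mulNr mulVf // scaleN1r addNr => /(_ erefl).
by rewrite linearD linearZ /= fy scaler0 add0r.
Qed.

(** Applying K_i - v^(mu i), with i a site where two weights differ, removes the term of [mu] and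
    rescales that of [lam] by a nonzero scalar. *)
Lemma wt_independent n r (P : schur_module n r) (s : seq {ffun 'I_n -> int})
    (f : {ffun 'I_n -> int} -> P) :
  uniq s -> (forall lam : {ffun 'I_n -> int}, wt lam (f lam)) -> \sum_(lam <- s) f lam = 0 ->
  forall lam, lam \in s -> f lam = 0.
Proof.
elim: s f => // mu s IH f /= /andP[mus us] wf; rewrite big_cons => e.
have h lam : lam \in s -> f lam = 0.
  move=> ls; have ml : lam != mu by apply: contraNneq mus => <-.
  have [i li] : exists i, lam i != mu i.
    apply/existsP; apply: contraNT ml; rewrite negb_exists => /forallP h.
    by apply/eqP/ffunP => i; apply/eqP; have := h i; rewrite negbK.
  have wf' (nu : {ffun 'I_n -> int}) : wt nu ((vv ^ nu i - vv ^ mu i) *: f nu) by exact: wtZ.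
  have e' : \sum_(nu <- s) (vv ^ nu i - vv ^ mu i) *: f nu = 0.
    have := congr1 (fun x => gact P (GK i) x - vv ^ mu i *: x) e.
    rewrite linear0 scaler0 subrr linearD wf scalerDr linear_sum scaler_sumr opprD addrACA subrr add0r.
    move=> z; rewrite -[RHS]z -sumrB; apply: eq_bigr => nu _.
    by rewrite [gact P _ _](wf nu i) scalerBl.
  move/eqP: (IH _ us wf' e' lam ls).
  rewrite scaler_eq0 subr_eq0 => /orP[/eqP/vv_expz_inj/eqP|/eqP //].
  by rewrite (negPf li).
move=> lam; rewrite inE => /orP[/eqP->|]; last exact: h.
by rewrite big1_seq ?addr0 in e => // nu /andP[_ /h].
Qed.

(** * An element killing the tensor space kills every module *)

Section Faithful.
Variables (n r : nat) (P : schur_module n r).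
Hypothesis (n4 : (3 < n)%N) (rn : (r < n)%N) (r0 : (0 < r)%N).
Local Notation T := (tensor_module r n4).
Local Notation omega := (swt n4 (home r)).
Implicit Types (lam : 'I_n -> int) (p : fa n).

Lemma omega01 i : 0 <= omega i <= 1.
Proof. by rewrite /swt /occ_wt; case: occ. Qed.

Lemma omega_total : \sum_i omega i = r%:Z.
Proof.
have s := strict_home (n4 := n4) rn.
rewrite (eq_bigr (fun i => \sum_(k < r) if site (lt3_gt0 n4) (home r k) == i then 1 else 0 : int)).
  rewrite exchange_big /= -[r in RHS]card_ord -sum1_card -natz natr_sum; apply: eq_bigr => k _.
  rewrite (bigD1 (site (lt3_gt0 n4) (home r k))) //= eqxx big1 ?addr0 //.
  by move=> i /negPf ik; rewrite eq_sym ik.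
by move=> i _; rewrite occ_sum // /swt /occ_wt; case: occ.
Qed.

Section OneVector.
Variable m : P.
Hypothesis wm : wt omega m.
Local Notation Q := (product_module T P).
Local Notation m0 := ((ev n4 (home r), m) : Q).
Local Notation spanm := (strict_span (n4 := n4) m).
Local Notation transp := (transported omega (P := Q) spanm).

Lemma transp_X lam b i (x : Q) : composition r lam -> transp lam x -> 1 <= lam (src b i) ->
  transp (shift lam b i) (X Q b i x).
Proof.
apply: (transported_closed n4 rn r0 omega01 omega_total).
- by move=> l l' y; exact: strict_span_ext.
- by move=> l c y; exact: strict_spanZ.
- by move=> l y; exact: wt_strict_span.
- by move=> l c j y; exact: strict_spanX.
- by move=> l j y; exact: strict_spanFE.
Qed.

Lemma transp_wt lam (x : Q) : transp lam x -> wt lam x.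
Proof. by apply: (wt_transported n4 rn r0 omega01 omega_total) => l y; exact: wt_strict_span. Qed.

(** A word keeps the generating vector inside one weight piece of the graph; a move from an empty
    site gives 0, which lies in every piece. *)
Lemma transp_word (u : word n) : exists lam, composition r lam /\ transp lam (wact (gact Q) u m0).
Proof.
elim: u => [|g u [lam [cl tr]]] /=.
  exists omega; split; first by split; [move=> i; case/andP: (omega01 i)|exact: omega_total].
  pose h : {ffun 'I_n -> int} := [ffun=> 0]; have h0 i : h i = 0 by rewrite ffunE.
  have <- : transport omega h m0 + 0 = m0.
    by rewrite addr0; apply: (transport0 n4 rn r0 omega_total).
  apply: transportedD; last exact: transported0.
  - by move=> i; rewrite (hwt0 n4 rn r0 omega_total h0); case/andP: (omega01 i).
  - exact: (hwt0 n4 rn r0 omega_total h0).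
  rewrite -(strict_vec_home n4 m0); apply: strict_span_gen => //; exact: (strict_home (n4 := n4) rn).
have XX b i : exists lam', composition r lam' /\ transp lam' (X Q b i (wact (gact Q) u m0)).
  have [l1|l0] := lerP 1 (lam (src b i)).
    exists (shift lam b i); split; first exact: composition_shift.
    exact: transp_X.
  exists lam; split=> //; rewrite (X_eq0 n4 (transp_wt tr)); last by lia.
  exact: transported0.
have w := transp_wt tr.
case: g => i; first exact: (XX true); first exact: (XX false).
  exists lam; split=> //; rewrite w; apply: transported_scale => // l c y; exact: strict_spanZ.
exists lam; split=> //; rewrite (actKi_wt _ w).
by apply: transported_scale => // l c y; exact: strict_spanZ.
Qed.

(** Descent along heights to weight [omega]: a homeward move is undone by X (~~ b) i, and X b i
    recovers x up to the nonzero scalar [lam (tgt b i)]. *)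
Lemma transp_graph lam (x : Q) : composition r lam -> transp lam x -> x.1 = 0 -> x = 0.
Proof.
move=> cl; have [h ah e] := exists_height n4 rn r0 omega_total cl.
elim/(height_ind n4 rn r0 omega01 omega_total): h / ah lam x cl e
    => [h h0|h b i ah hw IH] lam x cl e tr x0.
  have el : lam =1 omega by move=> j; rewrite -e (hwt0 n4 rn r0 omega_total h0).
  apply: (strict_span_graph rn wm) x0; apply: (transported_omega n4 rn r0 omega01 omega_total).
  - by move=> l l' y; exact: strict_span_ext.
  - by move=> l; exact: strict_span0.
  - by move=> l y z; exact: strict_spanD.
  - by move=> l c j y; exact: strict_spanX.
  exact: transported_ext tr.
have /and3P[_ /eqP z o] := hw; rewrite !e in z o.
have eS : src (~~ b) i = tgt b i by case: (b).
have eT : tgt (~~ b) i = src b i by case: (b).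
have x'0 : X Q (~~ b) i x = 0.
  apply: (IH (shift lam (~~ b) i)).
  - by apply: composition_shift; rewrite ?eS.
  - by move=> j; rewrite (hwt_upd n4 rn r0 omega_total) /shift e.
  - by apply: transp_X; rewrite ?eS.
  by rewrite fst_X x0 linear0.
have := XX_inv n4 (b := ~~ b) (i := i) (transp_wt tr); rewrite eT x'0 linear0 => /(_ z)/esym/eqP.
by rewrite scaler_eq0 qint_eq0 eS => /orP[/eqP lt|/eqP //]; move: o; rewrite lt.
Qed.

(** Write p m0 as a sum over weights. Its first coordinate is zero, so by independence of weights
    each piece has zero first coordinate, and then each piece vanishes by the graph property. *)
Lemma omega_faact p : (forall x : T, faact (gact T) p x = 0) -> faact (gact P) p m = 0.
Proof.
move=> hp; suff : faact (gact Q) p m0 = 0.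
  by rewrite [LHS]prod_faact => /(congr1 snd).
have z1 : (faact (gact Q) p m0).1 = 0.
  by rewrite [faact (gact Q) p m0]prod_faact; exact: hp.
have [L [hL e]] : exists L : seq ({ffun 'I_n -> int} * Q),
    (forall y, y \in L -> composition r y.1 /\ transp y.1 y.2) /\
    \sum_(y <- L) y.2 = faact (gact Q) p m0.
  rewrite /faact; elim: p {hp z1} => [|[c u] p [L [hL e]]]; first by exists [::]; rewrite !big_nil.
  have [lam [cl tr]] := transp_word u.
  have el : lam =1 finfun lam by move=> i; rewrite ffunE.
  exists ((finfun lam, c *: wact (gact Q) u m0) :: L); rewrite !big_cons e; split=> // y.
  rewrite inE => /orP[/eqP->|/hL //]; split=> /=.
    split=> [i|]; first by rewrite ffunE; exact: cl.1.
    by rewrite -cl.2; apply: eq_bigr => i _; rewrite ffunE.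
  by apply: transported_ext el _; apply: transported_scale => // l d y'; exact: strict_spanZ.
rewrite -e in z1 *; set z := \sum_(y <- L) y.2 in z1 *.
pose f (lam : {ffun 'I_n -> int}) := \sum_(y <- L | y.1 == lam) y.2.
have trf (lam : {ffun 'I_n -> int}) : transp lam (f lam).
  rewrite /f big_seq_cond; elim/big_ind: _ => [|x y|y /andP[/hL[_ tr] /eqP <-] //].
    exact: transported0.
  exact: transported_add.
pose s := undup [seq y.1 | y <- L].
have zf : z = \sum_(lam <- s) f lam.
  rewrite /f (exchange_big_dep predT) //= /z big_seq [RHS]big_seq; apply: eq_bigr => y yL.
  have ys : y.1 \in s by rewrite mem_undup map_f.
  rewrite big_mkcond (bigD1_seq _ ys (undup_uniq _)) /= eqxx big1 ?addr0 // => lam /negPf nl.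
  by rewrite eq_sym nl.
have f1 : \sum_(lam <- s) (f lam).1 = 0.
  by rewrite -[RHS]z1 zf; elim: (s) => [|lam l IH]; rewrite ?big_nil // !big_cons IH.
have wf (lam : {ffun 'I_n -> int}) : wt (P := T) lam (f lam).1.
  by move=> i; have := transp_wt (trf lam) i => /(congr1 fst).
rewrite zf big1_seq // => lam /andP[_ ls].
have f0 := wt_independent (undup_uniq _) wf f1 ls.
apply: transp_graph (trf lam) f0.
by move: ls; rewrite mem_undup => /mapP[y /hL[cl _] ->].
Qed.

End OneVector.

(** x is a nonzero multiple of X b i (X (~~ b) i x), and p times the generator of X b i still kills
    the tensor space; so the claim descends to the weight of X (~~ b) i x, which is closer to
    [omega]. *)
Lemma wt_faact lam p (x : P) : (forall y : T, faact (gact T) p y = 0) ->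
  wt lam x -> faact (gact P) p x = 0.
Proof.
move=> hp wx; have [->|xn0] := eqVneq x 0; first by rewrite linear0.
have cl : composition r lam.
  by split=> [i|]; [case/andP: (wt_bounds n4 i wx xn0)|exact: wt_total wx xn0].
have [h ah e] := exists_height n4 rn r0 omega_total cl.
elim/(height_ind n4 rn r0 omega01 omega_total): h / ah lam p x hp wx {xn0} cl e =>
    [h h0|h b i ah hw IH] lam p x hp wx cl e.
  apply: omega_faact hp; apply: wt_ext wx => j.
  by rewrite -e (hwt0 n4 rn r0 omega_total h0).
have /and3P[_ /eqP z o] := hw; rewrite !e in z o.
have eS : src (~~ b) i = tgt b i by case: (b).
have eT : tgt (~~ b) i = src b i by case: (b).
have := XX_inv n4 (b := ~~ b) (i := i) wx; rewrite eT eS negbK => /(_ z) xE.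
pose g := if b then GE i else GF i.
have : faact (gact P) (fa_mul p [:: (1, [:: g])]) (X P (~~ b) i x) = 0.
  apply: (IH (shift lam (~~ b) i)).
  - by move=> y; rewrite faact_mul hp.
  - exact: wt_shift.
  - by apply: composition_shift; rewrite ?eS.
  by move=> j; rewrite (hwt_upd n4 rn r0 omega_total) /shift e.
rewrite faact_mul faact_word -[wact _ _ _]/(X P b i _) xE linearZ => /eqP.
by rewrite scaler_eq0 qint_eq0 => /orP[/eqP lt|/eqP //]; move: o; rewrite lt.
Qed.

Theorem tensor_faithful p : (forall y : T, faact (gact T) p y = 0) ->
  forall x : P, faact (gact P) p x = 0.
Proof.
move=> hp; pose S (l : seq 'I_n) (lam : {ffun 'I_n -> int}) (x : P) :=
  forall i, i \in l -> gact P (GK i) x = vv ^ lam i *: x.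
have KKP i j x : gact P (GK i) (gact P (GK j) x) = gact P (GK j) (gact P (GK i) x).
  have := gactP (Q1 r i j) x; rewrite /faact !big_cons big_nil /= scale1r addr0 scaleN1r.
  by move/eqP; rewrite subr_eq0 => /eqP.
(* The list l holds the nodes whose K_i is not yet known to act on x by a power of v; (Q16) removes
   them one at a time. *)
suff main (l : seq 'I_n) (lam : {ffun 'I_n -> int}) x :
    S [seq i <- enum 'I_n | i \notin l] lam x -> faact (gact P) p x = 0.
  move=> x; refine (main (enum 'I_n) [ffun=> 0] x _) => i.
  by rewrite mem_filter mem_enum.
elim: l lam x => [|i l IH] lam x Sx.
  apply: (wt_faact (lam := lam)) => // i; apply: Sx.
  by rewrite mem_filter mem_enum.
set l' := [seq j <- _ | _] in Sx.
have := gactP (Q16 r i) x; rewrite faact_prod => Qx.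
apply: (diagonalize (K := gact P (GK i))
  (f := faact (gact P) p) (S := S l' lam) (js := iota 0 r.+1)).
- move=> c y w Sy Sw j jl; rewrite linearD linearZ /= Sy // Sw // scalerDr !scalerA.
  by rewrite mulrC.
- by move=> y Sy j jl; rewrite KKP Sy // linearZ.
- move=> k y Sy Ky; apply: (IH [ffun j => if j == i then k%:Z else lam j]) => j.
  rewrite mem_filter ffunE => /andP[jl _]; have [->|ji] := eqVneq j i; first exact: Ky.
  by apply: Sy; rewrite mem_filter inE negb_or ji jl mem_enum.
- exact: iota_uniq.
- exact: Sx.
rewrite -[RHS]Qx; elim: (iota _ _) => //= k ks ->.
by rewrite /faact !big_cons big_nil /= addr0 scale1r scaleNr.
Qed.

End Faithful.

(** * Translation to coefficients and to the ideal *)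

Section ActionOnTensors.
Variables (n r : nat).
Hypothesis n4 : (3 < n)%N.
Local Notation T := (tensor_module r n4).
Implicit Types p : fa n.

Lemma tact_size p s y : y \in tact p s -> size y.2 = size s.
Proof.
have ws w z : z \in tword w s -> size z.2 = size s.
  elim: w z => [|g w IH] z /=; first by rewrite inE => /eqP->.
  by case/flattenP => _ /mapP[u /IH us ->] /mapP[v /tgen_size vs -> /=]; rewrite vs.
by case/flattenP => _ /mapP[x _ ->] /mapP[z /ws zs ->].
Qed.

Lemma acts_zeroP p : acts_zero r p <-> forall x : T, faact (gact T) p x = 0.
Proof.
split=> [h x|h s sr s'].
  have [q ->] := cls_surj x; rewrite clsE linear_sum big1 // => y _.
  rewrite linearZ /=.
  have [sr|/fgen_size->] := eqVneq (size y.2) r; last by rewrite linear0 scaler0.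
  rewrite tensor_faact (_ : cls _ _ = 0) ?scaler0 //.
  by apply/cls_eq0 => s' _; exact: h.
have [s'r|s'r] := eqVneq (size s') r; last first.
  rewrite /vec_coef big1_seq // => y /andP[/eqP ys /tact_size].
  by rewrite ys sr => e; rewrite e eqxx in s'r.
have := h (fgen _ s); rewrite [LHS]tensor_faact => /cls_eq0 z.
by apply: z; apply/eqP.
Qed.

Lemma faact_coef (P : schur_module n r) p q x : (forall w, fa_coef p w = fa_coef q w) ->
  faact (gact P) p x = faact (gact P) q x.
Proof.
move=> e; apply/eqP; rewrite -subr_eq0; apply/eqP.
have <- : \sum_(y <- p ++ fscale (- 1) q) y.1 *: wact (gact P) y.2 x =
    faact (gact P) p x - faact (gact P) q x.
  rewrite big_cat big_map /faact -sumrN; congr (_ + _).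
  by apply: eq_bigr => y _; rewrite /= mulN1r scaleNr.
apply: (sum_coef_eq0 (fun w => wact (gact P) w x)) => w.
by rewrite -[LHS]/(fcoef _ _) fcoef_cat fcoef_scale -!fa_coefE e mulN1r subrr.
Qed.

Lemma ideal_faact (P : schur_module n r) p x : in_rel_ideal r p -> faact (gact P) p x = 0.
Proof.
move=> [q [hq e]]; rewrite (faact_coef _ e) /ideal_expand.
rewrite /faact big_flatten big_map big1_seq // => -[[[c u] rho] w] /andP[_ /hq /= rel].
rewrite big_map /=.
rewrite (eq_bigr (fun y => c *: wact (gact P) u (y.1 *: wact (gact P) y.2 (wact (gact P) w x)))).
  by rewrite -scaler_sumr -linear_sum -/(faact _ _ _) gactP // linear0 scaler0.
by move=> y _; rewrite !wact_cat linearZ /= scalerA.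
Qed.

End ActionOnTensors.

Theorem theorem1p6p1 (n r : nat) (hr : (3 <= r)%N) (hn : (r < n)%N) (p : fa n) :
  acts_zero r p <-> @in_rel_ideal n r p.
Proof.
have n4 : (3 < n)%N by exact: leq_ltn_trans hr hn.
rewrite (acts_zeroP r n4); split=> [h|h x]; last exact: ideal_faact.
(* Faithfulness is applied to the unit of the presented algebra. *)
apply: regular_faact; apply: tensor_faithful h _ => //; exact: leq_trans hr.
Qed.
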